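(* Let $1\le p\le\infty$, $1/p+1/q=1$, $0<\delta\le\rho\le 1$. For every $j\in\mathbb{N}$ let $\widetilde\varphi_j\in\mathcal{D}'$ and $\varphi_j\in\mathcal{T}_{M^j}$ be such that $$\widehat{\varphi_j}(k)\,\widehat{\widetilde\varphi_j}(k)=1\quad\text{for all } k\in D(\rho M^j).$$ Then, for any $j\in\mathbb{N}$ and any $f\in B_{\widetilde\varphi_j,p}$, $$\|f-Q_j(f,\varphi_j,\widetilde\varphi_j)\|_p\le C\Big(E_{\delta M^j}(f)_p+K_{\varphi_j,q}\big(\widetilde E_{M^j}(\widetilde\varphi_j*f)_p+\|\widetilde\varphi_j*(f-T_j)\|_p\big)\Big),$$ where $T_j\in\mathcal{T}_{\rho M^j}$ is such that $\|f-T_j\|_p\le c(d,p,\delta)E_{\delta M^j}(f)_p$ (with $c(d,p,\delta)$ a positive constant depending only on $d,p,\delta$). If, additionally, $\widetilde\varphi_j\in L_q$, then for any $f\in L_p$, $$\|f-Q_j(f,\varphi_j,\widetilde\varphi_j)\|_p\le C\big(1+K_{\varphi_j,q}\|\widetilde\varphi_j\|_{\mathcal{L}_{q,j}}\big)E_{\delta M^j}(f)_p.$$ Here the constant $C>0$ does not depend on $f$ and $j$.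
   Context: $\mathbb{T}^d=\mathbb{R}^d/\mathbb{Z}^d$, identified with $[-1/2,1/2)^d$ where needed. $L_p=L_p(\mathbb{T}^d)$ with norm $\|\cdot\|_p$; for $p=\infty$ the space of approximated functions $L_\infty$ is replaced by $C(\mathbb{T}^d)$. $B$ is the space of bounded measurable functions on $\mathbb{T}^d$. $\widehat f(k)=\int_{\mathbb{T}^d}f(x)e^{-2\pi i(k,x)}dx$. $\mathcal{D}'$ is the space of periodic distributions (continuous linear functionals on $C^\infty(\mathbb{T}^d)$), with Fourier coefficients $\widehat{\widetilde\varphi}(k)=\langle e^{-2\pi i(k,\cdot)},\widetilde\varphi\rangle$. $M=\mathrm{diag}(m_1,\dots,m_d)$ is a fixed diagonal matrix with integers $m_i$, $|m_i|>1$, and $m=|\det M|$. For a real diagonal matrix $A$ (such as $M^j$ or $\delta M^j$): $D(A)=(A[-1/2,1/2)^d)\cap\mathbb{Z}^d$; $\mathcal{T}_A$ is the set of trigonometric polynomials with frequencies in $D(A)$; $E_A(f)_p=\inf\{\|f-T\|_p: T\in\mathcal{T}_A\}$; for $g\in B$, $\widetilde E_A(g)_p=\inf\{\|t-T\|_p: t,T\in\mathcal{T}_A,\ t(x)\le g(x)\le T(x)\ \forall x\in\mathbb{T}^d\}$ (inequalities between real-valued functions). For $\widetilde\varphi\in\mathcal{D}'$, $B_{\widetilde\varphi,p}$ is the class of $f\in L_p$ such that $\sum_{\ell\in\mathbb{Z}^d}\widehat{\widetilde\varphi}(\ell)\widehat f(\ell)e^{2\pi i(\ell,x)}$ is the Fourier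 series of a bounded function, which is denoted $\widetilde\varphi*f$. If $\widetilde\varphi\in L_q$, $1/p+1/q=1$, then $B_{\widetilde\varphi,p}=L_p$. The quasi-interpolation operator is $$Q_j(f,\varphi_j,\widetilde\varphi_j)(x)=\frac1{m^j}\sum_{k\in D(M^j)}(\widetilde\varphi_j*f)(M^{-j}k)\,\varphi_j(x-M^{-j}k).$$ For a trigonometric polynomial $\varphi$, $K_{\varphi,q}=\sup_{\|f\|_q\le1}\|\varphi*f\|_q$, where $*$ is convolution on $\mathbb{T}^d$. For $\widetilde\varphi_j\in L_q$, $$\|\widetilde\varphi_j\|_{\mathcal{L}_{q,j}}=\Big(m^j\int_{M^{-j}\mathbb{T}^d}\Big(\frac1{m^j}\sum_{k\in D(M^j)}|\widetilde\varphi_j(x-M^{-j}k)|\Big)^q dx\Big)^{1/q}\ (1\le q<\infty),$$ $$\|\widetilde\varphi_j\|_{\mathcal{L}_{\infty,j}}=\frac1{m^j}\sup_{x\in\mathbb{R}^d}\sum_{k\in D(M^j)}|\widetilde\varphi_j(x-M^{-j}k)|,$$ with $M^{-j}\mathbb{T}^d=M^{-j}[-1/2,1/2)^d$. In the hypothesis $\widetilde\varphi_j\in L_q$ with $q=\infty$, $L_\infty$ is the usual space of essentially bounded functions. *)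

(* Defs.v *)
From HB Require Import structures.
From mathcomp Require Import all_boot all_order all_algebra.
From mathcomp Require Import complex.
From mathcomp Require Import all_classical all_reals all_analysis.

Set Implicit Arguments.
Unset Strict Implicit.
Unset Printing Implicit Defensive.
Import Order.TTheory GRing.Theory Num.Theory.
Import numFieldNormedType.Exports.

Local Open Scope classical_set_scope.
Local Open Scope complex_scope.
Local Open Scope ring_scope.

Definition colvec_display : measure_display.
Proof. exact: default_measure_display. Qed.

Section colvec_measurable.
Context {R : realType} {d : nat}.

Let coord (i : 'I_d) (x : 'cV[R]_d) : measurableTypeR R := x i 0.

Let colvec_set0 : g_sigma_preimage coord set0.
Proof. exact: sigma_algebra0. Qed.

Let colvec_setC A : g_sigma_preimage coord A -> g_sigma_preimage coord (~` A).
Proof. exact: sigma_algebraC. Qed.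

Let colvec_bigcup (F : (set 'cV[R]_d)^nat) :
  (forall i, g_sigma_preimage coord (F i)) ->
  g_sigma_preimage coord (\bigcup_i (F i)).
Proof. exact: sigma_algebra_bigcup. Qed.

(* The sigma-algebra generated by the coordinates, i.e. the Borel sets. *)
HB.instance Definition _ := @isMeasurable.Build colvec_display 'cV[R]_d
  (g_sigma_preimage coord) colvec_set0 colvec_setC colvec_bigcup.

Lemma measurable_coord (i : 'I_d) :
  measurable_fun [set: 'cV[R]_d] (fun x => x i 0 : measurableTypeR R).
Proof.
move=> _ Y mY; rewrite setTI; apply: sub_sigma_algebra => /=.
rewrite -bigcup_seq/=; exists i => /=; first by rewrite mem_index_enum.
by exists Y => //; rewrite setTI.
Qed.

Lemma measurable_fun_colvec dT (T : measurableType dT) (f : T -> 'cV[R]_d) :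
  (forall i, measurable_fun [set: T] (fun t => f t i 0 : measurableTypeR R)) ->
  measurable_fun [set: T] f.
Proof.
move=> mf _ Y mY; rewrite setTI.
suff : measurable `<=` image_set_system [set: T] f measurable.
  by move=> /(_ _ mY); rewrite /image_set_system/= setTI.
apply: smallest_sub; first exact/sigma_algebra_image/sigma_algebra_measurable.
rewrite -bigcup_seq/=; apply: bigcup_sub => i _ A [B mB <-].
by rewrite /image_set_system/= !setTI; have := mf i measurableT _ mB; rewrite setTI.
Qed.

End colvec_measurable.

Section torus_measure.
Context {R : realType}.

Definition interval_measure : set (measurableTypeR R) -> \bar R :=
  mrestr (@lebesgue_measure R) (measurable_itv `[(- 2^-1 : R), 2^-1[).

HB.instance Definition _ := Measure.on interval_measure.

Let interval_measure_setT : interval_measure setT = 1%E.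
Proof.
rewrite /interval_measure /mrestr setTI lebesgue_measure_itv/= lte_fin.
have h : 0 < 2^-1 :> R by rewrite invr_gt0.
by rewrite (lt_trans _ h) ?oppr_lt0// opprK -EFinD -div1r -splitr.
Qed.

HB.instance Definition _ := Measure_isProbability.Build _ _ _
  interval_measure interval_measure_setT.

Definition colvec_cons d (xv : measurableTypeR R * 'cV[R]_d) : 'cV[R]_d.+1 :=
  \col_i oapp (fun j => xv.2 j 0) xv.1 (unlift ord0 i).

Let measurable_colvec_cons d : measurable_fun setT (@colvec_cons d).
Proof.
apply: measurable_fun_colvec => i.
under eq_fun => xv do rewrite mxE.
case: (unliftP ord0 i) => [j|] _ /=; last exact: measurable_fst.
apply: (measurableT_comp (measurable_coord j)); exact: measurable_snd.
Qed.

HB.instance Definition _ d := isMeasurableFun.Build _ _ _ _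
  (@colvec_cons d) (@measurable_colvec_cons d).

(* Lebesgue measure on [-1/2, 1/2)^d, as an iterated product. *)
Fixpoint torus_measure (d : nat) : probability 'cV[R]_d R :=
  if d is d'.+1
  then distribution (interval_measure \x torus_measure d')%E (@colvec_cons d')
  else dirac (0 : 'cV[R]_0).

End torus_measure.

(* Functions on T^d = R^d / Z^d are Z^d-periodic functions on R^d. *)

Section torus_functions.
Context {R : realType} {d : nat}.
Local Notation C := R[i].
Local Notation mu := (@torus_measure R d).
Implicit Types (f g h u v : 'cV[R]_d -> C) (p q : \bar R) (k : 'cV[int]_d).

Definition zvec k : 'cV[R]_d := map_mx intr k.

Definition zperiodic f := forall k x, f (x + zvec k) = f x.

Definition cmeasurable f :=
  measurable_fun [set: 'cV[R]_d] (fun x => complex.Re (f x) : R) /\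
  measurable_fun [set: 'cV[R]_d] (fun x => complex.Im (f x) : R).

Definition ccontinuous f :=
  continuous (fun x => complex.Re (f x) : R) /\
  continuous (fun x => complex.Im (f x) : R).

Definition cintegral f : C :=
  (\int[mu]_x complex.Re (f x)) +i* (\int[mu]_x complex.Im (f x)).

Definition Lpnorm p f : \bar R := Lnorm mu p (fun x => (Normc.normc (f x))%:E).
Arguments Lpnorm p%_ereal_scope f%_ring_scope.

Definition in_Lp p f := [/\ zperiodic f, cmeasurable f & (Lpnorm p f < +oo)%E].

(* The space of approximated functions: L_p, replaced by C(T^d) if p = oo. *)
Definition in_Xp p f :=
  if p == +oo%E then zperiodic f /\ ccontinuous f else in_Lp p f.

(* The class B: bounded everywhere, not just almost everywhere. *)
Definition in_B f :=
  [/\ zperiodic f, cmeasurable f & exists b : R, forall x, Normc.normc (f x) <= b].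

Definition cexp k (x : 'cV[R]_d) : C :=
  let t := 2 * pi * \sum_i (k i 0)%:~R * x i 0 in cos t +i* sin t.

Definition fourier f k : C := cintegral (fun x => f x * cexp (- k) x).

Definition convolution f g x : C := cintegral (fun y => f (x - y) * g y).

(* Smooth functions on T^d, and their iterated partial derivatives along a
   list of directions. *)
Definition partial (s : seq 'I_d) (w : 'cV[R]_d -> R) : 'cV[R]_d -> R :=
  foldr (fun i w' x => 'D_(delta_mx i 0) w' x) w s.

Definition smooth_real (w : 'cV[R]_d -> R) := forall s,
  continuous (partial s w) /\
  forall i x, derivable (partial s w) x (delta_mx i 0).

Definition smooth u :=
  [/\ zperiodic u, smooth_real (fun x => complex.Re (u x)) &
      smooth_real (fun x => complex.Im (u x))].

Definition cpartial s u x : C :=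
  partial s (fun x => complex.Re (u x)) x +i*
  partial s (fun x => complex.Im (u x)) x.

(* Periodic distributions. Only the values on smooth functions matter;
   continuity is with respect to the topology of uniform convergence of all
   the partial derivatives. *)
Record periodic_distribution := PeriodicDistribution {
  pairing :> ('cV[R]_d -> C) -> C ;
  pairing_linear : forall (a : C) u v, smooth u -> smooth v ->
    pairing (fun x => a * u x + v x) = a * pairing u + pairing v ;
  pairing_continuous : forall u, smooth u -> forall e : R, 0 < e ->
    exists N : nat, exists2 eta : R, 0 < eta & forall v, smooth v ->
      (forall s, (size s <= N)%N ->
         forall x, Normc.normc (cpartial s v x - cpartial s u x) < eta) ->
      Normc.normc (pairing v - pairing u) < e }.

Definition dfourier (F : periodic_distribution) k : C := F (cexp (- k)).

(* The distribution F is (integration against) the function h. *)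
Definition represents (F : periodic_distribution) h :=
  forall u, smooth u -> F u = cintegral (fun x => u x * h x).

(* g is the bounded function F * f; thus f is in the class B_{F,p} iff
   in_Xp p f and is_dconv F f g for some g. *)
Definition is_dconv (F : periodic_distribution) f g :=
  in_B g /\ forall k, fourier g k = dfourier F k * fourier f k.

Definition cube : set 'cV[R]_d :=
  [set x | forall i, - 2^-1 <= x i 0 < 2^-1].

Definition freqs (A : 'M[R]_d) : set 'cV[int]_d :=
  [set k | exists2 x, cube x & zvec k = A *m x].

Definition trigpoly (A : 'M[R]_d) : set ('cV[R]_d -> C) :=
  [set T | exists c : 'cV[int]_d -> C,
     T = fun x => \sum_(k \in freqs A) c k * cexp k x].

Definition best_approx (A : 'M[R]_d) p f : \bar R :=
  ereal_inf [set Lpnorm p (f \- T) | T in trigpoly A].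

(* In the order of R[i], x <= y means that y - x is real and nonnegative; hence
   t, g and T are all real-valued below (and the value is +oo if g is not). *)
Definition best_onesided_approx (A : 'M[R]_d) p g : \bar R :=
  ereal_inf [set Lpnorm p (tT.1 \- tT.2) | tT in
    [set tT | [/\ trigpoly A tT.1, trigpoly A tT.2 &
      forall x, [/\ tT.1 x \is Num.real, tT.1 x <= g x & g x <= tT.2 x]]]].

Definition conv_norm (phi : 'cV[R]_d -> C) q : \bar R :=
  ereal_sup [set Lpnorm q (convolution phi f) | f in
    [set f | in_Lp q f /\ (Lpnorm q f <= 1)%E]].

Section dilation.
Variables (M : 'M[int]_d) (j : nat).

Definition dilation : 'M[R]_d := map_mx intr M ^+ j.

Definition absdet : R := `|\det M|%:~R.

Definition node k : 'cV[R]_d := invmx dilation *m zvec k.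

(* The quasi-interpolation operator; g is the bounded function F * f of is_dconv. *)
Definition quasi_interp g phi x : C :=
  (absdet ^- j)%:C *
  \sum_(k \in freqs dilation) g (node k) * phi (x - node k).

Definition node_mean h (x : 'cV[R]_d) : R :=
  absdet ^- j * \sum_(k \in freqs dilation) Normc.normc (h (x - node k)).

(* The cell M^{-j}[-1/2,1/2)^d is contained in [-1/2,1/2)^d, so that integrating
   over it with respect to torus_measure is integrating over it with respect
   to the Lebesgue measure. *)
Definition Lqj_norm q h : \bar R :=
  match q with
  | r%:E => ((absdet ^+ j)%:E *
      \int[mu]_(x in [set invmx dilation *m y | y in cube])
        (node_mean h x `^ r)%:E) `^ r^-1
  | +oo => ereal_sup [set (node_mean h x)%:E | x in [set: 'cV[R]_d]]
  | -oo => 0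
  end%E.

End dilation.

End torus_functions.

Arguments Lpnorm {R d} p%_ereal_scope f%_ring_scope.
Arguments is_dconv {R d} F f%_ring_scope g%_ring_scope.

Arguments periodic_distribution R d : clear implicits.

(* Main.v *)
From HB Require Import structures.
Require Import Defs.
From mathcomp Require Import all_boot all_order all_algebra.
From mathcomp Require Import complex.
From mathcomp Require Import all_classical all_reals all_analysis.
From mathcomp Require Import measurable_realfun ess_sup_inf zify ring lra.

Set Implicit Arguments.
Unset Strict Implicit.
Unset Printing Implicit Defensive.
Import Order.TTheory GRing.Theory Num.Theory.
Import numFieldNormedType.Exports.

Local Open Scope classical_set_scope.
Local Open Scope ring_scope.

(** Write [A] for the [j]-th power of the dilation, [D] for the integer points of its
   cell, [x_k] for the nodes and [K] for [conv_norm phi q]. The operator first samples a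
   function at the nodes and then synthesizes the samples [w_k] into the mean over [k]
   of [w_k * phi (x - x_k)]. The error is controlled by two facts.

   Reproduction ([synthesis_exact]). Exponentials with distinct frequencies in [D] are
   orthogonal on the nodes. As the coefficients of [phi] and [psi] are inverse to each
   other on the frequencies of [rho A], the samples of [P = psi * T] are synthesized
   into [T] itself for every polynomial [T] with these frequencies. Hence
   [f - Q f = (f - T) - synthesis of the samples of (psi * f - P)].

   Stability ([synthesis_bound]). The L_p-norm of a synthesized function is at most
   [3 ^ d * K] times the l_p-mean of its samples. By duality ([Lpnorm_dual_le]) it is
   enough to pair it with a bounded function [g], and the pairing only sees the samples
   of the polynomial [phi * g] (with [g] reflected), whose L_q-norm is at most
   [K * |g|_q]. Sampling a polynomial with frequencies in [D] is bounded from L_q to l_q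
   ([vp_sampling], a Marcinkiewicz-Zygmund inequality): the polynomial is reproduced by
   convolution with [vp_kernel], which is dominated by [3 ^ d] times the Fejer kernel of
   [D]; the latter is nonnegative with integral [1], and its translates by the nodes have
   mean [1], so Schur's test applies at every exponent with a constant that depends on
   [d] only. This is why the final constant does not depend on [j].

   It remains to estimate the samples of [psi * f - P]. For the first inequality, let
   [t <= g <= t'] be polynomials with frequencies in [D], where [g = psi * f]. At the
   nodes [g - t] is at most [t' - t], a polynomial, and [P - t] is the convolution of
   [vp_kernel] with [g - t - psi * (f - T)], because both have the same Fourier
   coefficients; both can thus be sampled ([onesided_samples]). For the second one,
   [psi * f - P = h * (f - T)] with [h] in L_q, and the samples of such a convolution
   are bounded by the L_q-norm of the mean of [|h|] over the nodes times the L_p-norm of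
   [f - T] ([node_pairing_convolution_le]). This mean is periodic with respect to the
   nodes, whose translates of the cell tile the torus, so that its norm is at most the
   one computed on a single cell ([Lpnorm_mean_on_nodes_cell]).

   Both bounds are affine in the error of approximation, so they pass to the infima
   that define the best approximations ([le_affine_ereal_inf]). *)

(** * Invariance of the measure of the torus *)

Section translation.
Context {R : realType}.
Local Open Scope ereal_scope.
Local Notation mu := (@lebesgue_measure R).
Local Notation im := (@interval_measure R).

Lemma lebesgue_measure_shift (a : R) (A : set (measurableTypeR R)) : measurable A ->
  pushforward mu (fun x : measurableTypeR R => (x + a)%R : measurableTypeR R) A = mu A.
Proof.
move=> mA.
have mf : measurable_fun setT (fun x : measurableTypeR R => (x + a)%R : measurableTypeR R).
  exact: measurable_funD.
pose f : {mfun measurableTypeR R >-> measurableTypeR R} :=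
   HB.pack (fun x : measurableTypeR R => (x + a)%R : measurableTypeR R)
     (isMeasurableFun.Build _ _ _ _ _ mf).
apply/esym/(@lebesgue_measure_unique R (pushforward mu f)) => //= _ [[x y]] _ <-.
rewrite /pushforward /=.
have -> : (fun z : R => (z + a)%R) @^-1` `]x, y] = [set` `](x - a)%R, (y - a)%R]].
  by apply/seteqP; split=> z /=; rewrite !in_itv/= ltrBlDr lerBrDr.
rewrite !lebesgue_measure_itv/= !lte_fin ltrD2r.
by case: ifPn => // _; congr (_%:E); rewrite opprB addrA subrK.
Qed.

Lemma ge0_integral_lebesgue_shift (a : R) (D : set R) (f : R -> \bar R) :
  measurable (D : set (measurableTypeR R)) ->
  measurable_fun setT (f : measurableTypeR R -> \bar R) -> (forall x, 0 <= f x) ->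
  \int[mu]_(x in D) f x = \int[mu]_(x in [set x | D (x + a)%R]) f (x + a)%R.
Proof.
move=> mD mf f0.
have mt : measurable_fun setT (fun x : measurableTypeR R => (x + a)%R : measurableTypeR R).
  exact: measurable_funD.
rewrite -(@ge0_integral_pushforward _ _ (measurableTypeR R) (measurableTypeR R) R _ mt mu D f)//.
- by apply: eq_measure_integral => //= A mA _; exact/esym/lebesgue_measure_shift.
- exact: measurable_funTS.
Qed.

Lemma integral_interval_measure (f : R -> \bar R) :
  measurable_fun setT (f : measurableTypeR R -> \bar R) -> (forall x, 0 <= f x) ->
  \int[im]_x f x = \int[mu]_(x in `[(- 2^-1)%R, 2^-1%R[) f x.
Proof.
move=> mf f0; set D := [set` _].
have mD : measurable (D : set (measurableTypeR R)) by exact: measurable_itv.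
rewrite -(setUv D) ge0_integral_setU//=.
- rewrite [X in _ + X](_ : _ = 0) ?adde0; last first.
    transitivity (\int[im]_(x in ~` D) `|f x|).
      by apply: eq_integral => x _; rewrite gee0_abs.
    apply: integral_abs_eq0; first exact: measurableC.
      exact: measurable_funTS.
    by suff : mu (~` D `&` D) = 0 by []; rewrite setICl measure0.
  apply: eq_measure_integral => A mA AD /=.
  by rewrite /interval_measure /mrestr setIidl.
- exact: measurableC.
- by rewrite setUv.
- exact/disj_setPCl.
Qed.

(** Translating by an integer reduces [a] to its fractional part [r]; the part of
   [[r, r + 1)] beyond [1] is then moved back by one period. *)
Lemma integral_period (f : R -> \bar R) (a : R) :
  measurable_fun setT (f : measurableTypeR R -> \bar R) -> (forall x, 0 <= f x) ->
  (forall x, f (x + 1)%R = f x) ->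
  \int[mu]_(x in `[a, (a + 1)%R[) f x = \int[mu]_(x in `[0%R, 1%R[) f x.
Proof.
move=> mf f0 f1.
have fZ (n : int) x : f (x + n%:~R)%R = f x.
  have fN (m : nat) y : f (y + m%:R)%R = f y.
    by elim: m => [|m IH] in y *; rewrite ?addr0// -natr1 addrA f1.
  case: n => m; first exact: fN.
  by rewrite NegzE mulrNz -[in RHS](subrK (m.+1%:~R : R) x) fN.
set r := (a - (Num.floor a)%:~R)%R.
have r0 : (0 <= r)%R by rewrite subr_ge0 floor_le.
have r1 : (r < 1)%R by rewrite ltrBlDr addrC -[X in (_ < _ + X)%R]/(1%:~R) -intrD floorD1_gt.
have mI (i : interval R) : measurable ([set` i] : set (measurableTypeR R)) by exact: measurable_itv.
have mfS (D : set (measurableTypeR R)) : measurable_fun D f by exact: measurable_funTS.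
rewrite (@ge0_integral_lebesgue_shift (Num.floor a)%:~R)//.
under eq_integral do rewrite fZ.
have -> : [set x : R | [set` `[a, (a + 1)%R[] (x + (Num.floor a)%:~R)%R] =
          [set` `[r, (r + 1)%R[].
  apply/seteqP; split=> z /=; rewrite !in_itv/= -lerBlDr -ltrBrDr.
    by rewrite addrAC.
  by rewrite [(a + 1 - _)%R]addrAC.
rewrite (_ : [set` `[r, (r + 1)%R[] = [set` `[r, 1%R[] `|` [set` `[1%R, (r + 1)%R[]); last first.
  apply/seteqP; split=> z /=; rewrite !in_itv/=.
    by move=> /andP[-> ->]; case: (ltP z 1%R) => ?; [left|right].
  move=> [/andP[-> z1]|/andP[z1 ->]]; rewrite ?andbT/=.
    by rewrite (lt_le_trans z1)// lerDr.
  by rewrite (le_trans (ltW r1)).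
rewrite ge0_integral_setU//=; last first.
  apply/disj_setPS => z [] /=; rewrite !in_itv/= => /andP[_ z1] /andP[z1' _].
  by move: (lt_le_trans z1 z1'); rewrite ltxx.
rewrite [X in _ + X](@ge0_integral_lebesgue_shift 1%R)//.
under [X in _ + X]eq_integral do rewrite f1.
have -> : [set x : R | [set` `[1%R, (r + 1)%R[] (x + 1)%R] = [set` `[0%R, r[].
  by apply/seteqP; split=> z /=; rewrite !in_itv/= ltrD2r -lerBlDr subrr.
rewrite addeC -ge0_integral_setU//=; last first.
  apply/disj_setPS => z [] /=; rewrite !in_itv/= => /andP[_ z1] /andP[z1' _].
  by move: (lt_le_trans z1 z1'); rewrite ltxx.
congr (integral _ _ _); apply/seteqP; split=> z /=; rewrite !in_itv/=.
  move=> [/andP[-> z1]|/andP[z1 ->]]; rewrite ?andbT/=; first exact: lt_trans r1.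
  exact: le_trans z1.
by move=> /andP[-> ->]; case: (ltP z r) => ?; [left|right].
Qed.

Lemma interval_measure_shift (a : R) (f : R -> \bar R) :
  measurable_fun setT (f : measurableTypeR R -> \bar R) -> (forall x, 0 <= f x) ->
  (forall x, f (x + 1)%R = f x) ->
  \int[im]_x f (x + a)%R = \int[im]_x f x.
Proof.
move=> mf f0 f1.
have half : (2^-1 = - 2^-1 + 1 :> R)%R by lra.
have mt : measurable_fun setT (fun x : measurableTypeR R => (x + a)%R : measurableTypeR R).
  exact: measurable_funD.
rewrite !integral_interval_measure//; last exact: (measurableT_comp mf mt).
rewrite [X in `[_, X[]half [in RHS]integral_period//.
rewrite -(@integral_period f (- 2^-1 + a)%R)//.
rewrite [RHS](@ge0_integral_lebesgue_shift a)//.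
rewrite [X in _ = integral _ X _](_ : _ = [set` `[(- 2^-1)%R, (- 2^-1 + 1)%R[])//.
by apply/seteqP; split=> z /=; rewrite !in_itv/= lerD2r [(_ + a + 1)%R]addrAC ltrD2r.
Qed.

Lemma interval_measure_opp (f : R -> \bar R) :
  measurable_fun setT (f : measurableTypeR R -> \bar R) -> (forall x, 0 <= f x) ->
  \int[im]_x f (- x)%R = \int[im]_x f x.
Proof.
move=> mf f0.
have mt : measurable_fun setT (-%R : measurableTypeR R -> measurableTypeR R) by [].
rewrite !integral_interval_measure//; last exact: (measurableT_comp mf mt).
have mfS (g : R -> \bar R) (D : set (measurableTypeR R)) :
    measurable_fun setT (g : measurableTypeR R -> \bar R) ->
    measurable_fun D (g : measurableTypeR R -> \bar R).
  by move=> mg; exact: measurable_funTS.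
rewrite [LHS]integral_itv_bndoo; last exact: mfS (measurableT_comp mf mt).
rewrite [RHS]integral_itv_bndoo; last exact: mfS.
transitivity (\int[pushforward mu (-%R : measurableTypeR R -> measurableTypeR R)]_(x in
    [set` `](- 2^-1)%R, 2^-1%R[]) f x); last first.
  by apply: eq_measure_integral => //= A mA _; exact: lebesgue_measureN.
rewrite ge0_integral_pushforward//=; last exact: mfS.
by rewrite opp_preimage_itvbndbnd /= opprK.
Qed.

End translation.

Section torus_invariance.
Context {R : realType}.
Local Open Scope ereal_scope.
Local Notation im := (@interval_measure R).

Definition operiodic d (G : 'cV[R]_d -> \bar R) :=
  forall (k : 'cV[int]_d) x, G (x + zvec k)%R = G x.

Lemma ge0_integral_torusS d (G : 'cV[R]_d.+1 -> \bar R) :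
  measurable_fun setT G -> (forall x, 0 <= G x) ->
  \int[torus_measure d.+1]_x G x =
  \int[im]_t \int[torus_measure d]_v G (colvec_cons (t, v)).
Proof.
move=> mG G0.
rewrite ge0_integral_distribution//.
rewrite (fubini_tonelli1 (G \o @colvec_cons R d))//; last by move=> x; exact: G0.
apply: measurableT_comp => //; exact: measurable_funPT.
Qed.

Lemma measurable_addl d (a : 'cV[R]_d) : measurable_fun setT (fun x => a + x)%R.
Proof.
apply: measurable_fun_colvec => i; under eq_fun do rewrite mxE.
by apply: measurable_funD => //; exact: measurable_coord.
Qed.

Lemma measurable_oppv d : measurable_fun setT (fun x : 'cV[R]_d => - x)%R.
Proof.
apply: measurable_fun_colvec => i; under eq_fun do rewrite mxE.
by apply: measurableT_comp => //; exact: measurable_coord.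
Qed.

Lemma colvec_consD1 d (t : R) (v : 'cV[R]_d) :
  colvec_cons ((t + 1)%R, v) = (colvec_cons (t, v) + zvec (delta_mx ord0 ord0))%R.
Proof.
apply/matrixP => i j; rewrite !mxE ord1 eqxx andbT.
by case: (unliftP ord0 i) => [l ->|->] //=; rewrite addr0.
Qed.

Lemma colvec_consDz d (t : R) (v : 'cV[R]_d) (k : 'cV[int]_d) :
  colvec_cons (t, (v + zvec k)%R) =
  (colvec_cons (t, v) +
    zvec (\col_i oapp (fun j => k j ord0) 0%R (unlift ord0 i)))%R.
Proof.
apply/matrixP => i j; rewrite !mxE.
by case: (unliftP ord0 i) => [l _|_] /=; rewrite ?mxE ?ord1// addr0.
Qed.

(** A map of the torus acting on each coordinate separately preserves the
   measure as soon as each of its components does: integrate out one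
   coordinate at a time. *)
Lemma ge0_integral_torus_coordwise d (tau : 'I_d -> R -> R)
    (G : 'cV[R]_d -> \bar R) :
  (forall i, measurable_fun setT (tau i : measurableTypeR R -> measurableTypeR R)) ->
  (forall i (f : R -> \bar R),
    measurable_fun setT (f : measurableTypeR R -> \bar R) -> (forall x, 0 <= f x) ->
    (forall x, f (x + 1)%R = f x) -> \int[im]_x f (tau i x) = \int[im]_x f x) ->
  measurable_fun setT G -> (forall x, 0 <= G x) -> operiodic G ->
  \int[torus_measure d]_x G (\col_i tau i (x i 0%R)) = \int[torus_measure d]_x G x.
Proof.
elim: d tau G => [|d IH] tau G mtau tauP mG G0 pG.
  by apply: eq_integral => x _; congr G; apply/matrixP => -[].
have mtau' : measurable_fun setT (fun x : 'cV[R]_d.+1 => \col_i tau i (x i 0))%R.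
  apply: measurable_fun_colvec => i; under eq_fun do rewrite mxE.
  by apply: (measurableT_comp (mtau i)); exact: measurable_coord.
rewrite !ge0_integral_torusS//; last exact: (measurableT_comp mG mtau').
have colE t v : (\col_i tau i (colvec_cons (t, v) i 0) =
    colvec_cons (tau ord0 t, \col_i tau (lift ord0 i) (v i 0)) :> 'cV[R]_d.+1)%R.
  apply/matrixP => i j; rewrite !mxE.
  by case: (unliftP ord0 i) => [l ->|->] /=; rewrite ?mxE.
under eq_integral => t _ do under eq_integral => v _ do rewrite colE.
have mGt t : measurable_fun setT (fun v => G (colvec_cons (t, v))).
  apply: (measurableT_comp mG); apply: (measurableT_comp (f := @colvec_cons R d)) => //.
transitivity (\int[im]_t \int[torus_measure d]_v G (colvec_cons (tau ord0 t, v))).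
  apply: eq_integral => t _.
  rewrite -[RHS](IH (fun i => tau (lift ord0 i)))//.
  - by move=> i; exact: tauP.
  - by move=> k x; rewrite colvec_consDz pG.
rewrite (tauP ord0 (fun t => \int[torus_measure d]_v G (colvec_cons (t, v))))//.
- apply: (measurable_fun_fubini_tonelli_F (m2 := torus_measure d) (G \o @colvec_cons R d)) => //.
    exact: measurableT_comp.
  by move=> x; exact: G0.
- by move=> t; exact: integral_ge0.
- by move=> t; apply: eq_integral => v _; rewrite colvec_consD1 pG.
Qed.

Lemma ge0_integral_torus_shift d (a : 'cV[R]_d) (G : 'cV[R]_d -> \bar R) :
  measurable_fun setT G -> (forall x, 0 <= G x) -> operiodic G ->
  \int[torus_measure d]_x G (a + x)%R = \int[torus_measure d]_x G x.
Proof.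
move=> mG G0 pG.
rewrite -[RHS](@ge0_integral_torus_coordwise d (fun i t => t + a i 0)%R)//.
- apply: eq_integral => x _; congr G; apply/matrixP => i j.
  by rewrite !mxE ord1 addrC.
- by move=> i; exact: measurable_funD.
- by move=> i f mf f0 f1; exact: interval_measure_shift.
Qed.

Lemma ge0_integral_torus_opp d (G : 'cV[R]_d -> \bar R) :
  measurable_fun setT G -> (forall x, 0 <= G x) -> operiodic G ->
  \int[torus_measure d]_x G (- x)%R = \int[torus_measure d]_x G x.
Proof.
move=> mG G0 pG.
rewrite -[RHS](@ge0_integral_torus_coordwise d (fun i t => - t)%R)//.
- apply: eq_integral => x _; congr G; apply/matrixP => i j.
  by rewrite !mxE ord1.
- by move=> i; exact: oppr_measurable.
- by move=> i f mf f0 f1; exact: interval_measure_opp.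
Qed.

Lemma ge0_integral_torus_reflect d (a : 'cV[R]_d) (G : 'cV[R]_d -> \bar R) :
  measurable_fun setT G -> (forall x, 0 <= G x) -> operiodic G ->
  \int[torus_measure d]_x G (a - x)%R = \int[torus_measure d]_x G x.
Proof.
move=> mG G0 pG; rewrite -(ge0_integral_torus_shift a mG G0 pG).
rewrite (ge0_integral_torus_opp (G := fun x => G (a + x)%R))//.
- by apply: (measurableT_comp mG); exact: measurable_addl.
- by move=> k x; rewrite addrA pG.
Qed.

End torus_invariance.

(** * Lebesgue norms and Hoelder inequality at all exponents *)

Section lnorm_complements.
Context d (T : measurableType d) (R : realType).
Variable mu : {measure set T -> \bar R}.
Local Open Scope ereal_scope.
Local Notation "'N_ p [ f ]" := (Lnorm mu p (EFin \o f)).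
Implicit Types (f g : T -> R) (p q : \bar R).

Lemma conj_exponentP p q : 1 <= p -> 1 <= q -> p^-1 + q^-1 = 1 ->
  [\/ p = 1 /\ q = +oo, p = +oo /\ q = 1 |
      exists r s : R, [/\ p = r%:E, q = s%:E, (1 < r)%R, (1 < s)%R &
                          (r^-1 + s^-1 = 1)%R]].
Proof.
move=> p1 q1 pq.
have aux (x : \bar R) : 1 <= x -> 1 + x^-1 = 1 -> x = +oo.
  case: x => [r| |//]//; rewrite lee_fin => r1.
  have r0 : (0 < r)%R by exact: lt_le_trans r1.
  rewrite inver gt_eqF// -EFinD => -[] /eqP; rewrite -subr_eq0 addrAC subrr add0r.
  by rewrite invr_eq0 gt_eqF.
have [pE|p_neq1] := eqVneq p 1.
  by constructor 1; split => //; apply: aux => //; rewrite -[RHS]pq pE inve1.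
have [pE|p_neqy] := eqVneq p +oo.
  by move: pq; rewrite pE invey add0e => /eqP; rewrite inve_eq1 => /eqP ->; constructor 2.
have [qE|q_neq1] := eqVneq q 1.
  by move: p_neqy; rewrite (aux p)//; rewrite -[RHS]pq qE inve1 addeC.
have [qE|q_neqy] := eqVneq q +oo.
  by move: pq; rewrite qE invey adde0 => /eqP; rewrite inve_eq1 (negbTE p_neq1).
move: p q p1 q1 pq p_neq1 p_neqy q_neq1 q_neqy => [r| |//] [s| |//]//.
rewrite !lee_fin !eqe => r1 s1 + r1' _ s1' _.
rewrite !inver !gt_eqF ?(lt_le_trans _ r1) ?(lt_le_trans _ s1)// => -[rs].
by constructor 3; exists r, s; split => //; rewrite lt_neqAle eq_sym ?r1' ?s1'.
Qed.

Lemma measurable_fun_powR f (r : R) :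
  measurable_fun setT f -> measurable_fun setT (fun x => f x `^ r)%R.
Proof. exact: (@measurableT_comp _ _ _ _ _ _ (@powR R ^~ r)). Qed.

Lemma measurable_EFin_norm_poweR f (r : R) : measurable_fun setT f ->
  measurable_fun setT (fun x => `|(f x)%:E| `^ r).
Proof.
move=> mf; under eq_fun do rewrite abse_EFin poweR_EFin.
by apply/measurable_EFinP; apply: measurable_fun_powR; exact: measurableT_comp.
Qed.

Lemma le_Lnorm p f g : 0 < p -> measurable_fun setT f -> measurable_fun setT g ->
  (forall x, `|f x| <= `|g x|)%R -> 'N_p[f] <= 'N_p[g].
Proof.
rewrite unlock; case: p => [r| |//]; last first.
  move=> _ mf mg fg; case: ifPn => // _; apply: le_ess_sup.
  by apply: aeW => x /=; rewrite lee_fin.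
rewrite lte_fin => r0 mf mg fg.
apply: gt0_ler_poweR; first by rewrite invr_ge0 ltW.
- by rewrite ?in_itv ?inE/= ?andbT ?leey ?andbT integral_ge0// => x _; exact: poweR_ge0.
- by rewrite ?in_itv ?inE/= ?andbT ?leey ?andbT integral_ge0// => x _; exact: poweR_ge0.
apply: ge0_le_integral => //.
- by move=> x _; exact: poweR_ge0.
- exact: measurable_EFin_norm_poweR.
- exact: measurable_EFin_norm_poweR.
- move=> x _; rewrite lee_fin ge0_ler_powR//; first exact: ltW.
Qed.

Lemma LnormMl p (c : R) f : 0 < p -> measurable_fun setT f ->
  'N_p[(fun x => c * f x)%R] = `|c|%:E * 'N_p[f].
Proof.
rewrite unlock; case: p => [r| |//]; last first.
  move=> _ mf; case: ifPn => mu0; last by rewrite mule0.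
  rewrite -ess_supZl//; congr ess_sup.
  by apply/funext => x /=; rewrite normrM EFinM.
rewrite lte_fin => r0 mf /=.
under eq_integral do rewrite normrM powRM// EFinM.
have mr : measurable_fun setT (fun x => (`|f x| `^ r)%:E).
  by apply/measurable_EFinP; apply: measurable_fun_powR; exact: measurableT_comp.
rewrite ge0_integralZl// ?lee_fin ?powR_ge0//.
rewrite poweRM ?lee_fin ?powR_ge0//; last first.
  by apply: integral_ge0 => x _; rewrite lee_fin powR_ge0.
by rewrite poweR_EFin -powRrM divff ?gt_eqF// powRr1.
Qed.

Lemma Lnorm_le_bound p (c : R) f : mu setT = 1 -> 0 < p -> (0 <= c)%R ->
  measurable_fun setT f -> (forall x, `|f x| <= c)%R -> 'N_p[f] <= c%:E.
Proof.
move=> mu1 p0 c0 mf fc.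
apply: (@le_trans _ _ 'N_p[cst c]); first by apply: le_Lnorm => // x; rewrite /= (ger0_norm c0).
rewrite unlock; case: p p0 => [r| |//]; last first.
  by move=> _; rewrite mu1 lte01; apply: ess_sup_ler => x /=; rewrite ger0_norm.
rewrite lte_fin => r0 /=; rewrite integral_cst//= mu1 mule1 poweR_EFin -powRrM.
by rewrite divff ?gt_eqF// powRr1// ger0_norm.
Qed.

Lemma LnormyE f : 0 < mu setT -> 'N_+oo[f] = ess_sup mu (abse \o (EFin \o f)).
Proof. by move=> mu0; rewrite unlock mu0. Qed.

Lemma hoelder_extended p q f g : 1 <= p -> 1 <= q -> p^-1 + q^-1 = 1 ->
  measurable_fun setT f -> measurable_fun setT g ->
  \int[mu]_x `|f x * g x|%:E <= 'N_p[f] * 'N_q[g].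
Proof.
move=> p1 q1 pq mf mg.
have endpoint (u v : T -> R) : measurable_fun setT u -> measurable_fun setT v ->
    \int[mu]_x `|u x * v x|%:E <= 'N_1[u] * 'N_+oo[v].
  move=> mu_ mv; rewrite Lnorm1 unlock; case: ifPn => [mu0|]; last first.
    rewrite -leNgt => mu0; rewrite mule0.
    have mu00 : mu setT = 0 by apply/eqP; rewrite eq_le mu0 measure_ge0.
    rewrite null_set_integral//.
    apply/measurable_EFinP; apply: measurableT_comp => //; exact: measurable_funM.
  rewrite -ge0_integralZr//; last 2 first.
    by do 2 apply: measurableT_comp => //.
    by apply: ess_sup_gee => //; apply: aeW => x /=.
  apply: ae_ge0_le_integral => //.
  - apply/measurable_EFinP; apply: measurableT_comp => //; exact: measurable_funM.
  - move=> x _; rewrite mule_ge0//.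
    by apply: ess_sup_gee => //; apply: aeW => y /=.
  - apply: emeasurable_funM; last exact: measurable_cst.
    by do 2 apply: measurableT_comp => //.
  - have := ess_sup_ge mu (abse \o (EFin \o v)).
    apply: filterS => x /= + _ => h.
    by rewrite normrM EFinM lee_wpmul2l.
have [[-> ->]|[-> ->]|[r [s [-> -> r1 s1 rs]]]] := conj_exponentP p1 q1 pq.
- exact: endpoint.
- by under eq_integral do rewrite mulrC; rewrite muleC; exact: endpoint.
- have := hoelder mu mf mg (lt_trans ltr01 r1) (lt_trans ltr01 s1) rs.
  by rewrite Lnorm1.
Qed.

End lnorm_complements.

(** * Normalized counting measures on finite sets of lattice points *)

(** A copy of Z^d carrying the discrete sigma-algebra, for which every family
   indexed by the nodes is a measurable function. *)
Definition lattice (d : nat) := 'cV[int]_d.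

HB.instance Definition _ d := Choice.on (lattice d).
HB.instance Definition _ d := isPointed.Build (lattice d) 0.
HB.instance Definition _ d := @isMeasurable.Build default_measure_display
  (lattice d) discrete_measurable discrete_measurable0
  discrete_measurableC discrete_measurableU.

Section mean_measure.
Context {R : realType} {d : nat}.
Variable s : seq (lattice d).
Local Open Scope ereal_scope.

Lemma measurable_lattice dT (T : measurableType dT) (D : set (lattice d))
  (f : lattice d -> T) : measurable_fun D f.
Proof. by []. Qed.

(** With means taken as integrals, the discrete l_p-norms are instances of [Lnorm]
   and obey the same Hoelder and Minkowski inequalities. *)
Definition mean_measure : {measure set (lattice d) -> \bar R} :=
  @mscale _ (lattice d) R ((size s)%:R^-1)%:nng%R (msum (fun i => @dirac _ (lattice d) (nth point s i) R) (size s)).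

Lemma ge0_integral_mean_measure (F : lattice d -> \bar R) : (forall k, 0 <= F k) ->
  \int[mean_measure]_k F k = ((size s)%:R^-1)%R%:E * \sum_(k <- s) F k.
Proof.
move=> F0; rewrite ge0_integral_mscale//; congr (_ * _).
rewrite ge0_integral_measure_sum// (big_nth point) big_mkord.
by apply: eq_bigr => i _; rewrite integral_dirac// diracT mul1e.
Qed.

Lemma mean_measureT : s != [::] -> mean_measure setT = 1.
Proof.
move=> s0; have := @ge0_integral_mean_measure (cst 1) (fun=> lee01).
rewrite integral_cst//= mul1e => ->.
rewrite sumEFin -EFinM big_const_seq count_predT iter_addr addr0.
by rewrite mulVf// pnatr_eq0 size_eq0.
Qed.

End mean_measure.

(** * Schur's test *)

Section schur_test.
Context d (T : measurableType d) (R : realType) (mu : {measure set T -> \bar R}).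
Local Open Scope ereal_scope.

(** Hoelder's inequality for the measure of density [h]: the weight is split
   as [h ^ (1 - 1/r) * h ^ (1/r)]. *)
Lemma weighted_power_mean (h u : T -> R) (a r : R) : (1 <= r)%R -> (0 <= a)%R ->
  measurable_fun setT h -> (forall y, 0 <= h y)%R -> measurable_fun setT u ->
  \int[mu]_y (h y)%:E <= a%:E ->
  (\int[mu]_y (h y * `|u y|)%:E) `^ r <=
  (a `^ (r - 1))%:E * \int[mu]_y (h y * `|u y| `^ r)%:E.
Proof.
move=> + a0 mh h0 mu_ ha; rewrite le_eqVlt => /predU1P[<-|r1].
  rewrite subrr powRr0 mul1e poweRe1; last first.
    by apply: integral_ge0 => y _; rewrite lee_fin mulr_ge0.
  by under [leRHS]eq_integral do rewrite powRr1//.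
have r0 : (0 < r)%R := lt_trans ltr01 r1.
pose s := (r / (r - 1))%R.
have s0 : (0 < s)%R by rewrite divr_gt0// subr_gt0.
have sr : (r^-1 + s^-1 = 1)%R.
  rewrite /s invf_div -[X in (X + _)%R]div1r -mulrDl subrKC divff//.
  by rewrite gt_eqF.
have mabs : measurable_fun setT (fun y => `|u y|%R) by exact: measurableT_comp.
pose f y := (h y `^ s^-1)%R; pose g y := (h y `^ r^-1 * `|u y|)%R.
have mf : measurable_fun setT f by exact: measurable_fun_powR.
have mg : measurable_fun setT g.
  by apply: measurable_funM => //; exact: measurable_fun_powR.
have := hoelder mu mg mf r0 s0 sr; rewrite Lnorm1.
under eq_integral => y _.
  rewrite /= /g /f ger0_norm ?mulr_ge0 ?powR_ge0//.
  rewrite mulrAC -powRD ?sr ?powRr1//; last by rewrite oner_eq0.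
  over.
rewrite unlock /=.
under [X in _ <= X `^ _ * _]eq_integral => y _.
  rewrite /= ger0_norm ?mulr_ge0 ?powR_ge0// /g powRM ?powR_ge0//.
  rewrite -powRrM mulVf ?gt_eqF// powRr1//.
  over.
under [X in _ <= _ * X `^ _]eq_integral => y _.
  rewrite /= ger0_norm ?powR_ge0// /f -powRrM mulVf ?gt_eqF// powRr1//.
  over.
set I := \int[mu]_y (h y * _)%:E; set J := \int[mu]_y (h y * _)%:E.
set K := \int[mu]_y (h y)%:E in ha *.
have I0 : 0 <= I by apply: integral_ge0 => y _; rewrite lee_fin mulr_ge0.
have J0 : 0 <= J.
  by apply: integral_ge0 => y _; rewrite lee_fin mulr_ge0// powR_ge0.
have K0 : 0 <= K by apply: integral_ge0 => y _; rewrite lee_fin.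
have itvP (x : \bar R) : 0 <= x -> x \in `[0, +oo] by move=> x0; rewrite in_itv/= x0 leey.
move=> IJK.
have {IJK} := gt0_ler_poweR (ltW r0) (itvP _ I0) (itvP _ _) IJK.
rewrite mule_ge0 ?poweR_ge0// => /(_ erefl) /le_trans; apply.
rewrite poweRM ?poweR_ge0// -!poweRrM mulVf ?gt_eqF// poweRe1// muleC.
apply: lee_wpmul2r => //.
have -> : (s^-1 * r = r - 1)%R by rewrite /s invf_div mulrVK// unitfE gt_eqF.
rewrite -poweR_EFin; apply: gt0_ler_poweR => //; first by rewrite subr_ge0 ltW.
- exact: itvP.
- by apply: itvP; rewrite lee_fin.
Qed.

(** The weighted power mean moves the exponent [p] inside the integral over [T];
   exchanging this integral with the mean over [s] then leaves a factor [a] coming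
   from the means of the kernel. *)
Lemma schur_test n (s : seq (lattice n)) (H : lattice n -> T -> R) (a : R)
    (p : \bar R) (w : lattice n -> R) (u : T -> R) :
  s != [::] -> 1 <= p -> (0 <= a)%R ->
  (forall k, measurable_fun setT (H k)) -> (forall k y, 0 <= H k y)%R ->
  measurable_fun setT u ->
  (forall k, \int[mu]_y (H k y)%:E <= a%:E) ->
  (forall y, (size s)%:R^-1 * \sum_(k <- s) H k y <= a)%R ->
  (forall k, `|w k|%:E <= \int[mu]_y (H k y * `|u y|)%:E) ->
  Lnorm (mean_measure s) p (EFin \o w) <= a%:E * Lnorm mu p (EFin \o u).
Proof.
move=> s0 + a0 mH H0 mu_ Ha Hs wHu; case: p => [r| |//]; last first.
  move=> _; rewrite [X in X <= _]LnormyE ?mean_measureT ?lte01//.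
  apply/ess_supP; apply: aeW => k /=; apply: (le_trans (wHu k)).
  have := @hoelder_extended _ _ _ mu 1 +oo (H k) u (lexx _) (leey _) _ (mH k) mu_.
  rewrite inve1 invey adde0 => /(_ erefl).
  under eq_integral do rewrite normrM (ger0_norm (H0 _ _)).
  move/le_trans; apply; apply: lee_wpmul2r; first exact: Lnorm_ge0.
  rewrite Lnorm1; apply: le_trans (Ha k); rewrite le_eqVlt; apply/orP; left; apply/eqP.
  by apply: eq_integral => y _; rewrite /= ger0_norm.
rewrite lee_fin => r1.
have r0 : (0 < r)%R := lt_le_trans ltr01 r1.
have itvP (x : \bar R) : 0 <= x -> x \in `[0, +oo] by move=> x0; rewrite in_itv/= x0 leey.
have mur : measurable_fun setT (fun y => `|u y| `^ r)%R.
  by apply: measurable_fun_powR; exact: measurableT_comp.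
have Hu0 k y : (0 <= H k y * `|u y| `^ r)%R by rewrite mulr_ge0// powR_ge0.
have mHu k : measurable_fun setT (fun y => (H k y * `|u y| `^ r)%:E).
  by apply/measurable_EFinP; exact: measurable_funM.
set U := \int[mu]_y (`|u y| `^ r)%:E.
have U0 : 0 <= U by apply: integral_ge0 => y _; rewrite lee_fin powR_ge0.
suff : \int[mean_measure s]_k (`|w k| `^ r)%:E <= (a `^ r)%:E * U.
  move=> wU; rewrite unlock/= -/U.
  rewrite -[X in X%:E * _](_ : (a `^ r) `^ r^-1 = a)%R; last first.
    by rewrite -powRrM divff ?gt_eqF// powRr1.
  rewrite -poweR_EFin -poweRM ?lee_fin ?powR_ge0//.
  apply: gt0_ler_poweR => //; first by rewrite invr_ge0 ltW.
  - by apply: itvP; apply: integral_ge0 => k _; rewrite lee_fin powR_ge0.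
  - by apply: itvP; rewrite mule_ge0// lee_fin powR_ge0.
rewrite ge0_integral_mean_measure; last by move=> k; rewrite lee_fin powR_ge0.
have step k : (`|w k| `^ r)%:E <=
    (a `^ (r - 1))%:E * \int[mu]_y (H k y * `|u y| `^ r)%:E.
  apply: le_trans (weighted_power_mean r1 a0 (mH k) (H0 k) mu_ (Ha k)).
  rewrite -poweR_EFin; apply: gt0_ler_poweR => //; first exact: ltW.
  - by apply: itvP; rewrite lee_fin.
  - by apply: itvP; apply: integral_ge0 => y _; rewrite lee_fin mulr_ge0.
have c0 : 0 <= ((size s)%:R^-1)%R%:E :> \bar R by rewrite lee_fin invr_ge0.
apply: (@le_trans _ _ (((size s)%:R^-1)%R%:E * \sum_(k <- s)
    (a `^ (r - 1))%:E * \int[mu]_y (H k y * `|u y| `^ r)%:E)).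
  by apply: lee_wpmul2l => //; apply: lee_sum => k _.
rewrite -ge0_sume_distrr; last first.
  by move=> k _; apply: integral_ge0 => y _; rewrite lee_fin.
rewrite -ge0_integral_sum//; last by move=> k y _; rewrite lee_fin.
rewrite muleCA -ge0_integralZl//; last 2 first.
- exact: emeasurable_sum.
- by move=> y _; apply: sume_ge0 => k _; rewrite lee_fin.
apply: (@le_trans _ _ ((a `^ (r - 1))%:E * (a%:E * U))).
  apply: lee_wpmul2l; first by rewrite lee_fin powR_ge0.
  rewrite -ge0_integralZl//; last exact/measurable_EFinP.
  apply: ge0_le_integral => //.
  - move=> y _; rewrite mule_ge0//; apply: sume_ge0 => k _.
    by rewrite lee_fin.
  - apply: emeasurable_funM => //; exact: emeasurable_sum.
  - by apply: emeasurable_funM => //; exact/measurable_EFinP.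
  - move=> y _; rewrite sumEFin -!EFinM lee_fin -mulr_suml mulrA.
    by rewrite ler_wpM2r// powR_ge0.
rewrite muleA -EFinM -[X in (_ * X)%R]powRr1// -powRD ?subrK//.
by rewrite gt_eqF.
Qed.

End schur_test.

(** * Complex-valued functions and their integrals *)

Local Open Scope complex_scope.
Notation Re := complex.Re.
Notation Im := complex.Im.
Notation normc := Normc.normc.

Section complex_modulus.
Context {R : rcfType}.
Implicit Types (z w : R[i]) (c : R).

Lemma ReD z w : Re (z + w) = Re z + Re w. Proof. by case: z w => [? ?] []. Qed.
Lemma ImD z w : Im (z + w) = Im z + Im w. Proof. by case: z w => [? ?] []. Qed.
Lemma ReN z : Re (- z) = - Re z. Proof. by case: z. Qed.
Lemma ImN z : Im (- z) = - Im z. Proof. by case: z. Qed.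
Lemma ReM z w : Re (z * w) = Re z * Re w - Im z * Im w.
Proof. by case: z w => [? ?] []. Qed.
Lemma ImM z w : Im (z * w) = Re z * Im w + Im z * Re w.
Proof. by case: z w => [? ?] []. Qed.

Lemma ReJ z : Re (conjc z) = Re z. Proof. by case: z. Qed.
Lemma ImJ z : Im (conjc z) = - Im z. Proof. by case: z. Qed.

Lemma complexP z w : Re z = Re w -> Im z = Im w -> z = w.
Proof. by case: z w => [? ?] [? ?] /= -> ->. Qed.

Lemma normc_ge0 z : 0 <= normc z.
Proof. by case: z => a b; exact: sqrtr_ge0. Qed.

Lemma sqr_normcE z : normc z ^+ 2 = Re z ^+ 2 + Im z ^+ 2.
Proof. by case: z => a b; rewrite sqr_sqrtr// addr_ge0// sqr_ge0. Qed.

Lemma normr_Re_le z : `|Re z| <= normc z.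
Proof.
by rewrite -(ler_sqr (normr_ge0 _) (normc_ge0 _)) sqr_normcE real_normK ?num_real// lerDl sqr_ge0.
Qed.

Lemma normr_Im_le z : `|Im z| <= normc z.
Proof.
by rewrite -(ler_sqr (normr_ge0 _) (normc_ge0 _)) sqr_normcE real_normK ?num_real// lerDr sqr_ge0.
Qed.

Lemma normcR c : normc c%:C = `|c|.
Proof. by rewrite /= expr0n addr0 sqrtr_sqr. Qed.

Lemma normcJ z : normc (conjc z) = normc z.
Proof. by case: z => a b; rewrite /= sqrrN. Qed.

Lemma mulcJ z : z * conjc z = (normc z ^+ 2)%:C.
Proof.
by apply: complexP; rewrite /= ?ReM ?ImM ?sqr_normcE; case: z => a b /=; rewrite ?mulrN ?opprK; ring.
Qed.

Lemma normc_sum (I : Type) (s : seq I) (F : I -> R[i]) :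
  normc (\sum_(i <- s) F i) <= \sum_(i <- s) normc (F i).
Proof.
elim/big_ind2 : _ => [|x a y b xa yb|//].
  by rewrite -[X in normc X]/(0%:C) normcR normr0.
by rewrite (le_trans (le_normcD _ _))// lerD.
Qed.

End complex_modulus.

Section complex_integral.
Context {R : realType} {d : nat}.
Local Notation V := 'cV[R]_d.
Local Notation mu := (@torus_measure R d).
Implicit Types (f g : V -> R[i]) (c : R[i]).

Lemma cmeasurable_cst c : cmeasurable (fun _ : V => c).
Proof. by split; exact: measurable_cst. Qed.

Lemma cmeasurableD f g : cmeasurable f -> cmeasurable g -> cmeasurable (fun x => f x + g x).
Proof.
move=> [f1 f2] [g1 g2]; split.
  by under eq_fun do rewrite ReD; exact: measurable_funD.
by under eq_fun do rewrite ImD; exact: measurable_funD.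
Qed.

Lemma cmeasurableN f : cmeasurable f -> cmeasurable (fun x => - f x).
Proof.
move=> [f1 f2]; split.
  by under eq_fun do rewrite ReN; exact: measurableT_comp.
by under eq_fun do rewrite ImN; exact: measurableT_comp.
Qed.

Lemma cmeasurableB f g : cmeasurable f -> cmeasurable g -> cmeasurable (fun x => f x - g x).
Proof. by move=> mf mg; apply: cmeasurableD => //; exact: cmeasurableN. Qed.

Lemma cmeasurableM f g : cmeasurable f -> cmeasurable g -> cmeasurable (fun x => f x * g x).
Proof.
move=> [f1 f2] [g1 g2]; split.
  under eq_fun do rewrite ReM; apply: measurable_funB; exact: measurable_funM.
under eq_fun do rewrite ImM; apply: measurable_funD; exact: measurable_funM.
Qed.

Lemma cmeasurableJ f : cmeasurable f -> cmeasurable (fun x => conjc (f x)).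
Proof.
move=> [f1 f2]; split; first by under eq_fun do rewrite ReJ.
by under eq_fun do rewrite ImJ; exact: measurableT_comp.
Qed.

Lemma cmeasurable_real (u : V -> R) : measurable_fun setT u ->
  cmeasurable (fun x => (u x)%:C).
Proof. by move=> mu_; split => //=; exact: measurable_cst. Qed.

Lemma cmeasurable_sum (I : Type) (s : seq I) (F : I -> V -> R[i]) :
  (forall i, cmeasurable (F i)) -> cmeasurable (fun x => \sum_(i <- s) F i x).
Proof.
move=> mF; elim: s => [|i s IH].
  by under eq_fun do rewrite big_nil; exact: cmeasurable_cst.
by under eq_fun do rewrite big_cons; exact: cmeasurableD.
Qed.

Lemma cmeasurable_comp f (tau : V -> V) : measurable_fun setT tau ->
  cmeasurable f -> cmeasurable (fun x => f (tau x)).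
Proof.
move=> mtau [f1 f2]; split.
  exact: (measurableT_comp f1 mtau).
exact: (measurableT_comp f2 mtau).
Qed.

Lemma measurable_normc f : cmeasurable f -> measurable_fun setT (fun x => normc (f x)).
Proof.
move=> [f1 f2].
have -> : (fun x => normc (f x)) = (fun x => Num.sqrt (Re (f x) ^+ 2 + Im (f x) ^+ 2)).
  by apply/funext => x; case: (f x).
apply: (measurableT_comp (continuous_measurable_fun (@sqrt_continuous R))) => //.
by apply: measurable_funD; exact: measurable_funX.
Qed.

Definition cintegrable f := cmeasurable f /\ (\int[mu]_x (normc (f x))%:E < +oo)%E.

Lemma cintegrable_Re f : cintegrable f -> mu.-integrable setT (fun x => (Re (f x))%:E).
Proof.
move=> [[f1 f2] foo]; apply/integrableP; split; first exact/measurable_EFinP.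
apply: le_lt_trans foo; apply: ge0_le_integral => //.
- by apply/measurable_EFinP; apply: measurableT_comp.
- by apply/measurable_EFinP; exact: measurable_normc.
- by move=> x _; rewrite lee_fin normr_Re_le.
Qed.

Lemma cintegrable_Im f : cintegrable f -> mu.-integrable setT (fun x => (Im (f x))%:E).
Proof.
move=> [[f1 f2] foo]; apply/integrableP; split; first exact/measurable_EFinP.
apply: le_lt_trans foo; apply: ge0_le_integral => //.
- by apply/measurable_EFinP; apply: measurableT_comp.
- by apply/measurable_EFinP; exact: measurable_normc.
- by move=> x _; rewrite lee_fin normr_Im_le.
Qed.

Lemma bounded_cintegrable f (b : R) : cmeasurable f -> (forall x, normc (f x) <= b) ->
  cintegrable f.
Proof.
move=> mf fb; split => //; apply: (@le_lt_trans _ _ (\int[mu]_x b%:E)%E); last first.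
  by rewrite integral_cst//= probability_setT mule1 ltry.
apply: ge0_le_integral => //.
- by move=> x _; rewrite lee_fin normc_ge0.
- by apply/measurable_EFinP; exact: measurable_normc.
- by move=> x _; rewrite lee_fin.
Qed.

Lemma cintegrableD f g : cintegrable f -> cintegrable g -> cintegrable (fun x => f x + g x).
Proof.
move=> [mf fo] [mg go]; split; first exact: cmeasurableD.
have mf' := measurable_normc mf; have mg' := measurable_normc mg.
apply: (@le_lt_trans _ _ (\int[mu]_x (normc (f x))%:E + \int[mu]_x (normc (g x))%:E)%E); last first.
  exact: lte_add_pinfty.
rewrite -ge0_integralD//; last 4 first.
- by move=> x _; rewrite lee_fin normc_ge0.
- exact/measurable_EFinP.
- by move=> x _; rewrite lee_fin normc_ge0.
- exact/measurable_EFinP.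
apply: ge0_le_integral => //.
- by move=> x _; rewrite lee_fin normc_ge0.
- by apply/measurable_EFinP; apply: measurable_normc; exact: cmeasurableD.
- by apply: emeasurable_funD; exact/measurable_EFinP.
- by move=> x _; rewrite -EFinD lee_fin le_normcD.
Qed.

Lemma cintegrableZ c f : cintegrable f -> cintegrable (fun x => c * f x).
Proof.
move=> [mf fo]; split; first by apply: cmeasurableM => //; exact: cmeasurable_cst.
under eq_integral do rewrite Normc.normcM EFinM.
have mf' := measurable_normc mf.
rewrite ge0_integralZl//=.
- by rewrite lte_mul_pinfty// lee_fin normc_ge0.
- exact/measurable_EFinP.
- by move=> x _; rewrite lee_fin normc_ge0.
- by rewrite lee_fin normc_ge0.
Qed.

Lemma cintegralD f g : cintegrable f -> cintegrable g ->
  cintegral (fun x => f x + g x) = cintegral f + cintegral g.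
Proof.
move=> fi gi; apply: complexP; rewrite ?ReD ?ImD /cintegral /=.
  under eq_Rintegral do rewrite ReD.
  by apply: RintegralD => //; exact: cintegrable_Re.
under eq_Rintegral do rewrite ImD.
by apply: RintegralD => //; exact: cintegrable_Im.
Qed.

Lemma cintegralZ c f : cintegrable f ->
  cintegral (fun x => c * f x) = c * cintegral f.
Proof.
move=> fi; have fRe := cintegrable_Re fi; have fIm := cintegrable_Im fi.
apply: complexP; rewrite ?ReM ?ImM /cintegral /=.
  under eq_Rintegral do rewrite ReM.
  rewrite RintegralB//; first by rewrite !RintegralZl.
  - exact: (integrableZl measurableT (Re c) fRe).
  - exact: (integrableZl measurableT (Im c) fIm).
under eq_Rintegral do rewrite ImM.
rewrite RintegralD//; first by rewrite !RintegralZl.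
- exact: (integrableZl measurableT (Re c) fIm).
- exact: (integrableZl measurableT (Im c) fRe).
Qed.

Lemma cintegral0 : cintegral (fun _ : V => 0) = 0.
Proof. by apply: complexP; rewrite /cintegral /= /Rintegral integral0. Qed.

Lemma cintegrable_sum (I : Type) (s : seq I) (F : I -> V -> R[i]) :
  (forall i, cintegrable (F i)) -> cintegrable (fun x => \sum_(i <- s) F i x).
Proof.
move=> Fi; elim: s => [|i s IH].
  under eq_fun do rewrite big_nil.
  by apply: (@bounded_cintegrable _ 0) => [|x]; rewrite ?normcR ?normr0//; exact: cmeasurable_cst.
by under eq_fun do rewrite big_cons; exact: cintegrableD.
Qed.

Lemma cintegral_sum (I : Type) (s : seq I) (F : I -> V -> R[i]) :
  (forall i, cintegrable (F i)) ->
  cintegral (fun x => \sum_(i <- s) F i x) = \sum_(i <- s) cintegral (F i).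
Proof.
move=> Fi; elim: s => [|i s IH].
  by rewrite big_nil; under eq_fun do rewrite big_nil; exact: cintegral0.
under eq_fun do rewrite big_cons.
by rewrite big_cons cintegralD ?IH//; exact: cintegrable_sum.
Qed.

(** After multiplication by the conjugate of the integral, only real parts have to
   be compared. *)
Lemma normc_cintegral_le f : cintegrable f ->
  ((normc (cintegral f))%:E <= \int[mu]_x (normc (f x))%:E)%E.
Proof.
move=> fi; set I := cintegral f.
have [I0|I0] := eqVneq (normc I) 0.
  by rewrite I0; apply: integral_ge0 => x _; rewrite lee_fin normc_ge0.
have Ip : 0 < normc I by rewrite lt0r I0 normc_ge0.
have mf := measurable_normc fi.1.
have key x : Re (conjc I * f x) <= normc I * normc (f x).
  by rewrite -[X in _ <= X * _](normcJ I) -Normc.normcM (le_trans (ler_norm _))// normr_Re_le.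
suff : ((normc I ^+ 2)%:E <= (normc I)%:E * \int[mu]_x (normc (f x))%:E)%E.
  by rewrite expr2 EFinM lee_pmul2l// lte_fin.
rewrite -ge0_integralZl//=; last 2 first.
- exact/measurable_EFinP.
- by move=> x _; rewrite lee_fin normc_ge0.
have -> : normc I ^+ 2 = Re (cintegral (fun x => conjc I * f x)).
  by rewrite cintegralZ// mulrC mulcJ.
have Ifi := cintegrableZ (conjc I) fi.
have fin := integrable_fin_num measurableT (cintegrable_Re Ifi).
rewrite /cintegral /= /Rintegral fineK//.
apply: le_integral => //.
- exact: cintegrable_Re.
- apply/integrableP; split.
    by apply: emeasurable_funM => //; exact/measurable_EFinP.
  have := Ifi.2; congr (_ < _)%E; apply: eq_integral => x _.
  by rewrite Normc.normcM normcJ /= ger0_norm// mulr_ge0 ?normc_ge0.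
- by move=> x _; rewrite lee_fin; exact: key.
Qed.

Lemma integral_torus_reflect (a : V) (f : V -> R) :
  measurable_fun setT f -> (forall k x, f (x + zvec k) = f x) ->
  \int[mu]_x f (a - x) = \int[mu]_x f x.
Proof.
move=> mf pf; rewrite /Rintegral; congr fine; rewrite integralE [RHS]integralE.
have mfE : measurable_fun setT (EFin \o f) by exact/measurable_EFinP.
congr (_ - _)%E.
  rewrite -[RHS](ge0_integral_torus_reflect a)//.
  - by apply: eq_integral => x _; rewrite !funeposE.
  - exact: measurable_funepos.
  - by move=> k x; rewrite !funeposE pf.
rewrite -[RHS](ge0_integral_torus_reflect a)//.
- by apply: eq_integral => x _; rewrite !funenegE.
- exact: measurable_funeneg.
- by move=> k x; rewrite !funenegE pf.
Qed.

Lemma cintegral_reflect (a : V) f : cmeasurable f -> zperiodic f ->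
  cintegral (fun x => f (a - x)) = cintegral f.
Proof.
move=> [f1 f2] pf; apply: complexP; rewrite /cintegral /=.
  by rewrite (integral_torus_reflect a f1)// => k x; rewrite pf.
by rewrite (integral_torus_reflect a f2)// => k x; rewrite pf.
Qed.

End complex_integral.

(** * Norms of functions on the torus, and duality *)

Section Lp_torus.
Context {R : realType} {d : nat}.
Local Notation V := 'cV[R]_d.
Local Notation mu := (@torus_measure R d).
Implicit Types (f g : V -> R[i]) (p q : \bar R).

Lemma Lpnorm_ge0 p f : (0 <= Lpnorm p f)%E.
Proof. exact: Lnorm_ge0. Qed.

Lemma le_Lpnorm p f g : (1 <= p)%E -> cmeasurable f -> cmeasurable g ->
  (forall x, normc (f x) <= normc (g x)) -> (Lpnorm p f <= Lpnorm p g)%E.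
Proof.
move=> p1 mf mg fg; apply: le_Lnorm => //.
- exact: lt_le_trans p1.
- exact: measurable_normc.
- exact: measurable_normc.
- by move=> x; rewrite !ger0_norm ?normc_ge0.
Qed.

Lemma LpnormD p f g : (1 <= p)%E -> cmeasurable f -> cmeasurable g ->
  (Lpnorm p (fun x => f x + g x)%R <= Lpnorm p f + Lpnorm p g)%E.
Proof.
move=> p1 mf mg; have mf' := measurable_normc mf; have mg' := measurable_normc mg.
apply: le_trans (eminkowski mu mf' mg' p1).
apply: le_Lnorm => //.
- exact: lt_le_trans p1.
- by apply: measurable_normc; exact: cmeasurableD.
- exact: measurable_funD.
- by move=> x; rewrite !ger0_norm ?normc_ge0 ?addr_ge0 ?normc_ge0 ?le_normcD.
Qed.

Lemma LpnormN p f : Lpnorm p (fun x => - f x) = Lpnorm p f.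
Proof. by apply: eq_Lnorm => x /=; rewrite normcN. Qed.

Lemma LpnormB p f g : (1 <= p)%E -> cmeasurable f -> cmeasurable g ->
  (Lpnorm p (fun x => f x - g x)%R <= Lpnorm p f + Lpnorm p g)%E.
Proof.
by move=> p1 mf mg; rewrite -(LpnormN p g); apply: LpnormD => //; exact: cmeasurableN.
Qed.

Lemma LpnormZ p (c : R[i]) f : (1 <= p)%E -> cmeasurable f ->
  Lpnorm p (fun x => c * f x) = ((normc c)%:E * Lpnorm p f)%E.
Proof.
move=> p1 mf; rewrite /Lpnorm -[X in (X%:E * _)%E](ger0_norm (normc_ge0 c)) -LnormMl.
- by apply: eq_Lnorm => x /=; rewrite Normc.normcM.
- exact: lt_le_trans p1.
- exact: measurable_normc.
Qed.

Lemma Lpnorm_le_bound p (b : R) f : (1 <= p)%E -> 0 <= b -> cmeasurable f ->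
  (forall x, normc (f x) <= b) -> (Lpnorm p f <= b%:E)%E.
Proof.
move=> p1 b0 mf fb; apply: Lnorm_le_bound => //.
- exact: probability_setT.
- exact: lt_le_trans p1.
- exact: measurable_normc.
- by move=> x; rewrite ger0_norm ?normc_ge0.
Qed.

Lemma hoelder_torus p q f g : (1 <= p)%E -> (1 <= q)%E -> (p^-1 + q^-1 = 1)%E ->
  cmeasurable f -> cmeasurable g ->
  (\int[mu]_x (normc (f x * g x))%:E <= Lpnorm p f * Lpnorm q g)%E.
Proof.
move=> p1 q1 pq mf mg.
have := hoelder_extended mu p1 q1 pq (measurable_normc mf) (measurable_normc mg).
apply: le_trans; rewrite le_eqVlt; apply/orP; left; apply/eqP.
by apply: eq_integral => x _; rewrite Normc.normcM ger0_norm// mulr_ge0 ?normc_ge0.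
Qed.

Lemma conj_exponent_ex p : (1 <= p)%E -> exists2 q, (1 <= q)%E & (p^-1 + q^-1 = 1)%E.
Proof.
case: p => [r| |//] p1; last by exists 1%E; rewrite // invey inve1 add0e.
move: p1; rewrite lee_fin le_eqVlt => /predU1P[<-|r1].
  by exists +oo%E; rewrite ?leey// inve1 invey adde0.
have r0 : 0 < r := lt_trans ltr01 r1.
exists (r / (r - 1))%:E.
  by rewrite lee_fin ler_pdivlMr ?subr_gt0// mul1r lerBlDr lerDl.
rewrite !inver !gt_eqF ?divr_gt0 ?subr_gt0// -EFinD invf_div.
by rewrite -[X in X + _]div1r -mulrDl subrKC divff// gt_eqF.
Qed.

Lemma Lpnorm_le_integral p f : (1 <= p)%E -> cmeasurable f ->
  (\int[mu]_x (normc (f x))%:E <= Lpnorm p f)%E.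
Proof.
move=> p1 mf; have [q q1 pq] := conj_exponent_ex p1.
have m1 : cmeasurable (fun _ : V => 1 : R[i]) by exact: cmeasurable_cst.
have := hoelder_torus p1 q1 pq mf m1.
under eq_integral do rewrite mulr1.
move=> /le_trans; apply; rewrite -[leRHS]mule1; apply: lee_wpmul2l; first exact: Lpnorm_ge0.
by apply: Lpnorm_le_bound => // x; rewrite Normc.normc1.
Qed.

Lemma Lpnorm_integrable p f : (1 <= p)%E -> cmeasurable f -> (Lpnorm p f < +oo)%E ->
  cintegrable f.
Proof. by move=> p1 mf; split => //; exact: le_lt_trans (Lpnorm_le_integral p1 mf) _. Qed.

Lemma Lpnorm1E f : Lpnorm 1%E f = (\int[mu]_x (normc (f x))%:E)%E.
Proof. by rewrite /Lpnorm Lnorm1; apply: eq_integral => x _; rewrite /= ger0_norm ?normc_ge0. Qed.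

Lemma LpnormE (r : R) f :
  Lpnorm r%:E f = ((\int[mu]_x (normc (f x) `^ r)%:E) `^ r^-1)%E.
Proof.
rewrite /Lpnorm unlock; apply: (congr1 (fun x => poweR x r^-1)).
by apply: eq_integral => x _; rewrite /= ger0_norm ?normc_ge0.
Qed.

Lemma LpnormyE f : Lpnorm +oo%E f = ess_sup mu (fun x => (normc (f x))%:E).
Proof.
rewrite /Lpnorm unlock [X in (_ < X)%E]probability_setT lte01; congr ess_sup.
by apply/funext => x /=; rewrite ger0_norm ?normc_ge0.
Qed.

Section invariance.
Variable tau : V -> V.
Hypothesis mtau : measurable_fun setT tau.
Hypothesis tauP : forall G : V -> \bar R, measurable_fun setT G ->
  (forall x, 0 <= G x)%E -> operiodic G ->
  (\int[mu]_x G (tau x) = \int[mu]_x G x)%E.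

(** Invariance of the integrals of nonnegative functions is enough: at [p = +oo] it
   is applied to the indicator functions of superlevel sets. *)
Lemma Lnorm_torus_invariant p (u : V -> R) : measurable_fun setT u ->
  (forall k x, u (x + zvec k) = u x) -> (1 <= p)%E ->
  Lnorm mu p (fun x => (u (tau x))%:E) = Lnorm mu p (fun x => (u x)%:E).
Proof.
move=> mu_ pu; have mut := measurableT_comp mu_ mtau.
case: p => [r| |//] p1; rewrite unlock.
  apply: (congr1 (fun x => poweR x r^-1)); rewrite (tauP (G := fun x => `|(u x)%:E| `^ r)%E)//.
  - exact: measurable_EFin_norm_poweR.
  - by move=> x; exact: poweR_ge0.
  - by move=> k x; rewrite pu.
case: ifPn => // _.
have muE (v : V -> R) : measurable_fun setT v ->
    measurable_fun setT (fun x => `|(v x)%:E|%E).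
  by move=> mv; apply: measurableT_comp => //; exact/measurable_EFinP.
have key y : (\forall x \ae mu, (`|(u (tau x))%:E| <= y)%E) <->
             (\forall x \ae mu, (`|(u x)%:E| <= y)%E).
  rewrite !ae_le_measureP; [|exact: muE|exact: muE].
  set S := (fun x : V => `|(u x)%:E|%E) @^-1` `]y, +oo[.
  have mS : measurable S.
    by rewrite -[S]setTI; apply: muE => //; exact: emeasurable_itv.
  have mtS : measurable (tau @^-1` S) by rewrite -[tau @^-1` S]setTI; exact: mtau.
  suff E : mu (tau @^-1` S) = mu S by split=> h; [exact: (etrans (esym E) h)|exact: (etrans E h)].
  transitivity (\int[mu]_x (\1_(tau @^-1` S) x)%:E)%E; first by rewrite integral_indic// setIT.
  transitivity (\int[mu]_x (\1_S x)%:E)%E; last by rewrite integral_indic// setIT.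
  rewrite -[RHS](tauP (G := fun x => (\1_S x)%:E))//.
  - by apply/measurable_EFinP; exact: measurable_indic.
  - move=> k x; rewrite !indicE; congr (_%:R%:E); congr nat_of_bool.
    by apply/idP/idP; rewrite !inE /S /= pu.
by rewrite /ess_sup; congr ereal_inf; apply/seteqP; split=> y /=; rewrite key.
Qed.

End invariance.

Lemma Lpnorm_reflect p f (a : V) : (1 <= p)%E -> cmeasurable f -> zperiodic f ->
  Lpnorm p (fun x => f (a - x)) = Lpnorm p f.
Proof.
move=> p1 mf pf.
rewrite /Lpnorm (@Lnorm_torus_invariant (fun x => a - x) _ _ p (fun x => normc (f x)))//.
- exact: (measurableT_comp (measurable_addl a) (@measurable_oppv R d)).
- by move=> G mG G0 pG; exact: ge0_integral_torus_reflect.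
- exact: measurable_normc.
- by move=> k x; rewrite pf.
Qed.

Lemma Lpnorm_shift p f (a : V) : (1 <= p)%E -> cmeasurable f -> zperiodic f ->
  Lpnorm p (fun x => f (a + x)) = Lpnorm p f.
Proof.
move=> p1 mf pf.
rewrite /Lpnorm (@Lnorm_torus_invariant (fun x => a + x) _ _ p (fun x => normc (f x)))//.
- exact: measurable_addl.
- by move=> G mG G0 pG; exact: ge0_integral_torus_shift.
- exact: measurable_normc.
- by move=> k x; rewrite pf.
Qed.

Lemma cintegralR (u : V -> R) (b : R) : measurable_fun setT u ->
  (forall x, 0 <= u x <= b) ->
  (normc (cintegral (fun x => (u x)%:C)))%:E = (\int[mu]_x (u x)%:E)%E.
Proof.
move=> mu_ ub.
have -> : cintegral (fun x => (u x)%:C) = (\int[mu]_x u x)%:C.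
  by apply: complexP; rewrite /cintegral /= /Rintegral ?integral0.
have ui : mu.-integrable setT (fun x => (u x)%:E).
  apply: (@cintegrable_Re _ _ (fun x => (u x)%:C)); apply: (@bounded_cintegrable _ _ _ b).
    by split => //=; exact: measurable_cst.
  by move=> x; have /andP[u0 ub'] := ub x; rewrite normcR ger0_norm.
rewrite normcR ger0_norm; last by apply: Rintegral_ge0 => x _; have /andP[] := ub x.
by rewrite /Rintegral fineK//; exact: integrable_fin_num.
Qed.

(** A norming function for [F] at a finite exponent [r] is
   [conj F * |F| ^ (r - 2)], which is in [B] because [F] is bounded; at [p = +oo] one
   tests against the phase of [F] restricted to a superlevel set of [|F|]. *)
Lemma Lpnorm_dual_le p q (F : V -> R[i]) (b : R) (C : \bar R) :
  (1 <= p)%E -> (1 <= q)%E -> (p^-1 + q^-1 = 1)%E ->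
  cmeasurable F -> zperiodic F -> (forall x, normc (F x) <= b) -> (0 <= C)%E ->
  (forall (g : V -> R[i]), in_B g ->
     ((normc (cintegral (fun x => F x * g x)))%:E <= C * Lpnorm q g)%E) ->
  (Lpnorm p F <= C)%E.
Proof.
move=> p1 q1 pq mF pF Fb C0 FC.
have mnF := measurable_normc mF.
have b0 : 0 <= b by apply: le_trans (Fb 0); exact: normc_ge0.
pose ext (r : R) x := conjc (F x) * (normc (F x) `^ (r - 2))%:C.
have mext r : cmeasurable (ext r).
  apply: cmeasurableM; first exact: cmeasurableJ.
  by apply: cmeasurable_real; exact: measurable_fun_powR.
have pext r : zperiodic (ext r) by move=> k x; rewrite /ext pF.
have next r x : 1 <= r -> normc (ext r x) = if F x == 0 then 0 else normc (F x) `^ (r - 1).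
  move=> r1; rewrite /ext Normc.normcM normcJ normcR ger0_norm ?powR_ge0//.
  case: eqVneq => [->|Fx0]; first by rewrite Normc.normc0 mul0r.
  have nF0 : 0 < normc (F x).
    by rewrite lt0r normc_ge0 andbT; apply: contra_neq Fx0; exact: Normc.eq0_normc.
  rewrite -[X in X * _](powRr1 (normc_ge0 _)) -powRD.
    by congr (_ `^ _); ring.
  by rewrite (gt_eqF nF0) implybT.
have extb r x : 1 <= r -> normc (ext r x) <= b `^ (r - 1).
  move=> r1; rewrite next//; case: eqP => _; first exact: powR_ge0.
  by apply: ge0_ler_powR; rewrite ?subr_ge0 ?nnegrE ?normc_ge0 ?b0// Fb.
have extb1 x : normc (ext 1 x) <= 1.
  by rewrite (le_trans (extb 1 x _))// subrr powRr0.
have Bext r : 1 <= r -> in_B (ext r).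
  by move=> r1; split => //; exists (b `^ (r - 1)) => x; exact: extb.
have Fext r x : 1 <= r -> F x * ext r x = (normc (F x) `^ r)%:C.
  move=> r1; have r0 : r != 0 by rewrite gt_eqF// (lt_le_trans ltr01 r1).
  have [Fx0|Fx0] := eqVneq (F x) 0; first by rewrite Fx0 mul0r Normc.normc0 powR0.
  have nF0 : 0 < normc (F x).
    by rewrite lt0r normc_ge0 andbT; apply: contra_neq Fx0; exact: Normc.eq0_normc.
  rewrite /ext mulrA mulcJ -rmorphM /= -powR_mulrn ?normc_ge0// -powRD.
    by rewrite addrC subrK.
  by rewrite (gt_eqF nF0) implybT.
have dual r : 1 <= r -> (\int[mu]_x (normc (F x) `^ r)%:E <= C * Lpnorm q (ext r))%E.
  move=> r1; apply: le_trans (FC _ (Bext r r1)).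
  have -> : (fun x => F x * ext r x) = (fun x => (normc (F x) `^ r)%:C).
    by apply/funext => x; exact: Fext.
  rewrite (@cintegralR _ (b `^ r))//; first exact: measurable_fun_powR.
  move=> x; rewrite powR_ge0/=; apply: ge0_ler_powR; rewrite ?nnegrE ?normc_ge0//.
  exact: le_trans r1.
case: (conj_exponentP p1 q1 pq) => [[pE qE]|[pE qE]|[r [s [pE qE r1 s1 rs]]]].
- rewrite pE Lpnorm1E; have := dual _ (lexx 1).
  under eq_integral do rewrite powRr1 ?normc_ge0//.
  move=> /le_trans; apply; rewrite -[leRHS]mule1; apply: lee_wpmul2l => //.
  exact: Lpnorm_le_bound.
- move: C C0 FC dual => [c| |//] c0 FC _; last by rewrite leey.
  rewrite lee_fin in c0.
  rewrite pE LpnormyE; apply/lee_addgt0Pr => e e0; apply/ess_supP.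
  rewrite ae_le_measureP; last exact/measurable_EFinP.
  set S := _ @^-1` _.
  have mS : measurable S.
    by rewrite -[S]setTI; apply: (measurable_EFinP _ _).2 => //; exact: emeasurable_itv.
  pose g x := ext 1 x * (\1_S x)%:C.
  have nS x : S x <-> c + e < normc (F x).
    by rewrite /S /= in_itv /= andbT lte_fin.
  have mI : measurable_fun setT (\1_S : V -> R) by exact: measurable_indic.
  have Sper k x : \1_S (x + zvec k) = \1_S x :> R.
    rewrite !indicE; congr (_%:R); congr nat_of_bool.
    by apply/idP/idP; rewrite !inE !nS pF.
  have indic_le1 x : \1_S x <= 1 :> R by rewrite indicE lern1 leq_b1.
  have gle x : normc (g x) <= \1_S x.
    by rewrite /g Normc.normcM normcR ger0_norm// -[leRHS]mul1r ler_wpM2r.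
  have Bg : in_B g.
    split.
    - by move=> k x; rewrite /g pext Sper.
    - by apply: cmeasurableM => //; exact: cmeasurable_real.
    - exists 1 => x; apply: (le_trans (gle x)); exact: indic_le1.
  have Fg x : F x * g x = (normc (F x) * \1_S x)%:C.
    by rewrite /g mulrA Fext// powRr1 ?normc_ge0// -rmorphM.
  have := FC g Bg.
  have -> : (fun x => F x * g x) = (fun x => (normc (F x) * \1_S x)%:C).
    exact/funext.
  rewrite (@cintegralR _ b)//; last 2 first.
  - exact: measurable_funM.
  - move=> x; rewrite mulr_ge0 ?normc_ge0//= -[leRHS]mulr1.
    by apply: ler_pM; rewrite ?normc_ge0 ?indic_le1//; exact: Fb.
  move=> h.
  have muSE : (mu S = \int[mu]_x (\1_S x)%:E)%E by rewrite integral_indic// setIT.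
  apply: (etrans muSE).
  have {h} : ((c + e)%:E * \int[mu]_x (\1_S x)%:E <= c%:E * \int[mu]_x (\1_S x)%:E)%E.
    apply: (@le_trans _ _ (\int[mu]_x (normc (F x) * \1_S x)%:E)%E).
      rewrite -ge0_integralZl//=; last 2 first.
      - exact/measurable_EFinP.
      - by rewrite lee_fin addr_ge0// ltW.
      apply: ge0_le_integral => //.
      - by move=> x _; rewrite -EFinM lee_fin mulr_ge0// addr_ge0// ltW.
      - by apply: emeasurable_funM => //; exact/measurable_EFinP.
      - by apply/measurable_EFinP; exact: measurable_funM.
      move=> x _; rewrite -EFinM lee_fin indicE.
      case: (boolP (x \in S)); last by rewrite !mulr0.
      by rewrite inE !mulr1 nS => /ltW.
    apply: (le_trans h); rewrite qE Lpnorm1E; apply: lee_wpmul2l; first by rewrite lee_fin.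
    apply: ge0_le_integral => //.
    - by move=> x _; rewrite lee_fin normc_ge0.
    - by apply/measurable_EFinP; apply: measurable_normc; case: Bg.
    - exact/measurable_EFinP.
    - by move=> x _; rewrite lee_fin.
  have : (\int[mu]_x (\1_S x)%:E)%E \is a fin_num.
    by rewrite -muSE; exact: fin_num_measure.
  have : (0 <= \int[mu]_x (\1_S x)%:E)%E.
    by apply: integral_ge0 => x _; rewrite lee_fin.
  case: (\int[mu]_x _)%E => [t| |]//= + _; rewrite lee_fin => t0; rewrite -!EFinM !lee_fin.
  rewrite mulrDl -subr_ge0 opprD addrA subrr add0r oppr_ge0 pmulr_rle0// => t0'.
  by congr EFin; apply/eqP; rewrite eq_le t0 t0'.
- have r1' := ltW r1; have r0 := lt_trans ltr01 r1; have s0 := lt_trans ltr01 s1.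
  have rsE : (r - 1) * s = r.
    move: rs => /(congr1 (fun x => x * (r * s))).
    rewrite mulrDl mulrA mulVf ?gt_eqF// mul1r mulrCA mulVf ?gt_eqF// mulr1 mul1r => h.
    by rewrite mulrBl mul1r -h addrAC subrr add0r.
  (* [(r - 1) * s = r], so the norm of the test function is a power of that of [F]. *)
  have := dual r r1'; rewrite qE LpnormE pE LpnormE.
  have -> : (\int[mu]_x (normc (ext r x) `^ s)%:E = \int[mu]_x (normc (F x) `^ r)%:E)%E.
    apply: eq_integral => x _; congr EFin; rewrite next//.
    case: eqP => [->|_]; last by rewrite -powRrM rsE.
    by rewrite Normc.normc0 !powR0 ?gt_eqF.
  set I := (\int[mu]_x _)%E => IC.
  have I0 : (0 <= I)%E by apply: integral_ge0 => x _; rewrite lee_fin powR_ge0.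
  have Ifin : (I <= (b `^ r)%:E)%E.
    apply: (@le_trans _ _ (\int[mu]_x (b `^ r)%:E)%E).
      apply: ge0_le_integral => //.
      - by move=> x _; rewrite lee_fin powR_ge0.
      - by apply/measurable_EFinP; exact: measurable_fun_powR.
      - move=> x _; rewrite lee_fin; apply: ge0_ler_powR; rewrite ?nnegrE ?normc_ge0//.
        exact: ltW.
    by rewrite integral_cst//= probability_setT mule1.
  move: C C0 {FC dual} IC => [c| |//] c0 IC; last by rewrite leey.
  case: I I0 Ifin IC => [i| |//] i0 Ifin IC; last by [].
  move: i0 IC; rewrite !poweR_EFin -EFinM !lee_fin le_eqVlt => /predU1P[<- _|i0 IC].
    by rewrite powR0 ?invr_eq0 ?gt_eqF.
  rewrite -(ler_pM2r (powR_gt0 s^-1 i0)) -powRD ?rs ?powRr1//; first exact: ltW.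
  by rewrite oner_eq0.
Qed.

End Lp_torus.

(** * Exponentials *)

Section exponentials.
Context {R : realType}.

Definition phase d (k : 'cV[int]_d) (x : 'cV[R]_d) : R :=
  2 * pi * \sum_i (k i 0)%:~R * x i 0.

Lemma cexpE d (k : 'cV[int]_d) (x : 'cV[R]_d) :
  cexp k x = cos (phase k x) +i* sin (phase k x).
Proof. by []. Qed.

Lemma phaseD d (k : 'cV[int]_d) (x y : 'cV[R]_d) : phase k (x + y) = phase k x + phase k y.
Proof.
rewrite /phase -mulrDr -big_split /=; congr (_ * _).
by apply: eq_bigr => i _; rewrite !mxE mulrDr.
Qed.

Lemma phaseDl d (k l : 'cV[int]_d) (x : 'cV[R]_d) : phase (k + l) x = phase k x + phase l x.
Proof.
rewrite /phase -mulrDr -big_split /=; congr (_ * _).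
by apply: eq_bigr => i _; rewrite !mxE rmorphD mulrDl.
Qed.

Lemma phaseZ d (k : 'cV[int]_d) (c : R) (x : 'cV[R]_d) : phase k (c *: x) = c * phase k x.
Proof.
rewrite /phase [RHS]mulrCA; congr (_ * _); rewrite mulr_sumr.
by apply: eq_bigr => i _; rewrite !mxE mulrCA.
Qed.

Lemma phaseN d (k : 'cV[int]_d) (x : 'cV[R]_d) : phase k (- x) = - phase k x.
Proof. by rewrite -scaleN1r phaseZ mulN1r. Qed.

Lemma phaseNl d (k : 'cV[int]_d) (x : 'cV[R]_d) : phase (- k) x = - phase k x.
Proof.
rewrite /phase -mulrN -sumrN; congr (_ * _).
by apply: eq_bigr => i _; rewrite !mxE rmorphN mulNr.
Qed.

Lemma cexpD d (k : 'cV[int]_d) (x y : 'cV[R]_d) : cexp k (x + y) = cexp k x * cexp k y.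
Proof.
rewrite !cexpE phaseD; apply: complexP; rewrite ?ReM ?ImM /= ?cosD ?sinD//.
by rewrite addrC; ring.
Qed.

Lemma cexpDl d (k l : 'cV[int]_d) (x : 'cV[R]_d) : cexp (k + l) x = cexp k x * cexp l x.
Proof.
rewrite !cexpE phaseDl; apply: complexP; rewrite ?ReM ?ImM /= ?cosD ?sinD//.
by rewrite addrC; ring.
Qed.

Lemma cexpNl d (k : 'cV[int]_d) (x : 'cV[R]_d) : cexp (- k) x = conjc (cexp k x).
Proof. by rewrite !cexpE phaseNl cosN sinN. Qed.

Lemma cexpN d (k : 'cV[int]_d) (x : 'cV[R]_d) : cexp k (- x) = cexp (- k) x.
Proof. by rewrite cexpNl !cexpE phaseN cosN sinN. Qed.

Lemma cexp0l d (x : 'cV[R]_d) : cexp 0 x = 1.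
Proof.
rewrite cexpE /phase big1 ?mulr0 ?cos0 ?sin0// => i _.
by rewrite mxE mul0r.
Qed.

Lemma normc_cexp d (k : 'cV[int]_d) (x : 'cV[R]_d) : normc (cexp k x) = 1.
Proof. by rewrite cexpE /= cos2Dsin2 sqrtr1. Qed.

Lemma cos_sin_2piz (n : int) : cos (2 * pi * n%:~R : R) = 1 /\ sin (2 * pi * n%:~R : R) = 0.
Proof.
have nat_case (m : nat) : cos (2 * pi * m%:R : R) = 1 /\ sin (2 * pi * m%:R : R) = 0.
  elim: m => [|m [IHc IHs]]; first by rewrite mulr0 cos0 sin0.
  have -> : 2 * pi * m.+1%:R = 2 * pi * m%:R + pi *+ 2 :> R.
    by rewrite mulrSr -mulr_natl; ring.
  by rewrite cosD2pi sinD2pi IHc IHs.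
case: n => m; first exact: nat_case.
have [c s] := nat_case m.+1.
by rewrite NegzE mulrNz mulrN cosN sinN c s oppr0.
Qed.

Lemma cexp_zvec d (k n : 'cV[int]_d) : cexp k (zvec n : 'cV[R]_d) = 1.
Proof.
rewrite cexpE /phase.
have -> : \sum_i (k i 0)%:~R * (zvec n : 'cV[R]_d) i 0 = (\sum_i k i 0 * n i 0)%:~R.
  by rewrite rmorph_sum; apply: eq_bigr => i _; rewrite mxE rmorphM.
by have [-> ->] := cos_sin_2piz (\sum_i k i 0 * n i 0).
Qed.

Lemma cexp_periodic d (k : 'cV[int]_d) : zperiodic (@cexp R d k).
Proof. by move=> n x; rewrite cexpD cexp_zvec mulr1. Qed.

Lemma measurable_phase d (k : 'cV[int]_d) : measurable_fun setT (@phase d k).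
Proof.
apply: measurable_funM; first exact: measurable_cst.
apply: measurable_sum => i; apply: measurable_funM; first exact: measurable_cst.
exact: measurable_coord.
Qed.

Lemma cmeasurable_cexp d (k : 'cV[int]_d) : cmeasurable (@cexp R d k).
Proof.
split => /=.
  apply: (measurableT_comp (continuous_measurable_fun (@continuous_cos R))).
  exact: measurable_phase.
apply: (measurableT_comp (continuous_measurable_fun (@continuous_sin R))).
exact: measurable_phase.
Qed.

Lemma cintegrable_cexp d (k : 'cV[int]_d) : cintegrable (@cexp R d k).
Proof.
apply: (@bounded_cintegrable _ _ _ 1); first exact: cmeasurable_cexp.
by move=> x; rewrite normc_cexp.
Qed.

(** For [k != 0] some translate of [cexp k] is its opposite, and the integral
   is invariant under translations. *)
Lemma cintegral_cexp d (k : 'cV[int]_d) : cintegral (@cexp R d k) = (k == 0)%:R.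
Proof.
have [->|k0] := eqVneq k 0.
  have -> : @cexp R d 0 = fun=> 1 by apply/funext => x; rewrite cexp0l.
  apply: complexP; rewrite /cintegral /= ?Rintegral_cst//= ?mul0r//.
  by rewrite mul1r; have := @probability_setT _ _ _ (@torus_measure R d) => ->.
have [i ki0] : exists i, k i 0 != 0.
  apply/existsP; apply: contra_neqT k0; rewrite negb_exists => /forallP k0.
  by apply/matrixP => i j; rewrite ord1 mxE; apply/eqP; have := k0 i; rewrite negbK.
have kR0 : (k i 0)%:~R != 0 :> R by rewrite intr_eq0.
pose a : 'cV[R]_d := (2 * (k i 0)%:~R)^-1 *: delta_mx i 0.
have ea : cexp k a = -1.
  have -> : cexp k a = cos pi +i* sin pi.
    rewrite cexpE; suff -> : phase k a = pi by [].
    rewrite phaseZ /phase (bigD1 i)//= big1 ?addr0; last first.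
      by move=> l li; rewrite mxE (negbTE li) mulr0.
    by rewrite mxE !eqxx mulr1; field.
  by rewrite cospi sinpi; apply: complexP => /=; rewrite ?oppr0.
have mk := cmeasurable_cexp k; have pk := @cexp_periodic d k.
have shift : cintegral (fun x => cexp k (x + a)) = cintegral (@cexp R d k).
  rewrite -(cintegral_reflect 0 mk pk).
  rewrite -(@cintegral_reflect _ _ (- a) (fun x => cexp k (0 - x))).
  - by congr cintegral; apply/funext => x; rewrite sub0r opprB opprK addrC.
  - apply: (cmeasurable_comp _ mk); under eq_fun do rewrite sub0r.
    exact: measurable_oppv.
  - by move=> n x; rewrite !sub0r !cexpN cexp_periodic.
move: shift; under eq_fun do rewrite cexpD ea mulrN1.
have -> : (fun x => - cexp k x) = (fun x => -1 * cexp k x :> R[i]).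
  by apply/funext => x; rewrite mulN1r.
rewrite cintegralZ; last exact: cintegrable_cexp.
set I := cintegral _ => /eqP; rewrite mulN1r -subr_eq0 -opprD oppr_eq0 -mulr2n mulrn_eq0/=.
by move/eqP.
Qed.

Lemma continuous_phase d (k : 'cV[int]_d) : continuous (@phase d k).
Proof.
have term (c : R) i : continuous (fun x : 'cV[R]_d => c * x i 0).
  move=> x; apply: (@continuous_comp _ _ _ (fun x : 'cV[R]_d => x i 0) (fun t => c * t)).
    exact: coord_continuous.
  exact: mulrl_continuous.
have sumc : continuous (fun x : 'cV[R]_d => \sum_i (k i 0)%:~R * x i 0).
  by apply: continuous_big => //; exact: add_continuous.
move=> x; apply: (@continuous_comp _ _ _ _ (fun t => 2 * pi * t)); first exact: sumc.
exact: mulrl_continuous.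
Qed.

Lemma smooth_trig d (k : 'cV[int]_d) (a b : R) :
  smooth_real (fun x => a * cos (@phase d k x) + b * sin (phase k x)).
Proof.
have der i a' b' (x : 'cV[R]_d) : is_derive x (delta_mx i 0)
    (fun x => a' * cos (phase k x) + b' * sin (phase k x))
    (phase k (delta_mx i 0) * b' * cos (phase k x)
      + - (phase k (delta_mx i 0) * a') * sin (phase k x)).
  set w := fun x => _; set c := phase k (delta_mx i 0); set t := phase k x.
  have wE (h : R) : w (h *: delta_mx i 0 + x) = a' * cos (h * c + t) + b' * sin (h * c + t).
    by rewrite /w phaseD phaseZ.
  have lin : is_derive (0 : R) 1 (fun h : R => h * c + t) c.
    by apply: is_derive_eq; rewrite /= scaler0 add0r addr0 [_%:A]mulr1.
  have dcos := @is_derive1_comp _ cos (fun h : R => h * c + t) 0 _ _ (is_derive_cos _) lin.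
  have dsin := @is_derive1_comp _ sin (fun h : R => h * c + t) 0 _ _ (is_derive_sin _) lin.
  have : is_derive (0 : R) 1 (fun h : R => w (h *: delta_mx i 0 + x))
     (a' *: (- sin (0 * c + t) * c) + b' *: (cos (0 * c + t) * c)).
    under eq_fun do rewrite wE.
    exact: is_deriveD.
  rewrite mul0r add0r => -[dw dwE].
  split; first exact/derivable1P.
  rewrite -[RHS](_ : a' *: (- sin t * c) + b' *: (cos t * c) = _); last first.
    by rewrite /GRing.scale/=; ring.
  rewrite -dwE /derive; set g1 := fun h => h^-1 *: _; set g2 := fun h => h^-1 *: _.
  suff -> : g1 = g2 by [].
  by apply/funext => h; rewrite /g1 /g2 /= addr0 scale0r add0r [_%:A]mulr1.
have form s : exists a' b', partial s (fun x => a * cos (@phase d k x) + b * sin (phase k x)) =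
    fun x => a' * cos (@phase d k x) + b' * sin (phase k x).
  elim: s => [|i s [a' [b' IH]]]; first by exists a, b.
  rewrite /= IH; do 2 eexists; apply/funext => x.
  by have [_ ->] := der i a' b' x.
move=> s; have [a' [b' ->]] := form s; split=> [x|i x]; last by have [] := der i a' b' x.
apply: (@continuous_comp _ _ _ (@phase d k) (fun t => a' * cos t + b' * sin t)).
  exact: continuous_phase.
set t := phase k x.
have ccos : a' * cos u @[u --> t] --> a' * cos t.
  apply: (@continuous_comp _ _ _ cos (fun v => a' * v)); first exact: continuous_cos.
  exact: mulrl_continuous.
have csin : b' * sin u @[u --> t] --> b' * sin t.
  apply: (@continuous_comp _ _ _ sin (fun v => b' * v)); first exact: continuous_sin.
  exact: mulrl_continuous.
exact: (cvgD ccos csin).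
Qed.

Lemma smooth_cexp d (k : 'cV[int]_d) : smooth (@cexp R d k).
Proof.
split; first exact: cexp_periodic.
  have -> : (fun x : 'cV[R]_d => Re (cexp k x)) =
      (fun x => 1 * cos (@phase d k x) + 0 * sin (phase k x)).
    by apply/funext => x; rewrite mul1r mul0r addr0.
  exact: smooth_trig.
have -> : (fun x : 'cV[R]_d => Im (cexp k x)) =
    (fun x => 0 * cos (@phase d k x) + 1 * sin (phase k x)).
  by apply/funext => x; rewrite mul1r mul0r add0r.
exact: smooth_trig.
Qed.

End exponentials.

(** * The cell of a diagonal integer matrix *)

Section lattice_cell.
Context {R : realType} {d : nat}.
Variable a : 'I_d -> int.
Hypothesis a_neq0 : forall i, a i != 0.
Local Notation aR i := ((a i)%:~R : R).
Implicit Types (k l n t : 'cV[int]_d).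

Definition diagR : 'M[R]_d := diag_mx (\row_i aR i).

Definition dilate n : 'cV[int]_d := \col_i (a i * n i 0).

Lemma aR_neq0 i : aR i != 0. Proof. by rewrite intr_eq0. Qed.

Lemma dilateD k n : dilate (k + n) = dilate k + dilate n.
Proof. by apply/matrixP => i j; rewrite !mxE mulrDr. Qed.

Lemma dilateN n : dilate (- n) = - dilate n.
Proof. by apply/matrixP => i j; rewrite !mxE mulrN. Qed.

Lemma diagR_mulE (x : 'cV[R]_d) i : (diagR *m x) i 0 = aR i * x i 0.
Proof. by rewrite /diagR mul_diag_mx !mxE. Qed.

Lemma diagR_unit : diagR \in unitmx.
Proof.
rewrite unitmxE det_diag unitfE; apply/prodf_neq0 => i _.
by rewrite mxE aR_neq0.
Qed.

Lemma invmx_diagR_mulE (x : 'cV[R]_d) i : (invmx diagR *m x) i 0 = x i 0 / aR i.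
Proof.
have := congr1 (fun y : 'cV[R]_d => y i 0) (mulKVmx diagR_unit x).
by rewrite diagR_mulE => <-; rewrite mulrAC divff ?mul1r// aR_neq0.
Qed.

Definition cell_point k : 'cV[R]_d := \col_i ((k i 0)%:~R / aR i).

Lemma cell_pointE k : cell_point k = invmx diagR *m zvec k.
Proof. by apply/matrixP => i j; rewrite ord1 invmx_diagR_mulE !mxE. Qed.

Lemma cell_pointD k n : cell_point (k + n) = cell_point k + cell_point n.
Proof. by apply/matrixP => i j; rewrite !mxE rmorphD mulrDl. Qed.

Lemma cell_pointN n : cell_point (- n) = - cell_point n.
Proof. by apply/matrixP => i j; rewrite !mxE rmorphN mulNr. Qed.

Lemma cell_point_dilate n : cell_point (dilate n) = zvec n.
Proof.
by apply/matrixP => i j; rewrite !mxE ord1 rmorphM/= mulrAC divff ?mul1r// aR_neq0.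
Qed.

Lemma cell_pointD_dilate k n i :
  cell_point (k + dilate n) i 0 = cell_point k i 0 + (n i 0)%:~R.
Proof. by rewrite cell_pointD cell_point_dilate [LHS]mxE [zvec _ _ _]mxE. Qed.

Lemma freqs_scaleP (c : R) k : 0 < c ->
  freqs (c *: diagR) k <-> forall i, - 2^-1 <= cell_point k i 0 / c < 2^-1.
Proof.
move=> c0; have cU : c != 0 by rewrite gt_eqF.
split=> [[x xc kx] i|kc].
  have -> : cell_point k i 0 / c = x i 0; last exact: xc.
  have := congr1 (fun y : 'cV[R]_d => y i 0) kx.
  have -> : (c *: diagR *m x) i 0 = c * (aR i * x i 0).
    by rewrite -scalemxAl mxE diagR_mulE.
  rewrite [zvec _ _ _]mxE [cell_point _ _ _]mxE => ->.
  by field; rewrite cU aR_neq0.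
exists (c^-1 *: cell_point k) => [i|]; first by rewrite mxE mulrC.
apply/matrixP => i j; rewrite ord1 -scalemxAl -scalemxAr scalerA divff// scale1r diagR_mulE.
by rewrite !mxE mulrCA divff ?mulr1// aR_neq0.
Qed.

Lemma freqsP k : freqs diagR k <-> forall i, - 2^-1 <= cell_point k i 0 < 2^-1.
Proof.
rewrite -[diagR]scale1r (freqs_scaleP _ ltr01).
by split=> h i; have := h i; rewrite divr1.
Qed.

Lemma freqs_scale_sub (b c : R) k : 0 < b -> b <= c ->
  freqs (b *: diagR) k -> freqs (c *: diagR) k.
Proof.
move=> b0 bc; have c0 := lt_le_trans b0 bc.
move=> /(freqs_scaleP _ b0) kb; apply/(freqs_scaleP _ c0) => i.
have := kb i; rewrite !ler_pdivlMr// !ltr_pdivrMr// => /andP[k1 k2].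
have hbc : 2^-1 * b <= 2^-1 * c by rewrite ler_pM2l// invr_gt0.
by rewrite (lt_le_trans k2)// andbT (le_trans _ k1)// !mulNr lerN2.
Qed.

Lemma freqs0 (c : R) : 0 < c -> freqs (c *: diagR) 0.
Proof.
move=> c0; apply/(freqs_scaleP _ c0) => i.
by rewrite !mxE !mul0r oppr_le0 invr_ge0 invr_gt0 ltr0n ler0n.
Qed.

Lemma finite_freqs (c : R) : 0 < c -> c <= 1 -> finite_set (freqs (c *: diagR)).
Proof.
move=> c0 c1.
pose N := (\max_i `|a i|%N)%N.
pose f (g : {ffun 'I_d -> 'I_(N + N).+1}) : 'cV[int]_d := \col_i ((g i)%:Z - N%:Z).
apply: (@sub_finite_set _ _ (f @` [set: {ffun 'I_d -> 'I_(N + N).+1}])); last first.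
  exact: finite_image.
move=> k /(freqs_scale_sub c0 c1); rewrite scale1r => /freqsP kP.
have kN i : (absz (k i ord0) <= N)%N.
  apply: leq_trans (leq_bigmax i).
  rewrite -(ler_nat R) !natr_absz -(ler_pM2r (_ : 0 < 2^-1 :> R))//.
  have := kP i; rewrite mxE => /andP[k1 k2].
  have : `|(k i 0)%:~R / aR i| <= 2^-1 by rewrite ler_norml k1 ltW.
  rewrite normrM normfV ler_pdivrMr ?normr_gt0 ?aR_neq0// -!intr_norm mulrC => h.
  apply: le_trans h; rewrite ler_piMr// ?ler0z//.
  by rewrite invf_le1// ler1n.
exists [ffun i => inord (absz (k i 0 + N%:Z))] => //.
apply/matrixP => i j; rewrite ord1 mxE ffunE.
have := kN i; move: (k i 0) => z zN.
rewrite inordK; last by lia.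
lia.
Qed.

Definition cell : seq (lattice d) := finmap.enum_fset (fset_set (freqs diagR)).

Lemma finite_cell : finite_set (freqs diagR).
Proof. by rewrite -[diagR]scale1r; exact: finite_freqs. Qed.

Lemma mem_cell k : (k \in cell) <-> freqs diagR k.
Proof. by rewrite [_ \in _]in_fset_set ?inE//; exact: finite_cell. Qed.

Lemma uniq_cell : uniq cell. Proof. exact: finmap.fset_uniq. Qed.

(** The points of the cell represent the cosets of [dilate Z^d]: rounding
   [k_i / a_i] to the nearest integer reduces any [k] into the cell. *)
Definition cell_quot k : 'cV[int]_d := \col_i Num.floor (cell_point k i 0 + 2^-1).
Definition cell_mod k : 'cV[int]_d := k - dilate (cell_quot k).

Lemma cell_mod_mem k : cell_mod k \in cell.
Proof.
apply/mem_cell/freqsP => i.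
rewrite /cell_mod -dilateN cell_pointD_dilate [(- cell_quot k) i 0]mxE [cell_quot _ _ _]mxE.
set y := cell_point k i 0; have := floor_itv (y + 2^-1).
rewrite intrD => /andP[h1 h2]; have half : (2^-1 + 2^-1 = 1 :> R) by field.
lra.
Qed.

Lemma cell_inj k l n : k \in cell -> l \in cell -> k = l + dilate n -> n = 0.
Proof.
move=> /mem_cell/freqsP kc /mem_cell/freqsP lc kl.
apply/matrixP => i j; rewrite ord1 [RHS]mxE.
have := congr1 (fun y : 'cV[R]_d => y i 0) (congr1 cell_point kl).
rewrite /= cell_pointD_dilate => e.
have := kc i; have := lc i; rewrite e => /andP[l1 l2] /andP[k1 k2].
have half : (2^-1 + 2^-1 = 1 :> R) by field.
have h1 : (n i 0)%:~R < 1%:~R :> R by rewrite -[1%:~R]/(1 : R); lra.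
have h2 : (-1)%:~R < (n i 0)%:~R :> R by rewrite rmorphN /= -[1%:~R]/(1 : R); lra.
move: h1 h2; rewrite !ltr_int; lia.
Qed.

Lemma cell_mod_id k : k \in cell -> cell_mod k = k.
Proof.
move=> kc; have n0 : cell_quot k = 0.
  by apply: (cell_inj kc (cell_mod_mem k)); rewrite /cell_mod subrK.
by rewrite /cell_mod n0 /dilate; apply/matrixP => i j; rewrite !mxE mulr0 subr0.
Qed.

Lemma cell_mod_inj k l : cell_mod k = cell_mod l -> exists n, k = l + dilate n.
Proof.
move=> e; exists (cell_quot k - cell_quot l).
rewrite dilateD dilateN -[LHS](subrK (dilate (cell_quot k))) -/(cell_mod k) e /cell_mod.
by rewrite -!addrA; congr (_ + _); rewrite addrC.
Qed.

(** A function that only depends on the coset modulo [dilate Z^d] has the same sum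
   over every system of representatives. *)
Lemma big_cell_reindex (T : Type) (idx : T) (op : Monoid.com_law idx)
    (F : 'cV[int]_d -> T) (sigma : 'cV[int]_d -> 'cV[int]_d) :
  (forall k n, F (k + dilate n) = F k) ->
  (forall k l n, sigma k = sigma l + dilate n -> exists n', k = l + dilate n') ->
  \big[op/idx]_(k <- cell) F (sigma k) = \big[op/idx]_(k <- cell) F k.
Proof.
move=> Fper sigma_inj.
have Fmod k : F (cell_mod k) = F k by rewrite -(Fper _ (cell_quot k)) subrK.
under eq_bigr do rewrite -Fmod.
rewrite -(big_map (fun k => cell_mod (sigma k)) predT F).
apply: perm_big; set s := map _ _.
have us : uniq s.
  rewrite map_inj_in_uniq ?uniq_cell// => k l kc lc /cell_mod_inj[n] /sigma_inj[n' e].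
  by rewrite e (cell_inj kc lc e) -[RHS]addr0; congr (_ + _); apply/matrixP => i j; rewrite !mxE mulr0.
have sub : {subset s <= cell} by move=> _ /mapP[k _ ->]; exact: cell_mod_mem.
have [_ eqm] := uniq_min_size us sub (eq_leq (esym (size_map _ _))).
by apply: uniq_perm => //; exact: uniq_cell.
Qed.

Lemma big_cellD (T : Type) (idx : T) (op : Monoid.com_law idx) (F : 'cV[int]_d -> T) l :
  (forall k n, F (k + dilate n) = F k) ->
  \big[op/idx]_(k <- cell) F (k + l) = \big[op/idx]_(k <- cell) F k.
Proof.
move=> Fper; apply: (@big_cell_reindex _ _ op F (fun k => k + l)) => // k t n.
by rewrite addrAC => /addIr ->; exists n.
Qed.

Lemma big_cellN (T : Type) (idx : T) (op : Monoid.com_law idx) (F : 'cV[int]_d -> T) :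
  (forall k n, F (k + dilate n) = F k) ->
  \big[op/idx]_(k <- cell) F (- k) = \big[op/idx]_(k <- cell) F k.
Proof.
move=> Fper; apply: (@big_cell_reindex _ _ op F (fun k => - k)) => // k t n e.
by exists (- n); rewrite -[LHS]opprK e opprD opprK dilateN.
Qed.

(** The reduction modulo the cell maps the box of the points [l] such that
   [0 <= l_i < |a_i|] one-to-one onto the cell. *)
Lemma size_cell : size cell = (\prod_i `|a i|%N)%N.
Proof.
pose T := {dffun forall i : 'I_d, 'I_`|a i|%N}.
have cardT : #|{: T}| = (\prod_i `|a i|%N)%N.
  by rewrite card_dep_ffun foldrE big_map big_enum; apply: eq_bigr => i _; rewrite card_ord.
rewrite -cardT cardE -(size_map (fun f : T => cell_mod (\col_i (f i : nat)%:Z))).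
apply: perm_size; apply: uniq_perm; first exact: uniq_cell.
  rewrite map_inj_uniq ?enum_uniq// => f g /cell_mod_inj[n /matrixP fg].
  apply/ffunP => i; apply: val_inj => /=.
  have := fg i 0; rewrite !mxE; have := ltn_ord (f i); have := ltn_ord (g i).
  move: (f i : nat) (g i : nat) (n i 0) => u v w.
  have := a_neq0 i; move: (a i) => b b0 ub vb e.
  have [w0|w0] := eqVneq w 0; first by move: e; rewrite w0 mulr0 addr0 => -[].
  exfalso; have : (absz b <= absz (b * w)%R)%N by rewrite abszM leq_pmulr// absz_gt0.
  by move: e ub vb; move: (b * w) => m; lia.
move=> k; apply/idP/idP => [kc|/mapP[f _ ->]]; last exact: cell_mod_mem.
have ltm i : (absz (k i ord0 %% a i)%Z < absz (a i))%N.
  by rewrite -ltz_nat gez0_abs ?modz_ge0// ltz_mod.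
apply/mapP; exists [ffun i => Ordinal (ltm i)]; first by rewrite mem_enum.
apply: esym; rewrite -[RHS](cell_mod_id kc).
set l := \col_i _.
have -> : l = k + dilate (\col_i - (k i ord0 %/ a i)%Z).
  apply/matrixP => i j; rewrite !mxE ffunE /= (ord1 j) gez0_abs ?modz_ge0//.
  apply/eqP; rewrite mulrN mulrC eq_sym subr_eq addrC; apply/eqP; exact: divz_eq.
apply: esym; have := cell_mod_mem k; have := cell_mod_mem (k + dilate (\col_i - (k i ord0 %/ a i)%Z)).
set m := \col_i _ => c1 c2.
have e : cell_mod k = cell_mod (k + dilate m) + dilate (cell_quot (k + dilate m) - cell_quot k - m).
  by rewrite /cell_mod !dilateD !dilateN; apply/matrixP => i j; rewrite !mxE; ring.
rewrite {1}e (cell_inj c2 c1 e) -[RHS]addr0; congr (_ + _).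
by apply/matrixP => i j; rewrite !mxE mulr0.
Qed.

Lemma size_cell_gt0 : (0 < size cell)%N.
Proof. by rewrite size_cell prodn_gt0// => i; rewrite absz_gt0. Qed.

Lemma cell_neq_nil : cell != [::]. Proof. by rewrite -size_eq0 -lt0n size_cell_gt0. Qed.

End lattice_cell.

(** * Fejer and de la Vallee-Poussin kernels of the cell *)

Section sampling_kernel.
Context {R : realType} {d : nat}.
Variable a : 'I_d -> int.
Hypothesis a_neq0 : forall i, a i != 0.
Local Notation V := 'cV[R]_d.
Local Notation mu := (@torus_measure R d).
Local Notation D := (@cell R d a).
Local Notation N := (size D).
Local Notation pt := (@cell_point R d a).
Local Notation dil := (dilate a).
Local Notation cmod := (@cell_mod R d a).
Implicit Types (k l n t : 'cV[int]_d) (x y : V).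

Lemma cos_2pi_eq1 (u : R) : cos (2 * pi * u) = 1 -> exists n : int, u = n%:~R.
Proof.
move=> cu; exists (Num.floor u); set f := u - (Num.floor u)%:~R.
have /andP[h1 h2] := floor_itv u.
have f0 : 0 <= f by rewrite subr_ge0.
have f1 : f < 1 by rewrite ltrBlDr addrC -[X in _ + X]/(1%:~R) -intrD.
suff f_eq0 : f = 0 by apply/eqP; rewrite -subr_eq0 -/f f_eq0.
have cf : cos (2 * pi * f) = 1.
  have [c s] := @cos_sin_2piz R (Num.floor u).
  by rewrite /f mulrBr cosB c s mulr1 mulr0 addr0.
have sf : sin (pi * f) = 0.
  move: cf; have -> : 2 * pi * f = (pi * f) *+ 2 :> R by rewrite -[RHS]mulr_natl mulrA.
  rewrite cos_mulr2n cos2sin2 => h; apply/eqP; rewrite -sqrf_eq0; apply/eqP; lra.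
apply/eqP; rewrite eq_le f0 andbT leNgt; apply/negP => fp.
have : 0 < sin (pi * f) by apply: sin_gt0_pi; rewrite mulr_gt0 ?pi_gt0//= gtr_pMr// pi_gt0.
by rewrite sf ltxx.
Qed.

Lemma cexp_cell_point_dilate l k n : cexp l (pt (k + dil n)) = cexp l (pt k).
Proof. by rewrite cell_pointD cell_point_dilate// cexpD cexp_zvec mulr1. Qed.

(** Shifting the summation index by a basis vector multiplies the sum by a constant,
   which differs from [1] for some direction when [l] is not in [dilate Z^d]. *)
Lemma sum_cexp_cell l : (forall n, l != dil n) -> \sum_(k <- D) cexp l (pt k) = 0.
Proof.
move=> ln.
have [i il] : exists i, forall n : int, l i 0 != a i * n.
  apply: contrapT => /forallNP h.
  have {}h i : exists n : int, l i 0 = a i * n.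
    by apply: contrapT => h'; apply: (h i) => n; apply/eqP => e; apply: h'; exists n.
  pose n := \col_i xget 0 [set n : int | l i 0 = a i * n].
  have := ln n; rewrite (_ : dil n = l) ?eqxx//.
  apply/matrixP => i j; rewrite !mxE ord1.
  by case: xgetP => [? _ -> //|]; have [m e] := h i => /(_ m).
have e1 : cexp l (pt (delta_mx i 0)) != 1.
  apply/eqP => /(congr1 (@complex.Re R)) h.
  have [n] : exists n : int, (l i 0)%:~R / (a i)%:~R = n%:~R :> R.
    apply: cos_2pi_eq1; rewrite -[RHS]h; congr (cos _).
    rewrite /phase (bigD1 i)//= big1 ?addr0; last first.
      by move=> m mi; rewrite !mxE (negbTE mi) mul0r mulr0.
    by rewrite !mxE !eqxx mul1r.
  move=> /(canRL (divfK (@aR_neq0 R d a a_neq0 i))); rewrite -intrM mulrC => /intr_inj e.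
  by have := il n; rewrite e eqxx.
pose S := \sum_(k <- D) cexp l (pt k).
have : \sum_(k <- D) cexp l (pt (k + delta_mx i 0)) = S.
  rewrite (@big_cellD R d a a_neq0 _ _ _ (fun k => cexp l (pt k)))//.
  by move=> k n; exact: cexp_cell_point_dilate.
under eq_bigr do rewrite cell_pointD cexpD.
rewrite -mulr_suml -/S => /eqP; rewrite -subr_eq0 -[X in _ - X]mulr1 -mulrBr mulf_eq0.
by rewrite subr_eq0 (negbTE e1) orbF => /eqP.
Qed.

Lemma sum_cexp_cell_ortho l t : l \in D -> t \in D ->
  \sum_(k <- D) cexp (l - t) (pt k) = (if l == t then N%:R else 0 : R[i]).
Proof.
move=> lD tD; case: eqVneq => [->|lt].
  under eq_bigr do rewrite subrr cexp0l.
  by rewrite big_const_seq count_predT iter_addr addr0.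
apply: sum_cexp_cell => n; apply/eqP => e; move/eqP: lt; apply.
have e' : l = t + dil n by rewrite -e addrC subrK.
by rewrite e' (cell_inj a_neq0 lD tD e'); apply/matrixP => i j; rewrite !mxE mulr0 addr0.
Qed.

Definition dirichlet x : R[i] := \sum_(t <- D) cexp t x.
Definition fejer x : R := N%:R^-1 * normc (dirichlet x) ^+ 2.

Lemma N_gt0 : 0 < N%:R :> R. Proof. by rewrite ltr0n size_cell_gt0. Qed.

Lemma fejer_ge0 x : 0 <= fejer x.
Proof. by rewrite mulr_ge0 ?invr_ge0 ?(ltW N_gt0)// sqr_ge0. Qed.

Lemma cmeasurable_dirichlet : cmeasurable dirichlet.
Proof. by apply: cmeasurable_sum => t; exact: cmeasurable_cexp. Qed.

Lemma measurable_fejer : measurable_fun setT fejer.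
Proof.
apply: measurable_funM; first exact: measurable_cst.
by apply: measurable_funX; apply: measurable_normc; exact: cmeasurable_dirichlet.
Qed.

Lemma fejerN x : fejer (- x) = fejer x.
Proof.
rewrite /fejer /dirichlet; under eq_bigr do rewrite cexpN cexpNl.
by rewrite -rmorph_sum normcJ.
Qed.

Lemma fejer_periodic k x : fejer (x + zvec k) = fejer x.
Proof.
by rewrite /fejer /dirichlet; under eq_bigr do rewrite cexp_periodic.
Qed.

(** The frequencies of the cell are pairwise incongruent, so the translates of
   the Fejer kernel by the nodes form a partition of unity. *)
Lemma mean_fejer x : N%:R^-1 * \sum_(k <- D) fejer (x - pt k) = 1.
Proof.
suff sumD : \sum_(k <- D) normc (dirichlet (x - pt k)) ^+ 2 = N%:R ^+ 2.
  rewrite /fejer -mulr_sumr sumD mulrA -invfM -expr2 mulVf//.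
  by rewrite expf_neq0// gt_eqF// N_gt0.
apply: (@complexI R); rewrite rmorph_sum /=.
under eq_bigr do rewrite -mulcJ /dirichlet rmorph_sum mulr_suml.
under eq_bigr do under eq_bigr do rewrite mulr_sumr.
have termE s t k : cexp s (x - pt k) * conjc (cexp t (x - pt k)) =
    cexp (s - t) x * cexp (t - s) (pt k).
  by rewrite -cexpNl -cexpDl cexpD cexpN opprB.
under eq_bigr do under eq_bigr do under eq_bigr do rewrite termE.
rewrite exchange_big /=; under eq_bigr do rewrite exchange_big /=.
under eq_bigr do under eq_bigr do rewrite -mulr_sumr.
transitivity (\sum_(s <- D) N%:R : R[i]).
  apply: eq_big_seq => s sD.
  rewrite (bigD1_seq s)//=; last exact: uniq_cell.
  rewrite sum_cexp_cell_ortho// eqxx subrr cexp0l mul1r.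
  rewrite big_seq_cond big1 ?addr0// => t /andP[tD ts].
  by rewrite sum_cexp_cell_ortho// (negbTE ts) mulr0.
rewrite big_const_seq count_predT iter_addr addr0 rmorphXn /= rmorph_nat expr2.
by rewrite mulr_natr.
Qed.

Lemma mean_fejerC x : N%:R^-1 * \sum_(k <- D) fejer (pt k - x) = 1.
Proof.
rewrite -[RHS](mean_fejer x); congr (_ * _); apply: eq_bigr => k _.
by rewrite -fejerN opprB.
Qed.

(** The translates by the nodes have the same integral, and their mean is [1]. *)
Lemma integral_fejer x : (\int[mu]_y (fejer (x - y))%:E = 1)%E.
Proof.
have mfE : measurable_fun setT (fun y => (fejer y)%:E) by apply/measurable_EFinP; exact: measurable_fejer.
have f0 y : (0 <= (fejer y)%:E)%E by rewrite lee_fin fejer_ge0.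
have pf : operiodic (fun y => (fejer y)%:E) by move=> k y; rewrite fejer_periodic.
have shift z : (\int[mu]_y (fejer (z - y))%:E = \int[mu]_y (fejer y)%:E)%E.
  by rewrite (ge0_integral_torus_reflect z mfE f0 pf).
rewrite shift.
have mz z : measurable_fun setT (fun y => (fejer (z - y))%:E).
  apply: (measurableT_comp mfE).
  exact: (measurableT_comp (measurable_addl z) (@measurable_oppv R d)).
transitivity (\int[mu]_y ((N%:R^-1)%:E * \sum_(k <- D) (fejer (- pt k - y))%:E))%E.
  rewrite ge0_integralZl//; last 2 first.
  - by apply: emeasurable_sum => k; exact: mz.
  - by move=> y _; apply: sume_ge0 => k _.
  rewrite ge0_integral_sum//.
  under [in RHS]eq_bigr do rewrite shift.
  have [I|] := boolP ((\int[mu]_y (fejer y)%:E)%E \is a fin_num); last first.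
    rewrite ge0_fin_numE ?integral_ge0// -leNgt leye_eq => /eqP ->.
    have := N_gt0; have := @uniq_cell R d a; case: (D) => [|k s] _; first by rewrite ltxx.
    rewrite big_cons addye; last by rewrite -ltNye (lt_le_trans ltNy0)// sume_ge0.
    by move=> n0; rewrite gt0_muley// lte_fin invr_gt0.
  rewrite -(fineK I) sumEFin big_const_seq count_predT iter_addr addr0 -EFinM.
  by rewrite -[fine _ *+ _]mulr_natl mulrA mulVf ?mul1r// gt_eqF// N_gt0.
rewrite (eq_integral (fun=> 1%E)) ?integral_cst//= ?mul1e ?probability_setT// => y _.
rewrite sumEFin -EFinM; congr EFin.
rewrite -[RHS](mean_fejer (- y)); congr (_ * _); apply: eq_bigr => k _.
by rewrite addrC.
Qed.

(** The kernel [|D|^-1 * dirichlet^2] has Fourier support in [D + D], and the sum of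
   its coefficients over a coset of [dilate Z^d] is [1]. On [D] the shifts by
   [dilate] of vectors with entries in {-1, 0, 1} collect the whole coset, so the
   coefficients of the product with [sign_sum] are equal to [1] there. Since
   [sign_sum] has [3 ^ d] terms, the product is dominated by [3 ^ d * fejer]. *)
Definition signs (f : {ffun 'I_d -> 'I_3}) : 'cV[int]_d := \col_i ((f i : nat)%:Z - 1).
Definition sign_sum x : R[i] :=
  \sum_(f <- enum [set: {ffun 'I_d -> 'I_3}]%SET) cexp (dil (signs f)) x.
Definition vp_kernel x : R[i] := (N%:R^-1)%:C * dirichlet x ^+ 2 * sign_sum x.
Definition vp_const : R := (3 ^ d)%:R.

Lemma vp_const_ge0 : 0 <= vp_const. Proof. exact: ler0n. Qed.

Lemma normc_vp_kernel x : normc (vp_kernel x) <= vp_const * fejer x.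
Proof.
rewrite /vp_kernel !Normc.normcM normcR ger0_norm ?invr_ge0 ?(ltW N_gt0)//.
rewrite -expr2 -/(fejer x) mulrC ler_wpM2r ?fejer_ge0//.
apply: (le_trans (normc_sum _ _)); under eq_bigr do rewrite normc_cexp.
rewrite big_const_seq count_predT iter_addr addr0 -cardE cardsT card_ffun !card_ord.
by rewrite lexx.
Qed.

Lemma cmeasurable_vp_kernel : cmeasurable vp_kernel.
Proof.
apply: cmeasurableM; last by apply: cmeasurable_sum => f; exact: cmeasurable_cexp.
apply: cmeasurableM; first exact: cmeasurable_cst.
by apply: cmeasurableM; exact: cmeasurable_dirichlet.
Qed.

Lemma sum_cell_signs t (G : 'cV[int]_d -> R[i]) : t \in D ->
  (forall l, l \notin D -> G l = 0) ->
  \sum_(s <- D) \sum_(f <- enum [set: {ffun 'I_d -> 'I_3}]%SET) G (t + s + dil (signs f)) =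
  \sum_(l <- D) G l.
Proof.
move=> tD G0; set E := enum _.
pose g (s : 'cV[int]_d) f := t + s + dil (signs f).
transitivity (\sum_(l <- [seq g s f | s <- D, f <- E]) G l).
  by rewrite big_allpairs_dep.
set L := [seq _ | _ <- _, _ <- _].
have dil_inj u v : dil u = dil v -> u = v.
  move=> e; apply/matrixP => i j; move/matrixP: e => /(_ i j); rewrite !mxE ord1.
  exact: mulfI.
have signs_inj : injective signs.
  move=> f h /matrixP e; apply/ffunP => i; apply: val_inj => /=.
  by have := e i 0; rewrite !mxE => /addIr [].
have gE s f s' f' : s \in D -> s' \in D -> g s f = g s' f' -> s = s' /\ f = f'.
  move=> sD sD' e.
  have e1 : s = s' + dil (signs f' - signs f).
    apply: (addrI t); rewrite dilateD dilateN addrA addrA -/(g s' f') -e /g.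
    by rewrite addrK.
  have z := cell_inj a_neq0 sD sD' e1.
  split; last by apply: signs_inj; apply/eqP; rewrite eq_sym -subr_eq0 z.
  by rewrite e1 z -[RHS]addr0; congr (_ + _); apply/matrixP => i j; rewrite !mxE mulr0.
have uL : uniq L.
  apply: allpairs_uniq; [exact: uniq_cell|exact: enum_uniq|].
  move=> [s f] [s' f'] /= /allpairsP[[s1 f1] /= [s1D _ [-> _]]] /allpairsP[[s2 f2] /= [s2D _ [-> _]]].
  by move=> /(gE _ _ _ _ s1D s2D)[-> ->].
have -> : \sum_(l <- L) G l = \sum_(l <- [seq l <- L | l \in D]) G l.
  rewrite big_filter [RHS]big_mkcond; apply: eq_bigr => l _.
  by case: ifPn => // lD; exact: G0.
apply: perm_big; apply: uniq_perm; [exact: filter_uniq|exact: uniq_cell|].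
move=> l; rewrite mem_filter andb_idr// => lD.
pose n := @cell_quot R d a (l - t).
have sD : cmod (l - t) \in D by exact: cell_mod_mem.
have lE : l = t + cmod (l - t) + dil n.
  by rewrite /cell_mod -addrA subrK addrC subrK.
have n3 i : (- 1 <= n i 0 <= 1)%R.
  move/(mem_cell a_neq0)/(freqsP a_neq0): (tD) => /(_ i) /andP[t1 t2].
  move/(mem_cell a_neq0)/(freqsP a_neq0): (sD) => /(_ i) /andP[s1 s2].
  move/(mem_cell a_neq0)/(freqsP a_neq0): (lD) => /(_ i).
  have -> : pt l i 0 = pt t i 0 + pt (cmod (l - t)) i 0 + (n i 0)%:~R.
    rewrite {1}lE cell_pointD_dilate//; congr (_ + _).
    by rewrite [LHS]mxE [pt t i 0]mxE [pt (cmod _) i 0]mxE [(t + _) i 0]mxE rmorphD mulrDl.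
  move=> /andP[l1 l2].
  have half : (2^-1 + 2^-1 = 1 :> R) by field.
  have b1 : (-2)%:~R < (n i 0)%:~R :> R by rewrite rmorphN /= -[2%:~R]/(2%:R : R); lra.
  have b2 : (n i 0)%:~R < 2%:~R :> R by rewrite -[2%:~R]/(2%:R : R); lra.
  move: b1 b2; rewrite !ltr_int; move: (n i 0) => z; clear; lia.
apply/allpairsP; exists (cmod (l - t), [ffun i => inord (absz (n i ord0 + 1))]) => /=.
split=> //; first by rewrite mem_enum inE.
rewrite {1}lE /g; congr (_ + dil _); apply/matrixP => i j; rewrite ord1 [RHS]mxE ffunE.
move: (n3 i); move: (n i 0) => z z3; clear - z3.
by rewrite inordK; lia.
Qed.

Lemma vp_kernelE x : vp_kernel x = (N%:R^-1)%:C *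
  \sum_(t <- D) \sum_(s <- D) \sum_(f <- enum [set: {ffun 'I_d -> 'I_3}]%SET)
    cexp (t + s + dil (signs f)) x.
Proof.
rewrite /vp_kernel -mulrA; congr (_ * _).
rewrite expr2 /dirichlet /sign_sum mulr_suml mulr_suml; apply: eq_bigr => t _.
rewrite -mulrA mulr_suml mulr_sumr; apply: eq_bigr => s _.
by rewrite !mulr_sumr; apply: eq_bigr => f _; rewrite !cexpDl mulrA.
Qed.

(** A function with spectrum in [D] only sees the coefficients of the kernel on [D],
   which are equal to [1]. *)
Lemma vp_reproduces (v : V -> R[i]) x : cintegrable v ->
  (forall l, l \notin D -> fourier v l = 0) ->
  cintegral (fun y => vp_kernel (x - y) * v y) = \sum_(l <- D) fourier v l * cexp l x.
Proof.
move=> vi v0.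
have cint m : cintegrable (fun y => v y * cexp (- m) y).
  case: vi => mv voo; split; first by apply: cmeasurableM => //; exact: cmeasurable_cexp.
  by under eq_integral do rewrite Normc.normcM normc_cexp mulr1.
pose term t s f := fun y => cexp (t + s + dil (signs f)) x * (v y * cexp (- (t + s + dil (signs f))) y).
have -> : (fun y => vp_kernel (x - y) * v y) = fun y => (N%:R^-1)%:C *
    \sum_(t <- D) \sum_(s <- D) \sum_(f <- enum [set: {ffun 'I_d -> 'I_3}]%SET) term t s f y.
  apply/funext => y; rewrite vp_kernelE -mulrA; congr (_ * _).
  rewrite mulr_suml; apply: eq_bigr => t _; rewrite mulr_suml; apply: eq_bigr => s _.
  rewrite mulr_suml; apply: eq_bigr => f _; rewrite /term cexpD cexpN.
  by rewrite -mulrA; congr (_ * _); rewrite mulrC.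
have ti t s f : cintegrable (term t s f) by exact: cintegrableZ.
have tsi t s : cintegrable (fun y => \sum_(f <- enum [set: {ffun 'I_d -> 'I_3}]%SET) term t s f y).
  by apply: cintegrable_sum => f; exact: ti.
have tti t : cintegrable (fun y => \sum_(s <- D) \sum_(f <- enum [set: {ffun 'I_d -> 'I_3}]%SET) term t s f y).
  by apply: cintegrable_sum => s; exact: tsi.
rewrite cintegralZ; last by apply: cintegrable_sum => t; exact: tti.
rewrite cintegral_sum//.
under eq_bigr do (rewrite cintegral_sum//; under eq_bigr do (rewrite cintegral_sum//; under eq_bigr do rewrite cintegralZ//)).
transitivity ((N%:R^-1)%:C * \sum_(t <- D) \sum_(l <- D) cexp l x * fourier v l).
  congr (_ * _); apply: eq_big_seq => t tD.
  rewrite -(@sum_cell_signs t (fun l => cexp l x * fourier v l))// => l /v0 ->.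
  by rewrite mulr0.
have NE : (N%:R^-1)%:C * N%:R = 1 :> R[i].
  by rewrite -(rmorph_nat (real_complex R)) -rmorphM /= mulVf ?gt_eqF ?N_gt0// rmorph1.
rewrite big_const_seq count_predT iter_addr addr0; set S := \sum_(l <- D) _.
by rewrite -[S *+ _]mulr_natl mulrA NE mul1r; apply: eq_bigr => l _; rewrite mulrC.
Qed.

End sampling_kernel.

(** * Sampling and synthesis of trigonometric polynomials *)

Section sampling.
Context {R : realType} {d : nat}.
Variable a : 'I_d -> int.
Hypothesis a_neq0 : forall i, a i != 0.
Local Notation V := 'cV[R]_d.
Local Notation mu := (@torus_measure R d).
Local Notation D := (@cell R d a).
Local Notation N := (size D).
Local Notation pt := (@cell_point R d a).
Local Notation A := (@diagR R d a).
Local Notation vp := (@vp_kernel R d a).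
Local Notation C3 := (@vp_const R d).
Local Notation nu := (@mean_measure R d D).
Implicit Types (k l n t : 'cV[int]_d) (x y : V) (c : 'cV[int]_d -> R[i]).

Lemma in_B_bounded_integrable (f : V -> R[i]) : in_B f -> cintegrable f.
Proof. by move=> [_ mf [b fb]]; exact: bounded_cintegrable fb. Qed.

Lemma cintegrableM_bounded (g f : V -> R[i]) (b : R) : cmeasurable g ->
  (forall x, normc (g x) <= b) -> cintegrable f -> cintegrable (fun x => g x * f x).
Proof.
move=> mg gb [mf foo]; split; first exact: cmeasurableM.
have b0 : 0 <= b := le_trans (normc_ge0 _) (gb 0).
apply: (@le_lt_trans _ _ (b%:E * \int[mu]_x (normc (f x))%:E)%E).
  rewrite -ge0_integralZl//; last 2 first.
  - by apply/measurable_EFinP; exact: measurable_normc.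
  - by move=> x _; rewrite lee_fin normc_ge0.
  apply: ge0_le_integral => //.
  - by move=> x _; rewrite lee_fin normc_ge0.
  - by apply/measurable_EFinP; apply: measurable_normc; exact: cmeasurableM.
  - by apply: emeasurable_funM => //; apply/measurable_EFinP; exact: measurable_normc.
  - by move=> x _; rewrite -EFinM lee_fin Normc.normcM ler_wpM2r ?normc_ge0.
by rewrite lte_mul_pinfty// ge0_fin_numE// integral_ge0// => x _; rewrite lee_fin normc_ge0.
Qed.

Definition cellpoly c x : R[i] := \sum_(k <- D) c k * cexp k x.

(** All the polynomials are written with coefficients on one finite list, the cell of
   [A], whatever the factor [b <= 1]. *)
Lemma trigpoly_cellpoly (b : R) (T : V -> R[i]) : 0 < b -> b <= 1 ->
  trigpoly (b *: A) T ->
  exists c, (forall k, ~ freqs (b *: A) k -> c k = 0) /\ T = cellpoly c.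
Proof.
move=> b0 b1 [c ->]; pose S := freqs (b *: A).
exists (fun k => if pselect (S k) then c k else 0); split.
  by move=> k Sk; case: pselect.
apply/funext => x; rewrite /cellpoly fsbig_finite; last exact: finite_freqs.
have finS : finite_set S by exact: finite_freqs.
transitivity (\sum_(k <- D | k \in S) c k * cexp k x).
  rewrite -[RHS]big_filter; apply: perm_big; apply: uniq_perm.
  - exact: finmap.fset_uniq.
  - by apply: filter_uniq; exact: uniq_cell.
  - move=> k; rewrite mem_filter in_fset_set// andb_idr// inE => Sk.
    apply/(mem_cell a_neq0); rewrite -[A]scale1r.
    exact: freqs_scale_sub Sk.
rewrite big_mkcond; apply: eq_bigr => k _.
case: pselect => [Sk|nSk]; first by rewrite mem_set.
by rewrite memNset// mul0r.
Qed.

Lemma cellpoly_in_B c : in_B (cellpoly c).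
Proof.
split.
- by move=> k x; apply: eq_bigr => l _; rewrite cexp_periodic.
- apply: cmeasurable_sum => k; apply: cmeasurableM; [exact: cmeasurable_cst|exact: cmeasurable_cexp].
- exists (\sum_(k <- D) normc (c k)) => x; apply: (le_trans (normc_sum _ _)).
  by apply: ler_sum => k _; rewrite Normc.normcM normc_cexp mulr1.
Qed.

Lemma cellpoly_integrable c : cintegrable (cellpoly c).
Proof. by apply: in_B_bounded_integrable; exact: cellpoly_in_B. Qed.

Lemma fourierE (f : V -> R[i]) k : fourier f k = cintegral (fun x => f x * cexp (- k) x).
Proof. by []. Qed.

Lemma fourier_cellpoly c l : fourier (cellpoly c) l = if l \in D then c l else 0.
Proof.
have -> : fourier (cellpoly c) l = \sum_(k <- D) c k * (k == l)%:R.
  rewrite fourierE.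
  have -> : (fun x => cellpoly c x * cexp (- l) x) = fun x => \sum_(k <- D) c k * cexp (k - l) x.
    by apply/funext => x; rewrite mulr_suml; apply: eq_bigr => k _; rewrite cexpDl mulrA.
  rewrite cintegral_sum => [|k]; last by apply: cintegrableZ; exact: cintegrable_cexp.
  apply: eq_bigr => k _; rewrite cintegralZ; last exact: cintegrable_cexp.
  by rewrite cintegral_cexp subr_eq0.
case: ifPn => lD.
  rewrite (bigD1_seq l)//=; last exact: uniq_cell.
  by rewrite eqxx mulr1 big1 ?addr0// => k kl; rewrite (negbTE kl) mulr0.
rewrite big_seq_cond big1// => k /andP[kD _].
by case: eqP => [e|_]; [rewrite e (negbTE lD) in kD|rewrite mulr0].
Qed.

Lemma fourier_integrable (f : V -> R[i]) k : cintegrable f ->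
  cintegrable (fun x => f x * cexp (- k) x).
Proof.
move=> [mf foo]; split; first by apply: cmeasurableM => //; exact: cmeasurable_cexp.
by under eq_integral do rewrite Normc.normcM normc_cexp mulr1.
Qed.

Lemma fourierD (f g : V -> R[i]) k : cintegrable f -> cintegrable g ->
  fourier (fun x => f x + g x) k = fourier f k + fourier g k.
Proof.
move=> fi gi; rewrite !fourierE -cintegralD; [|exact: fourier_integrable..].
by congr cintegral; apply/funext => x; rewrite mulrDl.
Qed.

Lemma fourierB (f g : V -> R[i]) k : cintegrable f -> cintegrable g ->
  fourier (fun x => f x - g x) k = fourier f k - fourier g k.
Proof.
move=> fi gi; rewrite fourierD//; last first.
  have -> : (fun x => - g x) = (fun x => -1 * g x) by apply/funext => x; rewrite mulN1r.
  exact: cintegrableZ.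
congr (_ + _); rewrite -mulN1r !fourierE -cintegralZ; last exact: fourier_integrable.
by congr cintegral; apply/funext => x; rewrite mulN1r mulNr.
Qed.

Lemma convolution_cellpoly c (f : V -> R[i]) : cintegrable f ->
  convolution (cellpoly c) f = cellpoly (fun k => c k * fourier f k).
Proof.
move=> fi; apply/funext => x; rewrite /convolution.
have -> : (fun y => cellpoly c (x - y) * f y) =
    fun y => \sum_(k <- D) c k * cexp k x * (f y * cexp (- k) y).
  apply/funext => y; rewrite mulr_suml; apply: eq_bigr => k _.
  by rewrite cexpD cexpN !mulrA -!mulrA; congr (_ * (_ * _)); rewrite mulrC.
rewrite cintegral_sum => [|k]; last by apply: cintegrableZ; exact: fourier_integrable.
apply: eq_bigr => k _; rewrite cintegralZ; last exact: fourier_integrable.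
by rewrite -fourierE mulrAC.
Qed.

Lemma vp_reproduces_cellpoly c x :
  cellpoly c x = cintegral (fun y => vp (x - y) * cellpoly c y).
Proof.
rewrite vp_reproduces//; last first.
- by move=> l lD; rewrite fourier_cellpoly (negbTE lD).
- exact: cellpoly_integrable.
by apply: eq_big_seq => l lD; rewrite fourier_cellpoly lD.
Qed.

Lemma cmeasurable_vp_shift x : cmeasurable (fun y => vp (x - y)).
Proof.
apply: (cmeasurable_comp _ (@cmeasurable_vp_kernel R d a)).
exact: (measurableT_comp (measurable_addl x) (@measurable_oppv R d)).
Qed.

Lemma vp_shift_integrable (v : V -> R[i]) x : cintegrable v ->
  cintegrable (fun y => vp (x - y) * v y).
Proof.
apply: (@cintegrableM_bounded _ _ (C3 * (N%:R^-1 * N%:R ^+ 2))).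
  exact: cmeasurable_vp_shift.
move=> y; apply: le_trans (normc_vp_kernel a_neq0 _) _.
apply: ler_wpM2l; first exact: vp_const_ge0.
apply: ler_wpM2l; first by rewrite invr_ge0.
rewrite ler_sqr ?nnegrE ?normc_ge0//; apply: (le_trans (normc_sum _ _)).
under eq_bigr do rewrite normc_cexp.
by rewrite big_const_seq count_predT iter_addr addr0.
Qed.

(** The Marcinkiewicz-Zygmund inequality. The condition on the points [P k] holds for
   the nodes and for their opposites; together with the integral of the Fejer kernel it
   provides the two bounds of Schur's test. *)
Lemma vp_sampling p (v : V -> R[i]) (P : lattice d -> V) : (1 <= p)%E ->
  (forall y, N%:R^-1 * \sum_(k <- D) fejer a (P k - y) = 1) -> cintegrable v ->
  (Lnorm nu p (fun k => (normc (cintegral (fun y => vp (P k - y) * v y)))%:E)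
    <= C3%:E * Lpnorm p v)%E.
Proof.
move=> p1 PP vi.
apply: (@schur_test _ _ _ mu d D (fun k y => C3 * fejer a (P k - y)) C3 p
  (fun k => normc (cintegral (fun y => vp (P k - y) * v y))) (fun y => normc (v y))) => //.
- exact: cell_neq_nil.
- move=> k; apply: measurable_funM; first exact: measurable_cst.
  apply: (measurableT_comp (@measurable_fejer R d a)).
  exact: (measurableT_comp (measurable_addl (P k)) (@measurable_oppv R d)).
- by move=> k y; rewrite mulr_ge0 ?vp_const_ge0 ?fejer_ge0.
- by apply: measurable_normc; case: vi.
- move=> k; under eq_integral do rewrite EFinM.
  rewrite ge0_integralZl//; last 3 first.
  - apply/measurable_EFinP; apply: (measurableT_comp (@measurable_fejer R d a)).
    exact: (measurableT_comp (measurable_addl (P k)) (@measurable_oppv R d)).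
  - by move=> y _; rewrite lee_fin fejer_ge0.
  - by rewrite lee_fin vp_const_ge0.
  by rewrite integral_fejer// mule1.
- by move=> y; rewrite -mulr_sumr mulrCA PP mulr1.
- move=> k; rewrite ger0_norm ?normc_ge0//.
  have int := vp_shift_integrable (P k) vi.
  apply: (le_trans (normc_cintegral_le int)); apply: ge0_le_integral => //.
  - by move=> y _; rewrite lee_fin normc_ge0.
  - by apply/measurable_EFinP; apply: measurable_normc; case: int.
  - apply/measurable_EFinP; apply: measurable_funM; last first.
      by apply: measurableT_comp => //; apply: measurable_normc; case: vi.
    apply: measurable_funM; first exact: measurable_cst.
    apply: (measurableT_comp (@measurable_fejer R d a)).
    exact: (measurableT_comp (measurable_addl (P k)) (@measurable_oppv R d)).
  - move=> y _; rewrite lee_fin Normc.normcM (ger0_norm (normc_ge0 (v y))).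
    by rewrite ler_wpM2r ?normc_ge0// normc_vp_kernel.
Qed.

Lemma cellpoly_sampling p c : (1 <= p)%E ->
  (Lnorm nu p (fun k => (normc (cellpoly c (pt k)))%:E) <= C3%:E * Lpnorm p (cellpoly c))%E.
Proof.
move=> p1; under eq_fun do rewrite vp_reproduces_cellpoly.
apply: vp_sampling => //; last exact: cellpoly_integrable.
exact: mean_fejerC.
Qed.

Section multiplier_norm.
Variable c : 'cV[int]_d -> R[i].
Let phi := cellpoly c.

(** A crude bound by the sup norm of [phi], which shows that the multiplier norm is
   finite. *)
Lemma convolution_crude q (b : R) (f : V -> R[i]) : (1 <= q)%E ->
  (forall x, normc (phi x) <= b) -> in_Lp q f ->
  (Lpnorm q (convolution phi f) <= b%:E * Lpnorm q f)%E.
Proof.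
move=> q1 phib [pf mf foo].
have b0 : 0 <= b := le_trans (normc_ge0 _) (phib 0).
have fi := Lpnorm_integrable q1 mf foo.
have [_ mphi _] := cellpoly_in_B c.
have [_ mconv _] := cellpoly_in_B (fun k => c k * fourier f k).
have [I IE] : exists I : R, (\int[mu]_x (normc (f x))%:E)%E = I%:E.
  exists (fine (\int[mu]_x (normc (f x))%:E)); rewrite fineK// ge0_fin_numE; first by case: fi.
  by apply: integral_ge0 => x _; rewrite lee_fin normc_ge0.
have I0 : 0 <= I.
  by rewrite -lee_fin -IE; apply: integral_ge0 => x _; rewrite lee_fin normc_ge0.
apply: (@le_trans _ _ (b * I)%:E); last first.
  by rewrite EFinM; apply: lee_wpmul2l; [rewrite lee_fin|rewrite -IE; exact: Lpnorm_le_integral].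
apply: Lpnorm_le_bound => //; [exact: mulr_ge0|by rewrite convolution_cellpoly|].
move=> x; rewrite -lee_fin /convolution.
have mphix : cmeasurable (fun y => phi (x - y)).
  apply: (cmeasurable_comp _ mphi).
  exact: (measurableT_comp (measurable_addl x) (@measurable_oppv R d)).
have int := cintegrableM_bounded mphix (fun y => phib (x - y)) fi.
apply: (le_trans (normc_cintegral_le int)).
rewrite EFinM -IE -ge0_integralZl//; last 2 first.
- by apply/measurable_EFinP; exact: measurable_normc.
- by move=> y _; rewrite lee_fin normc_ge0.
apply: ge0_le_integral => //.
- by move=> y _; rewrite lee_fin normc_ge0.
- by apply/measurable_EFinP; apply: measurable_normc; case: int.
- by apply: emeasurable_funM => //; apply/measurable_EFinP; exact: measurable_normc.
- by move=> y _; rewrite -EFinM lee_fin Normc.normcM ler_wpM2r ?normc_ge0.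
Qed.

Lemma conv_norm_lty q : (1 <= q)%E -> (conv_norm phi q < +oo)%E.
Proof.
move=> q1; have [_ _ [b phib]] := cellpoly_in_B c.
have b0 : 0 <= b := le_trans (normc_ge0 _) (phib 0).
apply: (@le_lt_trans _ _ b%:E); last exact: ltry.
apply: ge_ereal_sup => _ [f [Lf f1] <-].
apply: (le_trans (convolution_crude q1 phib Lf)).
by rewrite -[leRHS]mule1; apply: lee_wpmul2l => //; rewrite lee_fin.
Qed.

Lemma conv_norm_le q (f : V -> R[i]) : (1 <= q)%E -> in_Lp q f ->
  (Lpnorm q (convolution phi f) <= conv_norm phi q * Lpnorm q f)%E.
Proof.
move=> q1 Lf; have [pf mf foo] := Lf.
have [_ _ [b phib]] := cellpoly_in_B c.
have [f0|f0] := eqVneq (Lpnorm q f) 0%E.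
  by apply: le_trans (convolution_crude q1 phib Lf) _; rewrite f0 !mule0.
have : Lpnorm q f \is a fin_num by rewrite ge0_fin_numE// Lpnorm_ge0.
case fE : (Lpnorm q f) => [r| |]// _.
have r0 : 0 < r.
  by rewrite lt0r -lee_fin -fE Lpnorm_ge0 andbT; apply: contra_neq f0 => r0; rewrite fE r0.
have fi := Lpnorm_integrable q1 mf foo.
pose g x := (r^-1)%:C * f x.
have gE : Lpnorm q g = 1%E.
  by rewrite LpnormZ// fE normcR ger0_norm ?invr_ge0 ?ltW// -EFinM mulVf// gt_eqF.
have Lg : in_Lp q g.
  split; first by move=> k x; rewrite /g pf.
    by apply: cmeasurableM => //; exact: cmeasurable_cst.
  by rewrite gE ltry.
have gi : cintegrable g by exact: cintegrableZ.
have -> : convolution phi f = fun x => r%:C * convolution phi g x.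
  rewrite !convolution_cellpoly//; apply/funext => x.
  rewrite mulr_sumr; apply: eq_bigr => k _.
  have -> : fourier g k = (r^-1)%:C * fourier f k.
    rewrite !fourierE -cintegralZ; last exact: fourier_integrable.
    by congr cintegral; apply/funext => y; rewrite mulrA.
  have rr : r%:C * (r^-1)%:C = 1 by rewrite -rmorphM /= divff ?gt_eqF// rmorph1.
  by rewrite -[LHS]mul1r -rr; ring.
rewrite LpnormZ//; last by rewrite convolution_cellpoly//; have [] := cellpoly_in_B (fun k => c k * fourier g k).
rewrite normcR ger0_norm ?(ltW r0)// muleC; apply: lee_wpmul2r; first by rewrite lee_fin ltW.
by apply: ereal_sup_ubound; exists g => //; split => //; rewrite gE.
Qed.

(** A multiplier maps the constant [1] to its value at frequency [0]. *)
Lemma conv_norm_gt0 q : (1 <= q)%E -> c 0 != 0 -> 0 \in D -> (0 < conv_norm phi q)%E.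
Proof.
move=> q1 c0 D0.
have m1 : cmeasurable (fun _ : V => 1 : R[i]) by exact: cmeasurable_cst.
have L1 : in_Lp q (fun _ : V => 1 : R[i]).
  split => //; apply: (@le_lt_trans _ _ 1%E); last exact: ltry.
  by apply: Lpnorm_le_bound => // x; rewrite Normc.normc1.
have i1 : cintegrable (fun _ : V => 1 : R[i]).
  by apply: (@bounded_cintegrable _ _ _ 1) => // x; rewrite Normc.normc1.
have e1 : (fun _ : V => 1 : R[i]) = @cexp R d 0 by apply/funext => x; rewrite cexp0l.
have conv1 : convolution phi (fun=> 1) = fun=> c 0.
  rewrite convolution_cellpoly//; apply/funext => x; rewrite /cellpoly.
  have f1 k : fourier (fun _ : V => 1 : R[i]) k = (k == 0)%:R.
    rewrite fourierE; have -> : (fun x : V => 1 * cexp (- k) x) = @cexp R d (- k).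
      by apply/funext => y; rewrite mul1r.
    by rewrite cintegral_cexp oppr_eq0.
  rewrite (bigD1_seq 0)//=; last exact: uniq_cell.
  rewrite f1 eqxx mulr1 cexp0l mulr1 big1 ?addr0// => k k0.
  by rewrite f1 (negbTE k0) mulr0 mul0r.
apply: (@lt_le_trans _ _ (Lpnorm q (convolution phi (fun=> 1)))); last first.
  apply: ereal_sup_ubound; exists (fun=> 1) => //; split => //.
  by apply: Lpnorm_le_bound => // x; rewrite Normc.normc1.
rewrite conv1; apply: (@lt_le_trans _ _ (\int[mu]_(x in setT) (normc (c 0))%:E)%E); last first.
  by apply: Lpnorm_le_integral => //; exact: cmeasurable_cst.
rewrite integral_cst//= probability_setT mule1 lte_fin lt0r normc_ge0 andbT.
by apply: contra_neq c0; exact: Normc.eq0_normc.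
Qed.

Lemma conv_norm_ge0 q : (1 <= q)%E -> (0 <= conv_norm phi q)%E.
Proof.
move=> q1; apply: (@le_trans _ _ (Lpnorm q (convolution phi (fun=> 0%R)))); first exact: Lpnorm_ge0.
have m0 : cmeasurable (fun _ : V => 0 : R[i]) by exact: cmeasurable_cst.
have n0 : (Lpnorm q (fun _ : V => 0%R : R[i]) <= 0)%E.
  by apply: Lpnorm_le_bound => // x; rewrite Normc.normc0.
apply: ereal_sup_ubound; exists (fun=> 0) => //; split; last exact: le_trans n0 _.
by split => //; apply: le_lt_trans n0 _; exact: ltry.
Qed.

End multiplier_norm.

Definition synthesis c (w : lattice d -> R[i]) x : R[i] :=
  (N%:R^-1)%:C * \sum_(k <- D) w k * cellpoly c (x - pt k).

Definition node_pairing (w beta : lattice d -> R[i]) : R[i] :=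
  (N%:R^-1)%:C * \sum_(k <- D) w k * beta k.

(** Synthesis from samples. By duality it suffices to pair with [g] in L_q;
   the pairing only sees the samples at the nodes [- pt k] of the convolution of
   [phi] with the reflection of [g], which [vp_sampling] controls. *)
Lemma synthesis_bound p q c (w : lattice d -> R[i]) (W : \bar R) :
  (1 <= p)%E -> (1 <= q)%E -> (p^-1 + q^-1 = 1)%E -> (0 <= W)%E ->
  (forall beta : lattice d -> R[i],
    ((normc (node_pairing w beta))%:E <=
      W * Lnorm nu q (fun k => (normc (beta k))%:E))%E) ->
  (Lpnorm p (synthesis c w) <= C3%:E * conv_norm (cellpoly c) q * W)%E.
Proof.
move=> p1 q1 pq W0 wW.
set F := synthesis c w; set phi := cellpoly c.
have [pphi mphi [b phib]] := cellpoly_in_B c.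
have K0 := conv_norm_ge0 c q1.
have mshift k : cmeasurable (fun x => phi (x - pt k)).
  apply: (cmeasurable_comp (tau := fun x => x - pt k) _ mphi).
  under eq_fun do rewrite addrC; exact: measurable_addl.
have mF : cmeasurable F.
  apply: cmeasurableM; first exact: cmeasurable_cst.
  by apply: cmeasurable_sum => k; apply: cmeasurableM => //; exact: cmeasurable_cst.
apply: (@Lpnorm_dual_le _ _ p q F ((N%:R^-1) * \sum_(k <- D) (normc (w k) * b))) => //.
- by move=> k x; congr (_ * _); apply: eq_bigr => l _; rewrite addrAC pphi.
- move=> x; rewrite Normc.normcM normcR ger0_norm ?invr_ge0//; apply: ler_wpM2l.
    by rewrite invr_ge0.
  apply: (le_trans (normc_sum _ _)); apply: ler_sum => k _.
  by rewrite Normc.normcM ler_wpM2l ?normc_ge0.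
- by rewrite !mule_ge0// lee_fin vp_const_ge0.
move=> g Bg; have [pg mg [bg gb]] := Bg; have gi := in_B_bounded_integrable Bg.
pose beta k := cintegral (fun x => phi (x - pt k) * g x).
have ti k : cintegrable (fun x => phi (x - pt k) * g x).
  by apply: cintegrableM_bounded gi => // x; exact: phib.
have -> : cintegral (fun x => F x * g x) = (N%:R^-1)%:C * \sum_(k <- D) w k * beta k.
  have -> : (fun x => F x * g x) = fun x => (N%:R^-1)%:C * \sum_(k <- D) w k * (phi (x - pt k) * g x).
    apply/funext => x; rewrite /F /synthesis -mulrA; congr (_ * _); rewrite mulr_suml.
    by apply: eq_bigr => k _; rewrite mulrA.
  rewrite cintegralZ; last by apply: cintegrable_sum => k; exact: cintegrableZ.
  congr (_ * _); rewrite cintegral_sum => [|k]; last exact: cintegrableZ.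
  by apply: eq_bigr => k _; rewrite cintegralZ.
apply: (le_trans (wW beta)); rewrite -muleA [in leRHS]muleCA.
apply: lee_wpmul2l => //; rewrite -muleA.
pose h x := g (- x).
have mh : cmeasurable h by apply: (cmeasurable_comp _ mg); exact: measurable_oppv.
have ph : zperiodic h.
  by move=> k x; rewrite /h opprD -[LHS](pg k) subrK.
have Lh : in_Lp q h.
  split => //; apply: (@le_lt_trans _ _ bg%:E); last exact: ltry.
  apply: Lpnorm_le_bound => //; first by apply: le_trans (gb 0); exact: normc_ge0.
  by move=> x; exact: gb.
have hg : Lpnorm q h = Lpnorm q g.
  rewrite -(Lpnorm_reflect 0 q1 mg pg); congr Lpnorm.
  by apply/funext => x; rewrite sub0r.
have hi : cintegrable h by apply: (bounded_cintegrable mh) => x; exact: gb.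
have betaE k : beta k = convolution phi h (- pt k).
  rewrite /convolution -(@cintegral_reflect _ _ 0 (fun y => phi (- pt k - y) * h y)).
  - by congr cintegral; apply/funext => x; rewrite /h sub0r !opprK [x - _]addrC.
  - apply: cmeasurableM => //; apply: (cmeasurable_comp _ mphi).
    exact: (measurableT_comp (measurable_addl _) (@measurable_oppv R d)).
  - move=> n x; rewrite ph; congr (_ * _).
    by rewrite opprD addrA -[LHS](pphi n) subrK.
set c' := fun k => c k * fourier h k.
have convE : convolution phi h = cellpoly c' by exact: convolution_cellpoly.
apply: (@le_trans _ _ (C3%:E * Lpnorm q (convolution phi h))%E); last first.
  rewrite -hg; apply: lee_wpmul2l; first by rewrite lee_fin vp_const_ge0.
  exact: conv_norm_le.
rewrite (_ : (fun k => (normc (beta k))%:E) = fun k =>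
    (normc (cintegral (fun y => vp (- pt k - y) * convolution phi h y)))%:E); last first.
  by apply/funext => k; rewrite betaE convE -vp_reproduces_cellpoly.
apply: (vp_sampling (P := fun k => - pt k)) => //.
- move=> y; rewrite -[RHS](mean_fejer a_neq0 (- y)); congr (_ * _).
  by apply: eq_bigr => k _; rewrite addrC.
- by rewrite convE; exact: cellpoly_integrable.
Qed.

End sampling.

(** * Reproduction of polynomials and one-sided approximation *)

Section sampling_operator.
Context {R : realType} {d : nat}.
Variable a : 'I_d -> int.
Hypothesis a_neq0 : forall i, a i != 0.
Local Notation V := 'cV[R]_d.
Local Notation mu := (@torus_measure R d).
Local Notation D := (@cell R d a).
Local Notation N := (size D).
Local Notation pt := (@cell_point R d a).
Local Notation vp := (@vp_kernel R d a).
Local Notation C3 := (@vp_const R d).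
Local Notation nu := (@mean_measure R d D).
Local Notation poly := (cellpoly a).
Local Notation synth := (synthesis a).
Implicit Types (k l n t : 'cV[int]_d) (x y : V) (c b : 'cV[int]_d -> R[i]).

Lemma synthesisB c (w1 w2 : lattice d -> R[i]) x :
  synth c (fun k => w1 k - w2 k) x = synth c w1 x - synth c w2 x.
Proof.
rewrite /synthesis -mulrBr; congr (_ * _); rewrite -sumrB.
by apply: eq_bigr => k _; rewrite mulrBl.
Qed.

Lemma cellpolyB c b x : poly (fun k => c k - b k) x = poly c x - poly b x.
Proof. by rewrite /cellpoly -sumrB; apply: eq_bigr => k _; rewrite mulrBl. Qed.

(** The sums of [cexp (l - t)] over the nodes vanish for distinct [l] and [t] in the
   cell, so sampling followed by synthesis multiplies the coefficient of frequency
   [l] by [c l * e l]. *)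
Lemma synthesis_exact c b (e : 'cV[int]_d -> R[i]) :
  (forall l, l \in D -> b l != 0 -> c l * e l = 1) ->
  synth c (fun k => poly (fun l => e l * b l) (pt k)) = poly b.
Proof.
move=> ce; apply/funext => x; rewrite /synthesis.
have termE k : poly (fun l => e l * b l) (pt k) * poly c (x - pt k) =
    \sum_(l <- D) \sum_(t <- D) e l * b l * (c t * cexp t x) * cexp (l - t) (pt k).
  rewrite /cellpoly mulr_suml; apply: eq_bigr => l _.
  rewrite mulr_sumr; apply: eq_bigr => t _.
  by rewrite cexpD cexpN cexpDl; ring.
under eq_bigr do rewrite termE.
rewrite exchange_big /= mulr_sumr; apply: eq_big_seq => l lD.
rewrite exchange_big /=; under eq_bigr do rewrite -mulr_sumr.
rewrite (bigD1_seq l)//=; last exact: uniq_cell.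
rewrite sum_cexp_cell_ortho// eqxx big_seq_cond big1 ?addr0; last first.
  by move=> t /andP[tD tl]; rewrite sum_cexp_cell_ortho// eq_sym (negbTE tl) mulr0.
have NN : (N%:R^-1)%:C * N%:R = 1 :> R[i].
  rewrite -(rmorph_nat (real_complex R)) -rmorphM /= mulVf ?rmorph1//.
  by rewrite gt_eqF// N_gt0.
rewrite mulrCA NN mulr1.
have [->|b0] := eqVneq (b l) 0; first by rewrite mulr0 !mul0r.
by rewrite -[RHS]mul1r -(ce l lD b0); ring.
Qed.

Lemma normc_node_pairing_le (w beta : lattice d -> R[i]) :
  normc (node_pairing a w beta) <= N%:R^-1 * \sum_(k <- D) normc (w k) * normc (beta k).
Proof.
rewrite /node_pairing Normc.normcM normcR ger0_norm ?invr_ge0//.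
apply: ler_wpM2l; first by rewrite invr_ge0.
by apply: (le_trans (normc_sum _ _)); under eq_bigr do rewrite Normc.normcM.
Qed.

Lemma normc_pairing_hoelder p q (w beta : lattice d -> R[i]) :
  (1 <= p)%E -> (1 <= q)%E -> (p^-1 + q^-1 = 1)%E ->
  ((N%:R^-1 * \sum_(k <- D) normc (w k) * normc (beta k))%R%:E <=
    Lnorm nu p (fun k => (normc (w k))%:E) * Lnorm nu q (fun k => (normc (beta k))%:E))%E.
Proof.
move=> p1 q1 pq.
have := @hoelder_extended _ _ _ nu p q (fun k => normc (w k)) (fun k => normc (beta k)) p1 q1 pq.
move=> /(_ (measurable_lattice _) (measurable_lattice _)); apply: le_trans.
rewrite ge0_integral_mean_measure; last by move=> k; rewrite lee_fin.
rewrite sumEFin -EFinM lee_fin; apply: ler_wpM2l; first by rewrite invr_ge0.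
by apply: ler_sum => k _; rewrite ger0_norm// mulr_ge0 ?normc_ge0.
Qed.

Lemma synthesis_le_samples p q c (w : lattice d -> R[i]) :
  (1 <= p)%E -> (1 <= q)%E -> (p^-1 + q^-1 = 1)%E ->
  (Lpnorm p (synth c w) <=
    C3%:E * conv_norm (poly c) q * Lnorm nu p (fun k => (normc (w k))%:E))%E.
Proof.
move=> p1 q1 pq; apply: synthesis_bound => //; first exact: Lnorm_ge0.
move=> beta.
apply: le_trans (normc_pairing_hoelder w beta p1 q1 pq).
by rewrite lee_fin; exact: normc_node_pairing_le.
Qed.

(** The samples of [g] are compared with those of the polynomial [poly b] through
   a minorant [t] of [g]: the polynomial [poly b - t] is reproduced by convolution
   of [g - t - u] with the kernel, while [g - t] is dominated on the nodes by
   the polynomial [t' - t]. *)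
Lemma onesided_samples p b (g u : V -> R[i]) c c' : (1 <= p)%E ->
  in_B g -> in_B u ->
  (forall l, fourier g l = fourier (poly b) l + fourier u l) ->
  (forall x, [/\ poly c x \is Num.real, poly c x <= g x & g x <= poly c' x]) ->
  (Lnorm nu p (fun k => (normc (poly b (pt k) - g (pt k)))%:E) <=
    C3%:E * (Lpnorm p (poly c \- poly c') + Lpnorm p (poly c \- poly c') + Lpnorm p u))%E.
Proof.
move=> p1 Bg Bu gu cgc'.
have [_ mg _] := Bg; have [_ mu_ _] := Bu.
have gi := in_B_bounded_integrable Bg; have ui := in_B_bounded_integrable Bu.
have [_ mc _] := cellpoly_in_B a c; have ci := @cellpoly_integrable _ _ a c.
have [_ mc' _] := cellpoly_in_B a c'.
have gti : cintegrable (fun x => g x - poly c x).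
  have -> : (fun x => g x - poly c x) = (fun x => g x + -1 * poly c x).
    by apply/funext => x; rewrite mulN1r.
  by apply: cintegrableD => //; exact: cintegrableZ.
have mcc' : cmeasurable (poly c \- poly c') by exact: cmeasurableB.
have dom x : normc (g x - poly c x) <= normc ((poly c \- poly c') x).
  have [cr cg gc'] := cgc' x.
  have -> : normc ((poly c \- poly c') x) = normc (poly c' x - poly c x).
    by rewrite -normcN opprB.
  have h1 : 0 <= g x - poly c x by rewrite subr_ge0.
  have h2 : g x - poly c x <= poly c' x - poly c x by rewrite lerD2r.
  have h3 := le_trans h1 h2.
  have nE (z : R[i]) : 0 <= z -> (normc z)%:C = z by move=> z0; rewrite -[RHS](ger0_norm z0).
  by rewrite -lecR (nE _ h1) (nE _ h3).
pose v x := (g x - poly c x) - u x.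
have vi : cintegrable v.
  have -> : v = (fun x => (g x - poly c x) + -1 * u x).
    by apply/funext => x; rewrite /v mulN1r.
  by apply: cintegrableD => //; exact: cintegrableZ.
have vf l : fourier v l = fourier (poly (fun l => b l - c l)) l.
  rewrite /v fourierB// fourierB// gu addrAC.
  have -> : fourier (poly b) l + fourier u l - fourier u l = fourier (poly b) l by rewrite addrK.
  by rewrite !fourier_cellpoly; case: ifP => _; rewrite ?subrr.
have vrep x : poly b x - poly c x = cintegral (fun y => vp (x - y) * v y).
  rewrite -cellpolyB vp_reproduces//.
    by apply: eq_big_seq => l lD; rewrite vf fourier_cellpoly lD.
  by move=> l lD; rewrite vf fourier_cellpoly (negbTE lD).
have vn : (Lpnorm p v <= Lpnorm p (poly c \- poly c') + Lpnorm p u)%E.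
  apply: (le_trans (LpnormB p1 _ mu_)); first exact: cmeasurableB.
  by apply: leeD2r; apply: le_Lpnorm => //; exact: cmeasurableB.
have ml (F : lattice d -> R) : measurable_fun setT F := measurable_lattice F.
apply: (@le_trans _ _ (Lnorm nu p (fun k => (normc (poly b (pt k) - poly c (pt k)) +
   normc ((poly c \- poly c') (pt k)))%:E))).
  apply: le_Lnorm => //; first exact: lt_le_trans p1.
  move=> k; rewrite !ger0_norm ?addr_ge0 ?normc_ge0//.
  have -> : poly b (pt k) - g (pt k) = (poly b (pt k) - poly c (pt k)) + - (g (pt k) - poly c (pt k)).
    by rewrite opprB addrA subrK.
  by apply: (le_trans (le_normcD _ _)); rewrite lerD2l normcN.
have := eminkowski nu (ml (fun k => normc (poly b (pt k) - poly c (pt k))))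
  (ml (fun k => normc ((poly c \- poly c') (pt k)))) p1.
move=> /le_trans; apply.
have C0 : (0 <= C3%:E)%E by rewrite lee_fin vp_const_ge0.
rewrite -addeA [X in (_ <= _ * X)%E]addeC muleDr//; last first.
  by apply: ge0_adde_def; rewrite inE ?adde_ge0// Lpnorm_ge0.
apply: leeD.
  under eq_fun do rewrite vrep.
  apply: le_trans (lee_wpmul2l C0 vn).
  by apply: vp_sampling => //; exact: mean_fejerC.
have -> : (poly c \- poly c') = poly (fun k => c k - c' k).
  by apply/funext => x /=; rewrite cellpolyB.
exact: cellpoly_sampling.
Qed.

End sampling_operator.

(** * Means over the nodes *)

Section convolution_samples.
Context {R : realType} {d : nat}.
Variable a : 'I_d -> int.
Hypothesis a_neq0 : forall i, a i != 0.
Local Notation V := 'cV[R]_d.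
Local Notation mu := (@torus_measure R d).
Local Notation D := (@cell R d a).
Local Notation N := (size D).
Local Notation pt := (@cell_point R d a).
Local Notation nu := (@mean_measure R d D).
Implicit Types (k l n t : 'cV[int]_d) (x y : V).

Definition mean_on_nodes (h : V -> R[i]) x : R :=
  N%:R^-1 * \sum_(k <- D) normc (h (x - pt k)).

Lemma mean_on_nodes_ge0 h x : 0 <= mean_on_nodes h x.
Proof. by rewrite mulr_ge0 ?invr_ge0// sumr_ge0// => k _; exact: normc_ge0. Qed.

Lemma cmeasurable_shift (h : V -> R[i]) x : cmeasurable h -> cmeasurable (fun y => h (y - x)).
Proof.
move=> mh; apply: (cmeasurable_comp (tau := fun y => y - x) _ mh).
under eq_fun do rewrite addrC; exact: measurable_addl.
Qed.

Lemma cmeasurable_reflect (h : V -> R[i]) x : cmeasurable h -> cmeasurable (fun y => h (x - y)).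
Proof.
move=> mh; apply: (cmeasurable_comp _ mh).
exact: (measurableT_comp (measurable_addl x) (@measurable_oppv R d)).
Qed.

Lemma measurable_mean_on_nodes h : cmeasurable h -> measurable_fun setT (mean_on_nodes h).
Proof.
move=> mh; apply: measurable_funM; first exact: measurable_cst.
by apply: measurable_sum => k; apply: measurable_normc; exact: cmeasurable_shift.
Qed.

Section periodic.
Variable h : V -> R[i].
Hypothesis ph : zperiodic h.

Lemma periodic_dilate x k n : h (x - pt (k + dilate a n)) = h (x - pt k).
Proof. by rewrite cell_pointD cell_point_dilate// opprD addrA -[LHS](ph n) subrK. Qed.

Lemma mean_on_nodes_shift x k : mean_on_nodes h (x - pt k) = mean_on_nodes h x.
Proof.
congr (_ * _).
rewrite -[RHS](@big_cellD R d a a_neq0 _ _ _ (fun l => normc (h (x - pt l))) k)/=.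
  by apply: eq_bigr => l _; rewrite cell_pointD opprD addrA addrAC.
by move=> l n; rewrite periodic_dilate.
Qed.

Lemma mean_on_nodes_reflect x : N%:R^-1 * \sum_(k <- D) normc (h (x + pt k)) = mean_on_nodes h x.
Proof.
congr (_ * _).
rewrite -[RHS](@big_cellN R d a a_neq0 _ _ _ (fun l => normc (h (x - pt l))))/=.
  by apply: eq_bigr => l _; rewrite cell_pointN opprK.
by move=> l n; rewrite periodic_dilate.
Qed.

Lemma mean_on_nodes_periodic n x : mean_on_nodes h (x + zvec n) = mean_on_nodes h x.
Proof. by congr (_ * _); apply: eq_bigr => l _; rewrite addrAC ph. Qed.

End periodic.

Lemma Lpnorm_sum_le q (s : seq 'cV[int]_d) (F : 'cV[int]_d -> V -> R[i]) : (1 <= q)%E ->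
  (forall k, cmeasurable (F k)) ->
  (Lpnorm q (fun x => (\sum_(k <- s) normc (F k x))%:C)%R <= \sum_(k <- s) Lpnorm q (F k))%E.
Proof.
move=> q1 mF; have mn (s' : seq 'cV[int]_d) :
    cmeasurable (fun x => (\sum_(k <- s') normc (F k x))%:C).
  by apply: cmeasurable_real; apply: measurable_sum => k; exact: measurable_normc.
elim: s => [|k s IH].
  rewrite big_nil; apply: (@Lpnorm_le_bound _ _ _ 0) => // x.
  by rewrite big_nil normcR normr0.
rewrite big_cons; under eq_fun do rewrite big_cons rmorphD /=.
apply: (le_trans (LpnormD q1 _ (mn s))).
  by apply: cmeasurable_real; exact: measurable_normc.
apply: leeD => //; apply: le_Lpnorm => //.
  by apply: cmeasurable_real; exact: measurable_normc.
by move=> x; rewrite normcR ger0_norm ?normc_ge0.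
Qed.

(** The mean over the nodes is an average of translates. *)
Lemma Lpnorm_mean_on_nodes_le q (h : V -> R[i]) : (1 <= q)%E ->
  zperiodic h -> cmeasurable h ->
  (Lpnorm q (fun x => (mean_on_nodes h x)%:C)%R <= Lpnorm q h)%E.
Proof.
move=> q1 ph mh.
have mS : cmeasurable (fun x => (\sum_(k <- D) normc (h (x - pt k)))%:C).
  apply: cmeasurable_real; apply: measurable_sum => k; apply: measurable_normc.
  exact: cmeasurable_shift.
under eq_fun do rewrite rmorphM /=.
rewrite LpnormZ// normcR ger0_norm ?invr_ge0//.
have n0 : (0 <= (N%:R^-1 : R)%:E)%E by rewrite lee_fin invr_ge0.
apply: le_trans (lee_wpmul2l n0 (@Lpnorm_sum_le q D (fun k x => h (x - pt k)) q1 _)) _.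
  by move=> k; exact: cmeasurable_shift.
have e k : Lpnorm q (fun x => h (x - pt k)) = Lpnorm q h.
  by rewrite -(Lpnorm_shift (- pt k) q1 mh ph); congr Lpnorm; apply/funext => x; rewrite addrC.
under eq_bigr do rewrite e.
have [hoo|] := eqVneq (Lpnorm q h) +oo%E; first by rewrite hoo leey.
rewrite -ltey -ge0_fin_numE ?Lpnorm_ge0// => /fineK <-.
rewrite sumEFin -EFinM lee_fin big_const_seq count_predT iter_addr addr0.
rewrite -[fine _ *+ _]mulr_natl mulrA mulVf ?mul1r//.
by rewrite gt_eqF// N_gt0.
Qed.

Lemma Lpnorm1_mean_on_nodes (h : V -> R[i]) : zperiodic h -> cmeasurable h ->
  (Lpnorm 1%E h <= Lpnorm 1%E (fun x => (mean_on_nodes h x)%:C)%R)%E.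
Proof.
move=> ph mh; have mh' := measurable_normc mh.
have mhk k : measurable_fun setT (fun x => (normc (h (x - pt k)))%:E).
  by apply/measurable_EFinP; apply: measurable_normc; exact: cmeasurable_shift.
rewrite !Lpnorm1E.
have -> : (\int[mu]_x (normc (mean_on_nodes h x)%:C)%:E)%E =
    ((N%:R^-1)%:E * \sum_(k <- D) \int[mu]_x (normc (h (x - pt k)))%:E)%E.
  rewrite -ge0_integral_sum//; last first.
    by move=> k x _; rewrite lee_fin normc_ge0.
  rewrite -ge0_integralZl//; last 2 first.
  - exact: emeasurable_sum.
  - by move=> x _; apply: sume_ge0 => k _; rewrite lee_fin normc_ge0.
  apply: eq_integral => x _.
  by rewrite normcR ger0_norm ?mean_on_nodes_ge0// sumEFin -EFinM.
have e k : (\int[mu]_x (normc (h (x - pt k)))%:E)%E = (\int[mu]_x (normc (h x))%:E)%E.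
  rewrite -!Lpnorm1E -(Lpnorm_shift (- pt k) (lexx _) mh ph).
  by congr Lpnorm; apply/funext => x; rewrite addrC.
under eq_bigr do rewrite e.
have I0 : (0 <= \int[mu]_x (normc (h x))%:E)%E.
  by apply: integral_ge0 => x _; rewrite lee_fin normc_ge0.
have n0 : (0 < (N%:R^-1 : R)%:E)%E by rewrite lte_fin invr_gt0 N_gt0.
case IE : (\int[mu]_x (normc (h x))%:E)%E I0 => [r| |]// _.
  rewrite sumEFin -EFinM lee_fin big_const_seq count_predT iter_addr addr0.
  rewrite -[r *+ _]mulr_natl mulrA mulVf ?mul1r//.
  by rewrite gt_eqF// N_gt0.
have : D != [::] by exact: cell_neq_nil.
case: (D) n0 => // k s n0 _.
by rewrite big_cons addye ?gt0_muley// -ltNye (lt_le_trans ltNy0)// sume_ge0.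
Qed.

End convolution_samples.

(** * Samples of a convolution *)

Section convolution_pairing.
Context {R : realType} {d : nat}.
Variable a : 'I_d -> int.
Hypothesis a_neq0 : forall i, a i != 0.
Local Notation V := 'cV[R]_d.
Local Notation mu := (@torus_measure R d).
Local Notation D := (@cell R d a).
Local Notation N := (size D).
Local Notation pt := (@cell_point R d a).
Local Notation nu := (@mean_measure R d D).
Local Notation mean := (mean_on_nodes a).
Implicit Types (k l n t : 'cV[int]_d) (x y : V).

Lemma convolution_integrable p q (h v : V -> R[i]) x :
  (1 <= p)%E -> (1 <= q)%E -> (p^-1 + q^-1 = 1)%E -> in_Lp q h -> in_Lp p v ->
  cintegrable (fun y => h (x - y) * v y).
Proof.
move=> p1 q1 pq [ph mh hoo] [pv mv voo].
have mhx := cmeasurable_reflect x mh.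
split; first exact: cmeasurableM.
have qp : (q^-1 + p^-1 = 1)%E by rewrite addeC.
apply: (le_lt_trans (hoelder_torus q1 p1 qp mhx mv)).
by rewrite Lpnorm_reflect// lte_mul_pinfty ?Lpnorm_ge0// ge0_fin_numE ?Lpnorm_ge0.
Qed.

Lemma normc_convolution_le p q (h v : V -> R[i]) x :
  (1 <= p)%E -> (1 <= q)%E -> (p^-1 + q^-1 = 1)%E -> in_Lp q h -> in_Lp p v ->
  ((normc (convolution h v x))%:E <= \int[mu]_y (normc (h (x - y)) * normc (v y))%:E)%E.
Proof.
move=> p1 q1 pq Lh Lv.
apply: le_trans (normc_cintegral_le (convolution_integrable x p1 q1 pq Lh Lv)) _.
by under eq_integral do rewrite Normc.normcM.
Qed.

(** All the translates of [v] have the same integral of the power [r]. *)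
Lemma Lpnorm_power_mean (r : R) (v : V -> R[i]) : 1 <= r ->
  zperiodic v -> cmeasurable v ->
  Lpnorm r%:E (fun y => ((N%:R^-1 * \sum_(l <- D) normc (v (pt l + y)) `^ r) `^ r^-1)%:C)%R =
  Lpnorm r%:E v.
Proof.
move=> r1 pv mv; have r0 : 0 < r := lt_le_trans ltr01 r1.
rewrite !LpnormE.
have powE (A B : \bar R) : A = B -> (A `^ r^-1 = B `^ r^-1)%E by move=> ->.
apply: powE.
have S0 y : 0 <= N%:R^-1 * \sum_(l <- D) normc (v (pt l + y)) `^ r.
  by rewrite mulr_ge0 ?invr_ge0// sumr_ge0// => l _; exact: powR_ge0.
under eq_integral => y _.
  rewrite normcR ger0_norm ?powR_ge0// -powRrM mulVf ?gt_eqF// powRr1//.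
  over.
have mvl l : measurable_fun setT (fun y => (normc (v (pt l + y)) `^ r)%:E).
  apply/measurable_EFinP; apply: measurable_fun_powR; apply: measurable_normc.
  by apply: cmeasurable_comp mv; exact: measurable_addl.
under eq_integral do rewrite EFinM -sumEFin.
rewrite ge0_integralZl//; last 2 first.
- exact: emeasurable_sum.
- by move=> y _; apply: sume_ge0 => l _; rewrite lee_fin powR_ge0.
rewrite ge0_integral_sum//; last by move=> l y _; rewrite lee_fin powR_ge0.
pose G x := (normc (v x) `^ r)%:E.
have mG : measurable_fun setT G.
  by apply/measurable_EFinP; apply: measurable_fun_powR; exact: measurable_normc.
have G0 x : (0 <= G x)%E by rewrite lee_fin powR_ge0.
have pG : operiodic G by move=> k x; rewrite /G pv.
have e l : (\int[mu]_y G (pt l + y)%R = \int[mu]_y G y)%E by exact: ge0_integral_torus_shift.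
under eq_bigr do rewrite -/(G _) e.
have I0 : (0 <= \int[mu]_y G y)%E by exact: integral_ge0.
by rewrite -ge0_integral_mean_measure// integral_cst//= mean_measureT ?mule1//; exact: cell_neq_nil.
Qed.

(** At a finite exponent [p], the integral defining each sample of the convolution is
   averaged over its translates by the nodes. For each point [y] of the torus there
   remains a discrete convolution of [beta] with samples of [h], bounded by
   [mean h (- y)] according to Schur's test, paired with samples of [v]. *)
Lemma node_pairing_convolution_le p q (h v : V -> R[i]) (beta : lattice d -> R[i]) :
  (1 <= p)%E -> (1 <= q)%E -> (p^-1 + q^-1 = 1)%E -> in_Lp q h -> in_Lp p v ->
  ((normc (node_pairing a (fun k => convolution h v (pt k)) beta))%:E <=
   Lpnorm q (fun x => (mean h x)%:C)%R * Lpnorm p v *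
   Lnorm nu q (fun k => (normc (beta k))%:E))%E.
Proof.
move=> p1 q1 pq Lh Lv; have [ph mh hoo] := Lh; have [pv mv voo] := Lv.
have mmean := measurable_mean_on_nodes a mh.
pose w k := convolution h v (pt k).
apply: (@le_trans _ _ (N%:R^-1 * \sum_(k <- D) normc (w k) * normc (beta k))%:E).
  by rewrite lee_fin; exact: normc_node_pairing_le.
have qp : (q^-1 + p^-1 = 1)%E by rewrite addeC.
move: p p1 pq qp voo Lv => [r| |//] p1 pq qp voo Lv; last first.
  have qE : q = 1%E by have [[//]|[]//|[? [? []]//]] := conj_exponentP p1 q1 pq.
  rewrite {q q1 qp pq}qE in Lh hoo *.
  (* At [p = +oo] the samples are bounded one by one. *)
  have r1 : (1 <= (1 : \bar R))%E by [].
  have qp1 : ((1 : \bar R)^-1 + (+oo)^-1 = 1)%E by rewrite inve1 invey adde0.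
  have pq1 : ((+oo : \bar R)^-1 + 1^-1 = 1)%E by rewrite addeC.
  have hv : (Lpnorm 1%E h * Lpnorm +oo%E v)%E \is a fin_num.
    by rewrite fin_numM// ge0_fin_numE ?Lpnorm_ge0.
  have wb k : normc (w k) <= fine (Lpnorm 1%E h * Lpnorm +oo%E v)%E.
    rewrite -lee_fin fineK//.
    apply: le_trans (normc_convolution_le (pt k) p1 r1 pq1 Lh Lv) _.
    rewrite -(Lpnorm_reflect (pt k) r1 mh ph).
    under eq_integral do rewrite -Normc.normcM.
    by apply: hoelder_torus => //; exact: cmeasurable_reflect.
  apply: (@le_trans _ _ (Lnorm nu +oo%E (fun k => (normc (w k))%:E) *
      Lnorm nu 1%E (fun k => (normc (beta k))%:E))%E).
    exact: normc_pairing_hoelder.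
  apply: lee_wpmul2r; first exact: Lnorm_ge0.
  apply: (@le_trans _ _ (Lpnorm 1%E h * Lpnorm +oo%E v)%E); last first.
    by apply: lee_wpmul2r; [exact: Lpnorm_ge0|exact: Lpnorm1_mean_on_nodes].
  rewrite -(fineK hv); apply: Lnorm_le_bound => //.
  - by rewrite mean_measureT//; exact: cell_neq_nil.
  - exact: le_trans (normc_ge0 _) (wb 0).
  - by move=> k; rewrite ger0_norm ?normc_ge0.
have r1 : 1 <= r by rewrite -lee_fin.
have r0 : 0 < r := lt_le_trans ltr01 r1.
pose nb := Lnorm nu q (fun k => (normc (beta k))%:E).
have nb0 : (0 <= nb)%E by exact: Lnorm_ge0.
pose Nv y := (N%:R^-1 * \sum_(l <- D) normc (v (pt l + y)) `^ r) `^ r^-1.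
have mhv k l : cmeasurable (fun y => h (pt k - pt l - y) * v (pt l + y)).
  apply: cmeasurableM; first exact: cmeasurable_reflect.
  by apply: cmeasurable_comp mv; exact: measurable_addl.
pose g k y := N%:R^-1 * \sum_(l <- D) normc (h (pt k - pt l - y) * v (pt l + y)).
have g0 k y : 0 <= g k y.
  by rewrite mulr_ge0 ?invr_ge0// sumr_ge0// => l _; exact: normc_ge0.
have mg k : measurable_fun setT (g k).
  apply: measurable_funM; first exact: measurable_cst.
  by apply: measurable_sum => l; exact: measurable_normc.
(* Averaging the integral over its translates by the nodes. *)
have wg k : ((normc (w k))%:E <= \int[mu]_y (g k y)%:E)%E.
  apply: le_trans (normc_convolution_le (pt k) p1 q1 pq Lh Lv) _.
  pose G y := (normc (h (pt k - y)) * normc (v y))%:E.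
  have mG : measurable_fun setT G.
    apply/measurable_EFinP; apply: measurable_funM; last exact: measurable_normc.
    by apply: measurable_normc; exact: cmeasurable_reflect.
  have G0 y : (0 <= G y)%E by rewrite lee_fin mulr_ge0 ?normc_ge0.
  have pG : operiodic G by move=> n y; rewrite /G pv opprD addrA -[in LHS](ph n) subrK.
  have e l : (\int[mu]_y G (pt l + y)%R = \int[mu]_y G y)%E by exact: ge0_integral_torus_shift.
  have I0 : (0 <= \int[mu]_y G y)%E by exact: integral_ge0.
  rewrite le_eqVlt; apply/orP; left; apply/eqP.
  transitivity ((N%:R^-1)%:E * \sum_(l <- D) \int[mu]_y G (pt l + y)%R)%E.
    under eq_bigr do rewrite e.
    by rewrite -ge0_integral_mean_measure// integral_cst//= mean_measureT ?mule1//; exact: cell_neq_nil.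
  have mGl l : measurable_fun setT (fun y => G (pt l + y)).
    by apply: (measurableT_comp mG); exact: measurable_addl.
  rewrite -ge0_integral_sum// -ge0_integralZl//; last 2 first.
  - exact: emeasurable_sum.
  - by move=> y _; exact: sume_ge0.
  apply: eq_integral => y _; rewrite sumEFin -EFinM; congr EFin; congr (_ * _).
  by apply: eq_bigr => l _; rewrite Normc.normcM opprD addrA.
have mgE k : measurable_fun setT (fun y => (g k y)%:E) by exact/measurable_EFinP.
have mNv : measurable_fun setT Nv.
  apply: measurable_fun_powR; apply: measurable_funM; first exact: measurable_cst.
  apply: measurable_sum => l; apply: measurable_fun_powR; apply: measurable_normc.
  by apply: cmeasurable_comp mv; exact: measurable_addl.
have m0 y : 0 <= mean h (0 - y) * Nv y by rewrite mulr_ge0 ?powR_ge0 ?mean_on_nodes_ge0.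
have mm0 : measurable_fun setT (fun y => mean h (0 - y)).
  apply: (measurableT_comp mmean).
  exact: (measurableT_comp (measurable_addl 0) (@measurable_oppv R d)).
(* For a fixed [y], a discrete convolution of [beta] with the samples of [h],
   paired with the samples of [v]. *)
have pointwise y : ((N%:R^-1 * \sum_(k <- D) g k y * normc (beta k))%:E <=
    nb * (mean h (0 - y) * Nv y)%:E)%E.
  pose B l := N%:R^-1 * \sum_(k <- D) normc (h (pt k - pt l - y)) * normc (beta k).
  have B0 l : 0 <= B l.
    rewrite mulr_ge0 ?invr_ge0// sumr_ge0// => k _.
    by rewrite mulr_ge0 ?normc_ge0.
  have -> : N%:R^-1 * \sum_(k <- D) g k y * normc (beta k) =
      N%:R^-1 * \sum_(l <- D) `|B l * normc (v (pt l + y))|.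
    congr (_ * _); under eq_bigr do rewrite /g -mulrA mulr_suml mulr_sumr.
    rewrite exchange_big /=; apply: eq_bigr => l _.
    rewrite ger0_norm; last by rewrite mulr_ge0 ?normc_ge0.
    rewrite -[RHS]mulrA mulr_suml mulr_sumr.
    by apply: eq_bigr => k _; rewrite Normc.normcM mulrAC.
  have Blt : (Lnorm nu q (EFin \o B) <= (mean h (0 - y))%:E * nb)%E.
    apply: (@schur_test _ _ _ nu d D (fun l k => normc (h (pt k - pt l - y)))
        (mean h (0 - y)) q B (fun k => normc (beta k))) => //.
    - exact: cell_neq_nil.
    - exact: mean_on_nodes_ge0.
    - by move=> l k; exact: normc_ge0.
    - move=> l; rewrite ge0_integral_mean_measure => [|k]; last by rewrite lee_fin normc_ge0.
      rewrite sumEFin -EFinM lee_fin -(mean_on_nodes_shift a_neq0 ph _ l).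
      rewrite -(mean_on_nodes_reflect a_neq0 ph).
      rewrite le_eqVlt; apply/orP; left; apply/eqP; congr (_ * _).
      by apply: eq_bigr => k _; congr (normc (h _)); rewrite sub0r [RHS]addrC addrA addrAC.
    - move=> k; rewrite -(mean_on_nodes_shift a_neq0 ph _ (- k)).
      rewrite le_eqVlt; apply/orP; left; apply/eqP; congr (_ * _).
      apply: eq_bigr => l _; congr (normc (h _)).
      by rewrite cell_pointN opprK sub0r addrAC [- y + _]addrC.
    - move=> l; rewrite ger0_norm// ge0_integral_mean_measure => [|k].
        rewrite sumEFin -EFinM lee_fin; apply: ler_wpM2l; first by rewrite invr_ge0.
        by apply: ler_sum => k _; rewrite [`|normc _|]ger0_norm ?normc_ge0.
      by rewrite lee_fin mulr_ge0 ?normc_ge0.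
  have -> : (nb * (mean h (0 - y) * Nv y)%:E = (mean h (0 - y))%:E * nb * (Nv y)%:E)%E.
    by rewrite EFinM muleA [(nb * _)%E]muleC.
  apply: le_trans (lee_wpmul2r _ Blt); last by rewrite lee_fin powR_ge0.
  have NvE : (Nv y)%:E = Lnorm nu r%:E (EFin \o (fun l => normc (v (pt l + y)))).
    rewrite unlock ge0_integral_mean_measure => [|l]; last exact: poweR_ge0.
    under eq_bigr => l _ do rewrite /= ger0_norm ?normc_ge0//.
    by rewrite sumEFin -EFinM poweR_EFin.
  rewrite NvE; apply: le_trans (hoelder_extended nu q1 p1 qp (measurable_lattice B) (measurable_lattice _)).
  rewrite ge0_integral_mean_measure => [|l]; last by rewrite lee_fin.
  by rewrite sumEFin -EFinM.
apply: (@le_trans _ _ (\int[mu]_y (N%:R^-1 * \sum_(k <- D) g k y * normc (beta k))%:E)%E).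
  have e : (\int[mu]_y (N%:R^-1 * \sum_(k <- D) g k y * normc (beta k))%:E =
    (N%:R^-1)%:E * \sum_(k <- D) (normc (beta k))%:E * \int[mu]_y (g k y)%:E)%E.
    under [in RHS]eq_bigr => k _.
      rewrite -ge0_integralZl//; last 2 first.
      - by move=> y _; rewrite lee_fin.
      - by rewrite lee_fin normc_ge0.
      over.
    have mgb k : measurable_fun setT (fun y => ((normc (beta k))%:E * (g k y)%:E)%E).
      by apply: emeasurable_funM.
    rewrite -ge0_integral_sum//; last first.
      by move=> k y _; rewrite -EFinM lee_fin mulr_ge0 ?normc_ge0.
    rewrite -ge0_integralZl//; last 2 first.
    - exact: emeasurable_sum.
    - by move=> y _; apply: sume_ge0 => k _; rewrite -EFinM lee_fin mulr_ge0 ?normc_ge0.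
    apply: eq_integral => y _; rewrite EFinM -sumEFin; congr (_ * _)%E.
    by apply: eq_bigr => k _; rewrite EFinM muleC.
  rewrite e EFinM -sumEFin; apply: lee_wpmul2l; first by rewrite lee_fin invr_ge0.
  apply: lee_sum => k _; rewrite EFinM muleC; apply: lee_wpmul2l => //.
  by rewrite lee_fin normc_ge0.
apply: (@le_trans _ _ (\int[mu]_y (nb * (mean h (0 - y)%R * Nv y)%R%:E))%E).
  apply: ge0_le_integral => //.
  - move=> y _; rewrite lee_fin mulr_ge0 ?invr_ge0// sumr_ge0// => k _.
    by rewrite mulr_ge0 ?normc_ge0.
  - apply/measurable_EFinP; apply: measurable_funM; first exact: measurable_cst.
    by apply: measurable_sum => k; apply: measurable_funM => //; exact: measurable_cst.
  - by apply: emeasurable_funM => //; apply/measurable_EFinP; exact: measurable_funM.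
rewrite ge0_integralZl//; last 2 first.
- by apply/measurable_EFinP; exact: measurable_funM.
- by move=> y _; rewrite lee_fin.
rewrite muleC; apply: lee_wpmul2r => //.
have mmC : cmeasurable (fun x => (mean h x)%:C) by exact: cmeasurable_real.
have pmC : zperiodic (fun x => (mean h x)%:C).
  by move=> n x; rewrite mean_on_nodes_periodic.
rewrite -(Lpnorm_reflect 0 q1 mmC pmC) -(Lpnorm_power_mean r1 pv mv).
apply: le_trans (hoelder_torus q1 p1 qp _ _); last 2 first.
- exact: (cmeasurable_reflect 0 mmC).
- exact: cmeasurable_real.
rewrite le_eqVlt; apply/orP; left; apply/eqP; apply: eq_integral => y _.
by rewrite Normc.normcM !normcR !ger0_norm ?powR_ge0 ?mean_on_nodes_ge0.
Qed.

End convolution_pairing.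

(** * Tiling of the torus by the nodes *)

Section cell_integral.
Context {R : realType} {d : nat}.
Local Notation V := 'cV[R]_d.
Local Notation mu := (@torus_measure R d).

Lemma measurable_coordwise n (B : 'I_n -> set (measurableTypeR R)) :
  (forall i, measurable (B i)) -> measurable [set x : 'cV[R]_n | forall i, B i (x i 0)].
Proof.
move=> mB.
rewrite (_ : [set _ | _] = \bigcap_(i in setT) ((fun x : 'cV[R]_n => x i 0) @^-1` B i)).
  apply: fin_bigcap_measurable => // i _.
  by rewrite -[X in measurable X]setTI; exact: (measurable_coord i measurableT (mB i)).
by apply/seteqP; split => [x xB i _|x xB i]; [exact: xB|exact: (xB i I)].
Qed.

Lemma measurable_cube n : measurable (@cube R n).
Proof.
apply: (@measurable_coordwise n (fun _ => `[- 2^-1, 2^-1[%classic)) => i.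
exact: measurable_itv.
Qed.
End cell_integral.

Lemma torus_measure_cube (R : realType) d : torus_measure d (~` @cube R d) = 0%E.
Proof.
have mC n : measurable (~` @cube R n) by apply: measurableC; exact: measurable_cube.
suff cube1 : torus_measure d (@cube R d) = 1%E.
  by rewrite probability_setC ?cube1 ?subee//; exact: measurable_cube.
elim: d => [|d IH].
  rewrite (_ : @cube R 0 = setT) ?probability_setT//.
  by apply/seteqP; split => // x _; case.
transitivity (((@interval_measure R) \x torus_measure d)%E (@colvec_cons R d @^-1` (@cube R d.+1))) => //.
have -> : @colvec_cons R d @^-1` (@cube R d.+1) =
    (`[- 2^-1, 2^-1[%classic : set (measurableTypeR R)) `*` @cube R d.
  apply/seteqP; split => -[t v] /=.
    move=> tv; split => /=.
      by have := tv ord0; rewrite mxE unlift_none /= in_itv.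
    by move=> i; have := tv (lift ord0 i); rewrite mxE liftK.
  rewrite in_itv /= => -[tP vP] i; rewrite mxE.
  by case: (unliftP ord0 i) => [j _|_] //=; exact: vP.
rewrite product_measure1E//; last exact: measurable_cube.
have im1 : interval_measure (`[- 2^-1, 2^-1[%classic : set (measurableTypeR R)) = 1%E.
  rewrite /interval_measure /mrestr setIid.
  have lt2 : (- 2^-1 < 2^-1 :> R) by lra.
  by rewrite lebesgue_measure_itv /= lte_fin lt2 -EFinD; congr EFin; lra.
by apply: (etrans (congr2 (fun x y => x * y)%E im1 IH)); rewrite mule1.
Qed.

Section cell_tiling.
Context {R : realType} {d : nat}.
Variable a : 'I_d -> int.
Hypothesis a_neq0 : forall i, a i != 0.
Hypothesis a_gt1 : forall i, a i = 1 \/ 1 < `|a i|.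
Local Notation V := 'cV[R]_d.
Local Notation mu := (@torus_measure R d).
Local Notation D := (@cell R d a).
Local Notation N := (size D).
Local Notation pt := (@cell_point R d a).
Local Notation A := (@diagR R d a).
Local Notation mean := (mean_on_nodes a).

Let base : set V := [set x | forall i, - 2^-1 <= (a i)%:~R * x i 0 < 2^-1].

Let baseE : [set invmx A *m y | y in @cube R d] = base.
Proof.
apply/seteqP; split => [_ [y yc <-] i|x xS].
  by rewrite invmx_diagR_mulE// mulrC divfK ?aR_neq0//; exact: yc.
exists (A *m x); first by move=> i; rewrite diagR_mulE; exact: xS.
by rewrite mulKmx// diagR_unit.
Qed.

(** The base cell is made periodic, so that the invariance of the integral under
   translations of the torus applies to its indicator function. *)
Let tiles : set V := [set x | forall i, exists n : int,
  - 2^-1 <= (a i)%:~R * (x i 0 - n%:~R) < 2^-1].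

Let measurable_base : measurable base.
Proof.
apply: (@measurable_coordwise _ _ (fun i => [set t : R | - 2^-1 <= (a i)%:~R * t < 2^-1])) => i.
have mf : measurable_fun setT (fun t : measurableTypeR R => (a i)%:~R * t : measurableTypeR R).
  exact: measurable_funM.
rewrite -[X in measurable X]setTI.
have := mf measurableT _ (measurable_itv `[- 2^-1, 2^-1[).
by congr measurable; congr (_ `&` _); apply/seteqP; split => t /=; rewrite in_itv.
Qed.

Let measurable_tiles : measurable tiles.
Proof.
apply: (@measurable_coordwise _ _ (fun i => [set t : R | exists n : int,
  - 2^-1 <= (a i)%:~R * (t - n%:~R) < 2^-1])) => i.
rewrite (_ : [set _ | _] = \bigcup_(n in setT) [set t : R | - 2^-1 <= (a i)%:~R * (t - n%:~R) < 2^-1]).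
  apply: countable_bigcupT_measurable => // n.
  have mf : measurable_fun setT (fun t : measurableTypeR R => (a i)%:~R * (t - n%:~R) : measurableTypeR R).
    by apply: measurable_funM => //; exact: measurable_funB.
  rewrite -[X in measurable X]setTI.
  have := mf measurableT _ (measurable_itv `[- 2^-1, 2^-1[).
  by congr measurable; congr (_ `&` _); apply/seteqP; split => t /=; rewrite in_itv.
by apply/seteqP; split => [t [n tn]|t [n _ tn]]; exists n.
Qed.

Let tiles_cover x : exists2 l, l \in D & tiles (x - pt l).
Proof.
pose k : 'cV[int]_d := \col_i Num.floor ((a i)%:~R * x i 0 + 2^-1).
exists (@cell_mod R d a k); first exact: cell_mod_mem.
move=> i; exists (@cell_quot R d a k i 0).
have -> : (x - pt (@cell_mod R d a k)) i 0 = x i 0 - pt (@cell_mod R d a k) i 0 by rewrite !mxE.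
rewrite /cell_mod -dilateN cell_pointD_dilate//.
rewrite [(- cell_quot _ _) i 0]mxE rmorphN /=.
have -> : (a i)%:~R * (x i 0 - (pt k i 0 - (@cell_quot R d a k i 0)%:~R) - (@cell_quot R d a k i 0)%:~R) =
    (a i)%:~R * x i 0 - (k i 0)%:~R :> R.
  by rewrite [pt k _ _]mxE; field; exact: aR_neq0.
rewrite mxE; set z := _ * _; have := floor_itv (z + 2^-1); rewrite intrD => /andP[h1 h2].
have half : (2^-1 + 2^-1 = 1 :> R) by field.
lra.
Qed.

(** The translates of the base cell by the nodes tile the torus. *)
Lemma integral_node_periodic_le (G : V -> \bar R) :
  measurable_fun setT G -> (forall x, 0 <= G x)%E ->
  (forall x k, G (x - pt k) = G x) ->
  (\int[mu]_x G x <= N%:R%:E * \int[mu]_(x in [set invmx A *m y | y in @cube R d]) G x)%E.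
Proof.
move=> mG G0 pG; rewrite baseE.
have pGz : operiodic G.
  by move=> n x; rewrite -(pG x (dilate a (- n))) cell_point_dilate// -[X in _ - X]/(zvec _) /zvec map_mxN opprK.
pose F := G \_ tiles.
have mF : measurable_fun setT F.
  by apply/(measurable_restrictT G measurable_tiles); exact: measurable_funTS.
have F0 x : (0 <= F x)%E by exact: erestrict_ge0.
have pF : operiodic F.
  move=> n x; rewrite /F !patchE pGz; suff -> : (x + zvec n \in tiles) = (x \in tiles) by [].
  apply/idP/idP => /set_mem h; apply/mem_set => i; have [m hm] := h i.
    exists (m - n i 0); move: hm; rewrite !mxE.
    have -> : x i 0 - (m - n i 0)%:~R = x i 0 + (n i 0)%:~R - m%:~R :> R by rewrite rmorphB /=; ring.
    by [].
  exists (m + n i 0); move: hm; rewrite !mxE.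
  have -> : x i 0 + (n i 0)%:~R - (m + n i 0)%:~R = x i 0 - m%:~R :> R by rewrite rmorphD /=; ring.
  by [].
have mFl l : measurable_fun setT (fun x => F (- pt l + x)).
  by apply: (measurableT_comp mF); exact: measurable_addl.
apply: (@le_trans _ _ (\int[mu]_x \sum_(l <- D) F (- pt l + x)%R)%E).
  apply: ge0_le_integral => //.
  - exact: emeasurable_sum.
  - move=> x _; have [l lD xl] := tiles_cover x.
    rewrite (bigD1_seq l)//=; last exact: uniq_cell.
    rewrite [X in F X]addrC {1}/F patchE mem_set// pG.
    by rewrite leeDl// sume_ge0.
rewrite ge0_integral_sum//.
have e l : (\int[mu]_x F (- pt l + x)%R = \int[mu]_x F x)%E by exact: ge0_integral_torus_shift.
under eq_bigr do rewrite e.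
have FG : (\int[mu]_x F x <= \int[mu]_(x in base) G x)%E.
  rewrite -integral_mkcond (ge0_negligible_integral (N := ~` @cube R d))//; last 3 first.
  - by apply: measurableC; exact: measurable_cube.
  - exact: measurable_funTS.
  - exact: torus_measure_cube.
  apply: ge0_subset_integral => //.
  - by apply: measurableD => //; apply: measurableC; exact: measurable_cube.
  - exact: measurable_funTS.
  move=> x [xt /contrapT xc] i; have [n xn] := xt i.
  (* If [a i] is not [1], the side of the base cell is at most 1/2, so that its
     other integer translates do not meet the cube. *)
  suff n0 : n = 0 by rewrite n0 subr0 in xn.
  have := xc i; case: (a_gt1 i) => [a1 | a1] xi.
    have h1 : n%:~R < 1%:~R :> R by rewrite -[1%:~R]/(1 : R); rewrite a1 mul1r in xn; lra.
    have h2 : (-1)%:~R < n%:~R :> R by rewrite rmorphN /= -[1%:~R]/(1 : R); rewrite a1 mul1r in xn; lra.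
    by move: h1 h2; rewrite !ltr_int; lia.
  have : `|x i 0 - n%:~R| <= 2^-1 / 2.
    have : `|(a i)%:~R * (x i 0 - n%:~R)| <= 2^-1.
      by rewrite ler_norml; case/andP: xn => -> /ltW ->.
    have a1R : 2 <= `|(a i)%:~R| :> R by rewrite -intr_norm (ler_int _ 2).
    rewrite normrM => h'; have := normr_ge0 (x i 0 - n%:~R); nra.
  rewrite ler_norml => xn'.
  have h1 : n%:~R < 1%:~R :> R by rewrite -[1%:~R]/(1 : R); lra.
  have h2 : (-1)%:~R < n%:~R :> R by rewrite rmorphN /= -[1%:~R]/(1 : R); lra.
  by move: h1 h2; rewrite !ltr_int; lia.
have FI0 : (0 <= \int[mu]_x F x)%E by exact: integral_ge0.
apply: le_trans (lee_wpmul2l _ FG); last by rewrite lee_fin.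
rewrite le_eqVlt; apply/orP; left; apply/eqP.
by rewrite big_const_seq count_predT iter_addr_0 mule_natl.
Qed.

(** The mean over the nodes is invariant under the translations by the nodes. *)
Lemma Lpnorm_mean_on_nodes_cell (r : R) (h : V -> R[i]) : 1 <= r ->
  zperiodic h -> cmeasurable h ->
  (Lpnorm r%:E (fun x => (mean h x)%:C)%R <=
   (N%:R%:E * \int[mu]_(x in [set invmx A *m y | y in @cube R d]) (mean h x `^ r)%:E) `^ r^-1)%E.
Proof.
move=> r1 ph mh; rewrite LpnormE.
have r0 : 0 < r := lt_le_trans ltr01 r1.
have e : (\int[mu]_x (normc (mean h x)%:C `^ r)%:E = \int[mu]_x (mean h x `^ r)%:E)%E.
  by apply: eq_integral => x _; rewrite normcR ger0_norm ?mean_on_nodes_ge0.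
rewrite e; apply: gt0_ler_poweR.
- by rewrite invr_ge0 ltW.
- by rewrite in_itv /= leey andbT integral_ge0// => x _; rewrite lee_fin powR_ge0.
- rewrite in_itv /= leey andbT mule_ge0 ?lee_fin// integral_ge0// => x _.
  by rewrite lee_fin powR_ge0.
apply: integral_node_periodic_le.
- by apply/measurable_EFinP; apply: measurable_fun_powR; exact: measurable_mean_on_nodes.
- by move=> x; rewrite lee_fin powR_ge0.
- by move=> x k; rewrite mean_on_nodes_shift.
Qed.

End cell_tiling.

(** * Continuous functions on the torus *)

Section continuous_torus_functions.
Context {R : realType} {d : nat}.
Local Notation V := 'cV[R]_d.
Local Notation mu := (@torus_measure R d).
Implicit Types (g : V -> R) (f : V -> R[i]) (x y : V).

Definition grid_index (m : nat) x : lattice d := \col_i Num.floor (m.+1%:R * x i 0).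

Definition grid_point (m : nat) (k : lattice d) : V := \col_i ((k i 0)%:~R / m.+1%:R).

Lemma measurable_grid_index m : measurable_fun setT (grid_index m).
Proof.
move=> _ Y _; rewrite setTI.
rewrite (_ : _ @^-1` Y = \bigcup_(k in setT) (if k \in Y then
  [set x : V | forall i, k i 0 = Num.floor (m.+1%:R * x i 0)] else set0)); last first.
  apply/seteqP; split=> [x xY|x [k _]].
    exists (grid_index m x) => //; rewrite mem_set// => i; by rewrite mxE.
  case: ifPn => // /set_mem kY h; rewrite /preimage /=; suff -> : grid_index m x = k by [].
  by apply/matrixP => i j; rewrite !mxE ord1 -h.
apply: countable_bigcupT_measurable; first exact: (countableP (T := 'cV[int]_d)).
move=> k; case: ifPn => _; last exact: measurable0.
apply: (@measurable_coordwise _ _ (fun i => [set t : R | k i 0 = Num.floor (m.+1%:R * t)])) => i.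
have mf : measurable_fun setT (fun t : measurableTypeR R => m.+1%:R * t : measurableTypeR R).
  exact: measurable_funM.
rewrite -[X in measurable X]setTI.
have := mf measurableT _ (measurable_itv `[(k i 0)%:~R, (k i 0 + 1)%:~R[).
congr measurable; congr (_ `&` _); apply/seteqP; split => t /=; rewrite in_itv /=.
  by move/floor_def.
by move=> ->; exact: floor_itv.
Qed.

Lemma grid_cvg x : (fun m => grid_point m (grid_index m x)) @ \oo --> x.
Proof.
apply/cvg_ballP => e e0.
near=> m.
split=> // i j; rewrite ord1 !mxE /ball /=.
have m0 : 0 < m.+1%:R :> R by [].
have me : m.+1%:R^-1 < e by near: m; exact: (near_infty_natSinv_lt (PosNum e0)).
have /andP[h1 h2] := floor_itv (m.+1%:R * x i 0).
have -> : x i 0 - (Num.floor (m.+1%:R * x i 0))%:~R / m.+1%:R =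
   (m.+1%:R * x i 0 - (Num.floor (m.+1%:R * x i 0))%:~R) / m.+1%:R by field.
apply: le_lt_trans me.
rewrite ger0_norm ?divr_ge0 ?subr_ge0// ler_pdivrMr// mulVf ?gt_eqF//.
by rewrite lerBlDl ltW// -[X in _ < _ + X]/(1%:~R) -intrD.
Unshelve. all: by end_near.
Qed.

(** A continuous function is the pointwise limit of its step approximations,
   which factor through the countable discrete space Z^d. *)
Lemma continuous_measurable_colvec g : continuous g -> measurable_fun setT g.
Proof.
move=> cg; apply: (@measurable_fun_cvg _ _ _ _ (fun m x => g (grid_point m (grid_index m x)))).
  move=> m; exact: (measurableT_comp (measurable_lattice (fun k => g (grid_point m k))) (measurable_grid_index m)).
by move=> x _; apply: continuous_cvg; [exact: cg|exact: grid_cvg].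
Qed.

(** The fundamental cube is compact, as the transpose of a product of segments. *)
Lemma continuous_periodic_bounded g : continuous g -> (forall k x, g (x + zvec k) = g x) ->
  exists b : R, forall x, `|g x| <= b.
Proof.
move=> cg pg.
pose K := [set v : 'rV[R]_d | forall i, v ord0 i \in `[- 2^-1, 2^-1]].
have cK : compact K.
  have := @rV_compact R d (fun _ => `[- 2^-1, 2^-1]%classic).
  by apply => i; exact: (@segment_compact R).
pose F (v : 'rV[R]_d) := g v^T.
have ctr : continuous (fun v : 'rV[R]_d => v^T).
  move=> v P [U nU UP]; exists (fun i j => U j i).
    by move=> i j; have := nU j i; rewrite mxE.
  by move=> w Uw; apply: UP => i j; rewrite mxE; exact: Uw.
have cF : continuous F.
  by move=> v P /(cg v^T) /(ctr v).
have K0 : K !=set0.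
  by exists 0 => i; rewrite /= in_itv /= mxE oppr_le0 invr_ge0 ler0n.
have [v _ vmax] := compact_EVT_max K0 cK (continuous_subspaceT cF).
have [w _ wmin] := compact_EVT_min K0 cK (continuous_subspaceT cF).
exists (`|F v| + `|F w|) => x.
pose n : 'cV[int]_d := \col_i Num.floor (x i 0 + 2^-1).
have <- : g (x - zvec n) = g x by rewrite -(pg n) subrK.
have xK : (x - zvec n)^T \in K.
  apply/mem_set => i; rewrite in_itv /= !mxE.
  have := floor_itv (x i 0 + 2^-1); rewrite intrD => /andP[h1 h2].
  have half : (2^-1 + 2^-1 = 1 :> R) by field.
  lra.
have := vmax _ xK; have := wmin _ xK; rewrite {2 3}/F trmxK => h1 h2.
have := ler_norm (F v); have := ler_norm (- F w); rewrite normrN => h3 h4.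
have := normr_ge0 (F v); have := normr_ge0 (F w) => h5 h6.
by rewrite ler_norml; lra.
Qed.

Lemma in_Xp_in_Lp p f : (1 <= p)%E -> in_Xp p f -> in_Lp p f.
Proof.
move=> p1; rewrite /in_Xp; case: eqP => [->|//] [pf [c1 c2]].
have mf : cmeasurable f by split; exact: continuous_measurable_colvec.
have [b1 fb1] : exists b : R, forall x, `|Re (f x)| <= b.
  by apply: continuous_periodic_bounded => // k x; rewrite pf.
have [b2 fb2] : exists b : R, forall x, `|Im (f x)| <= b.
  by apply: continuous_periodic_bounded => // k x; rewrite pf.
split => //; apply: (@le_lt_trans _ _ (b1 + b2)%:E); last exact: ltry.
apply: Lpnorm_le_bound => //; first exact: leey.
  by apply: addr_ge0; [exact: le_trans (fb1 0)|exact: le_trans (fb2 0)].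
move=> x.
have -> : f x = (Re (f x))%:C + 'i * (Im (f x))%:C.
  by apply: complexP; rewrite ?ReD ?ImD ?ReM ?ImM /=; ring.
apply: (le_trans (le_normcD _ _)); apply: lerD; first by rewrite normcR.
by rewrite Normc.normcM normcR /= expr0n /= expr1n add0r sqrtr1 mul1r.
Qed.

End continuous_torus_functions.

(** * Error estimates for one diagonal matrix *)

Section error_estimates.
Context {R : realType} {d : nat}.
Variable a : 'I_d -> int.
Hypothesis a_neq0 : forall i, a i != 0.
Local Notation V := 'cV[R]_d.
Local Notation mu := (@torus_measure R d).
Local Notation D := (@cell R d a).
Local Notation N := (size D).
Local Notation pt := (@cell_point R d a).
Local Notation C3 := (@vp_const R d).
Local Notation poly := (cellpoly a).
Local Notation synth := (synthesis a).
Local Notation mean := (mean_on_nodes a).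
Implicit Types (k l n t : 'cV[int]_d) (x y : V) (b c e : 'cV[int]_d -> R[i]).

Lemma cellpoly_in_Lp p c : (1 <= p)%E -> in_Lp p (poly c).
Proof.
move=> p1; have [pc mc [b cb]] := cellpoly_in_B a c; split => //.
apply: (@le_lt_trans _ _ b%:E); last exact: ltry.
by apply: Lpnorm_le_bound => //; apply: le_trans (cb 0); exact: normc_ge0.
Qed.

Lemma in_LpB p (f g : V -> R[i]) : (1 <= p)%E -> in_Lp p f -> in_Lp p g -> in_Lp p (f \- g).
Proof.
move=> p1 [pf mf foo] [pg mg goo]; split.
- by move=> k x /=; rewrite pf pg.
- exact: cmeasurableB.
- by apply: le_lt_trans (LpnormB p1 mf mg) _; exact: lte_add_pinfty.
Qed.

Lemma cmeasurable_synthesis c (w : lattice d -> R[i]) : cmeasurable (synth c w).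
Proof.
apply: cmeasurableM; first exact: cmeasurable_cst.
apply: cmeasurable_sum => k; apply: cmeasurableM; first exact: cmeasurable_cst.
by apply: cmeasurable_shift; have [] := cellpoly_in_B a c.
Qed.

(** The operator reproduces [poly b] from the samples of [poly (e * b)], so its error
   on [f] is [f - poly b] plus the synthesis of the differences of the samples of
   [poly (e * b)] and [g]. *)
Lemma error_le_onesided p q c b e b0 b1 (f g u : V -> R[i]) :
  (1 <= p)%E -> (1 <= q)%E -> (p^-1 + q^-1 = 1)%E -> in_Lp p f -> in_B g -> in_B u ->
  (forall l, l \in D -> b l != 0 -> c l * e l = 1) ->
  (forall l, fourier g l = fourier (poly (fun l => e l * b l)) l + fourier u l) ->
  (forall x, [/\ poly b0 x \is Num.real, poly b0 x <= g x & g x <= poly b1 x]) ->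
  (Lpnorm p (f \- synth c (fun k => g (pt k))) <= Lpnorm p (f \- poly b) +
    C3%:E * conv_norm (poly c) q *
    (C3%:E * (Lpnorm p (poly b0 \- poly b1) + Lpnorm p (poly b0 \- poly b1) + Lpnorm p u)))%E.
Proof.
move=> p1 q1 pq [pf mf foo] Bg Bu ce gu gb.
have [pb mb _] := cellpoly_in_B a b.
set w := fun k : lattice d => poly (fun l => e l * b l) (pt k) - g (pt k).
have -> : f \- synth c (fun k => g (pt k)) = fun x => (f \- poly b) x + synth c w x.
  apply/funext => x; rewrite /= synthesisB synthesis_exact//.
  by rewrite [RHS]addrA subrK.
apply: le_trans (LpnormD p1 (cmeasurableB mf mb) (cmeasurable_synthesis c w)) _.
apply: leeD2l; apply: le_trans (synthesis_le_samples a_neq0 c w p1 q1 pq) _.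
apply: lee_wpmul2l; last exact: onesided_samples.
by rewrite mule_ge0// ?lee_fin ?vp_const_ge0// conv_norm_ge0.
Qed.

Lemma convolution_cellpolyC q b (h : V -> R[i]) : (1 <= q)%E -> in_Lp q h ->
  convolution h (poly b) = poly (fun l => fourier h l * b l).
Proof.
move=> q1 [ph mh hoo]; have hi := Lpnorm_integrable q1 mh hoo.
have [pb mb _] := cellpoly_in_B a b.
have -> : (fun l => fourier h l * b l) = (fun l => b l * fourier h l).
  by apply/funext => l; rewrite mulrC.
rewrite -convolution_cellpoly//; apply/funext => x; rewrite /convolution.
rewrite -(@cintegral_reflect _ _ x (fun y => poly b (x - y) * h y)).
- by congr cintegral; apply/funext => y; rewrite subKr mulrC.
- by apply: cmeasurableM => //; exact: cmeasurable_reflect.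
- by move=> k y; rewrite ph opprD addrA -[in LHS](pb k) subrK.
Qed.

(** By linearity of the convolution the operator is here applied to [f - poly b]
   only, and [node_pairing_convolution_le] bounds the samples. *)
Lemma error_le_convolution p q c b (h f : V -> R[i]) :
  (1 <= p)%E -> (1 <= q)%E -> (p^-1 + q^-1 = 1)%E -> in_Lp q h -> in_Lp p f ->
  (forall l, l \in D -> b l != 0 -> c l * fourier h l = 1) ->
  (Lpnorm p (f \- synth c (fun k => convolution h f (pt k))) <=
   (1 + C3%:E * conv_norm (poly c) q * Lpnorm q (fun x => (mean h x)%:C)%R) *
     Lpnorm p (f \- poly b))%E.
Proof.
move=> p1 q1 pq Lh Lf ce; have Lb := @cellpoly_in_Lp p b p1.
have Lv := in_LpB p1 Lf Lb; set v := f \- poly b.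
have K0 : (0 <= C3%:E * conv_norm (poly c) q)%E.
  by rewrite mule_ge0// ?lee_fin ?vp_const_ge0// conv_norm_ge0.
set w := fun k : lattice d => convolution h v (pt k).
have wE k : w k = convolution h f (pt k) - poly (fun l => fourier h l * b l) (pt k).
  rewrite -(convolution_cellpolyC b q1 Lh).
  suff -> : convolution h f (pt k) = convolution h v (pt k) + convolution h (poly b) (pt k).
    by rewrite addrK.
  rewrite -cintegralD; [|exact: (convolution_integrable (pt k) p1 q1 pq Lh)..].
  by congr cintegral; apply/funext => y; rewrite -mulrDr subrK.
have -> : f \- synth c (fun k => convolution h f (pt k)) = fun x => v x - synth c w x.
  apply/funext => x; have -> : w = fun k => convolution h f (pt k) -
      poly (fun l => fourier h l * b l) (pt k) by exact/funext.
  by rewrite synthesisB synthesis_exact// /v /= opprB addrA subrK.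
have [_ mv _] := Lv.
apply: le_trans (LpnormB p1 mv (cmeasurable_synthesis c w)) _.
rewrite ge0_muleDl ?mul1e//; last by rewrite mule_ge0// Lpnorm_ge0.
apply: leeD2l; rewrite -muleA; apply: synthesis_bound => //.
  by rewrite mule_ge0// Lpnorm_ge0.
by move=> beta; exact: node_pairing_convolution_le.
Qed.

End error_estimates.

(** An affine upper bound valid for every approximant passes to the best
   approximation, the constant term being finite and the slope positive and finite. *)
Lemma le_affine_ereal_inf (R : realType) (S : set \bar R) (L X : \bar R) (y : R) :
  0 < y -> X \is a fin_num -> (forall s, S s -> (L <= X + y%:E * s)%E) ->
  (L <= X + y%:E * ereal_inf S)%E.
Proof.
move=> y0 Xf LS; rewrite -leeBlDl// -lee_pdivrMl//; apply: le_ereal_inf_tmp => s Ss.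
by rewrite lee_pdivrMl// leeBlDl//; exact: LS.
Qed.

(** * Powers of the dilation matrix *)

Section dilation_matrix.
Context {R : realType} {d : nat}.
Variable M : 'M[int]_d.
Hypothesis M_diag : is_diag_mx M.
Hypothesis M_gt1 : forall i, 1 < `|M i i|.
Variable j : nat.

Definition dilation_entry (i : 'I_d) : int := M i i ^+ j.

Lemma dilation_entry_neq0 i : dilation_entry i != 0.
Proof. by rewrite expf_neq0// -normr_gt0 (lt_trans _ (M_gt1 i)). Qed.

Lemma dilation_entry_gt1 i : dilation_entry i = 1 \/ 1 < `|dilation_entry i|.
Proof.
rewrite /dilation_entry; case: j => [|n]; first by left.
by right; rewrite normrX exprn_egt1.
Qed.

Lemma dilationE : dilation M j = @diagR R d dilation_entry.
Proof.
rewrite /dilation /dilation_entry; elim: j => [|n IH].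
  rewrite expr0 -[RHS]/(diag_mx _); apply/matrixP => i k; rewrite !mxE.
  by rewrite /= -[_^+ 0]/(1 : int).
rewrite exprS IH -mulmxE mul_mx_diag; apply/matrixP => i k; rewrite !mxE.
have [->|ik] := eqVneq i k; first by rewrite exprS rmorphM mulr1n.
by rewrite (is_diag_mxP M_diag)// mul0r mulr0n.
Qed.

Lemma absdet_dilation : absdet M ^+ j = (size (@cell R d dilation_entry))%:R :> R.
Proof.
rewrite size_cell /absdet; last exact: dilation_entry_neq0.
have -> : \det M = \prod_i M i i.
  have -> : M = diag_mx (\row_i M i i).
    apply/matrixP => i k; rewrite !mxE.
    have [->|ik] := eqVneq i k; first by rewrite mulr1n.
    by rewrite (is_diag_mxP M_diag)// mulr0n.
  by rewrite det_diag; apply: eq_bigr => i _; rewrite !mxE eqxx mulr1n.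
rewrite normr_prod rmorph_prod /= -prodrXl natr_prod; apply: eq_bigr => i _.
by rewrite /dilation_entry natr_absz normrX rmorphXn.
Qed.

Lemma nodeE k : node M j k = @cell_point R d dilation_entry k.
Proof. by rewrite /node dilationE cell_pointE//; exact: dilation_entry_neq0. Qed.

Lemma fsbig_cell (T : nmodType) (F : 'cV[int]_d -> T) :
  \sum_(k \in freqs (@dilation R d M j)) F k = \sum_(k <- @cell R d dilation_entry) F k.
Proof.
by rewrite dilationE fsbig_finite//; apply: finite_cell; exact: dilation_entry_neq0.
Qed.

Lemma quasi_interpE (g : 'cV[R]_d -> R[i]) c :
  quasi_interp M j g (cellpoly dilation_entry c) =
  synthesis dilation_entry c (fun k => g (@cell_point R d dilation_entry k)).
Proof.
apply/funext => x; rewrite /quasi_interp /synthesis fsbig_cell absdet_dilation.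
by congr (_ * _); apply: eq_bigr => k _; rewrite nodeE.
Qed.

Lemma node_meanE (h : 'cV[R]_d -> R[i]) : node_mean M j h = mean_on_nodes dilation_entry h.
Proof.
apply/funext => x; rewrite /node_mean /mean_on_nodes fsbig_cell absdet_dilation.
by congr (_ * _); apply: eq_bigr => k _; rewrite nodeE.
Qed.

Lemma Lpnorm_mean_le_Lqj q (h : 'cV[R]_d -> R[i]) : (1 <= q)%E -> zperiodic h -> cmeasurable h ->
  (Lpnorm q (fun x => (mean_on_nodes dilation_entry h x)%:C)%R <= Lqj_norm M j q h)%E.
Proof.
move=> q1 ph mh; case: q q1 => [r| |//] q1 /=.
  rewrite node_meanE absdet_dilation dilationE.
  apply: Lpnorm_mean_on_nodes_cell => //; [exact: dilation_entry_neq0|exact: dilation_entry_gt1].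
rewrite LpnormyE; apply/ess_supP/aeW => x.
rewrite normcR ger0_norm ?mean_on_nodes_ge0//.
by apply: ereal_sup_ubound; exists x => //; rewrite node_meanE.
Qed.

End dilation_matrix.

Theorem theorem4p1 (R : realType) (d : nat) (d_gt0 : (0 < d)%N)
    (p q : \bar R) (p_ge1 : (1 <= p)%E) (q_ge1 : (1 <= q)%E)
    (pq_conj : (p^-1 + q^-1 = 1)%E)
    (delta rho : R) (delta_gt0 : 0 < delta) (delta_le_rho : delta <= rho)
    (rho_le1 : rho <= 1)
    (c : nat -> \bar R -> R -> R) (c_gt0 : 0 < c d p delta)
    (M : 'M[int]_d) (M_diag : is_diag_mx M) (M_gt1 : forall i, 1 < `|M i i|)
    (psi : nat -> periodic_distribution R d) (phi : nat -> 'cV[R]_d -> R[i])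
    (phi_trig : forall j, trigpoly (dilation M j) (phi j))
    (phi_psi : forall j k, freqs (rho *: dilation M j) k ->
       fourier (phi j) k * dfourier (psi j) k = 1) :
  exists2 C : R, 0 < C & forall j : nat,
    (forall f g : 'cV[R]_d -> R[i], in_Xp p f -> is_dconv (psi j) f g ->
     forall T : 'cV[R]_d -> R[i], trigpoly (rho *: dilation M j) T ->
     (Lpnorm p (f \- T) <=
        (c d p delta)%:E * best_approx (delta *: dilation M j) p f)%E ->
     forall u : 'cV[R]_d -> R[i], is_dconv (psi j) (f \- T) u ->
     (Lpnorm p (f \- quasi_interp M j g (phi j)) <=
        C%:E * (best_approx (delta *: dilation M j) p f +
                conv_norm (phi j) q *
                (best_onesided_approx (dilation M j) p g + Lpnorm p u)))%E) /\
    (forall h : 'cV[R]_d -> R[i], in_Lp q h -> represents (psi j) h ->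
     forall f : 'cV[R]_d -> R[i], in_Xp p f ->
     (Lpnorm p (f \- quasi_interp M j (convolution h f) (phi j)) <=
        C%:E * ((1 + conv_norm (phi j) q * Lqj_norm M j q h) *
                best_approx (delta *: dilation M j) p f))%E).
Proof.
have C3_ge1 : 1 <= @vp_const R d by rewrite /vp_const ler1n expn_gt0.
set C3 := @vp_const R d in C3_ge1.
have C3_gt0 : 0 < C3 := lt_le_trans ltr01 C3_ge1.
(* [c d p delta] pays for [f - T]; one factor [C3] comes from the synthesis and one
   from sampling, and the polynomial [t' - t] is sampled twice. *)
exists (c d p delta + 2 * C3 ^+ 2); first by rewrite ltr_wpDr// mulr_ge0// sqr_ge0.
set C := _ + _; have cC : c d p delta <= C by rewrite lerDl mulr_ge0// sqr_ge0.
have CC : 2 * C3 ^+ 2 <= C by rewrite lerDr ltW.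
have C0 : 0 < C by rewrite (lt_le_trans c_gt0).
move=> j.
pose a := dilation_entry M j.
have a0 : forall i, a i != 0 by exact: dilation_entry_neq0.
have AE : dilation M j = @diagR R d a by exact: dilationE.
have rho_gt0 : 0 < rho := lt_le_trans delta_gt0 delta_le_rho.
have [c' [_ phiE]] : exists c', (forall k, ~ freqs (1 *: @diagR R d a) k -> c' k = 0) /\
    phi j = cellpoly a c'.
  by apply: trigpoly_cellpoly => //; rewrite scale1r -AE; exact: phi_trig.
have rhoD l : freqs (rho *: @diagR R d a) l -> l \in @cell R d a.
  move=> lr; apply/(mem_cell a0); rewrite -[diagR a]scale1r.
  exact: freqs_scale_sub lr.
pose e := dfourier (psi j).
have ce l : freqs (rho *: @diagR R d a) l -> c' l * e l = 1.
  move=> lr; rewrite -(phi_psi j l); last by rewrite AE.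
  by rewrite phiE fourier_cellpoly// rhoD.
have zero_rho : freqs (rho *: @diagR R d a) 0 by exact: freqs0.
(* The multiplier norm must be positive for the bound to be infinite when [g] has no
   one-sided approximant; it must be finite to pass to the infimum. *)
have K0 : (0 < conv_norm (phi j) q)%E.
  rewrite phiE; apply: conv_norm_gt0 => //; last exact: rhoD.
  by apply: contra_eq_neq (ce _ zero_rho) => ->; rewrite mul0r eq_sym oner_eq0.
have : conv_norm (phi j) q \is a fin_num.
  by rewrite ge0_fin_numE ?ltW// phiE; exact: conv_norm_lty.
case KE : (conv_norm (phi j) q) => [k| |]// _.
have k0 : 0 < k by rewrite -lte_fin -KE.
have b_exact (s : R) (b : 'cV[int]_d -> R[i]) : 0 < s -> s <= rho ->
    (forall l, ~ freqs (s *: @diagR R d a) l -> b l = 0) ->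
    forall l, l \in @cell R d a -> b l != 0 -> c' l * e l = 1.
  move=> s0 srho bs l _ bl; apply: ce; apply: freqs_scale_sub srho _ => //.
  by apply: contrapT => /bs bl0; rewrite bl0 eqxx in bl.
have E0 f : (0 <= best_approx (delta *: dilation M j) p f)%E.
  by apply: le_ereal_inf_tmp => _ [T _ <-]; exact: Lpnorm_ge0.
split=> [f g Xf [Bg gE] T trigT TE u [Bu uE]|h Lh psih f Xf].
  have Lf := in_Xp_in_Lp p_ge1 Xf.
  have [b [bs Tb]] : exists b, (forall l, ~ freqs (rho *: @diagR R d a) l -> b l = 0) /\
      T = cellpoly a b by apply: trigpoly_cellpoly => //; rewrite -AE.
  rewrite Tb in trigT TE uE.
  have Lb := cellpoly_in_Lp a b p_ge1.
  have fin_Lp (v : 'cV[R]_d -> R[i]) : in_Lp p v -> Lpnorm p v \is a fin_num.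
    by move=> [_ _ voo]; rewrite ge0_fin_numE ?Lpnorm_ge0.
  have Lu : in_Lp p u.
    have [pu mu_ [bu ub]] := Bu; split => //; apply: (@le_lt_trans _ _ bu%:E); last exact: ltry.
    by apply: Lpnorm_le_bound => //; exact: le_trans (normc_ge0 _) (ub 0).
  have gu l : fourier g l = fourier (cellpoly a (fun l => e l * b l)) l + fourier u l.
    have [_ mf foo] := Lf; have [_ mb boo] := Lb.
    rewrite gE uE fourierB; [|exact: Lpnorm_integrable p_ge1 mf foo|exact: Lpnorm_integrable p_ge1 mb boo].
    by rewrite !fourier_cellpoly// mulrBr; case: ifP => _; rewrite ?mulr0 addrC subrK.
  case fbE : (Lpnorm p (f \- cellpoly a b)) (fin_Lp _ (in_LpB p_ge1 Lf Lb)) TE => [r1| |]// _ r1E.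
  case uE' : (Lpnorm p u) (fin_Lp _ Lu) => [r2| |]// _.
  have r20 : 0 <= r2 by rewrite -lee_fin -uE' Lpnorm_ge0.
  have y0 : 0 < 2 * C3 ^+ 2 * k by rewrite mulr_gt0// mulr_gt0// exprn_gt0.
  set Z := best_onesided_approx _ _ _.
  have Z0 : (0 <= Z)%E by apply: le_ereal_inf_tmp => _ [tT _ <-]; exact: Lpnorm_ge0.
  apply: (@le_trans _ _ ((r1 + C3 ^+ 2 * k * r2)%:E + (2 * C3 ^+ 2 * k)%:E * Z)%E).
    apply: le_affine_ereal_inf => // _ [[t t'] /= [trigt trigt' tt'] <-].
    have [b0 [_ tE]] : exists c', (forall k, ~ freqs (1 *: @diagR R d a) k -> c' k = 0) /\
      t = cellpoly a c' by apply: trigpoly_cellpoly => //; rewrite scale1r -AE.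
    have [b1 [_ t'E]] : exists c', (forall k, ~ freqs (1 *: @diagR R d a) k -> c' k = 0) /\
      t' = cellpoly a c' by apply: trigpoly_cellpoly => //; rewrite scale1r -AE.
    rewrite phiE quasi_interpE//; subst t t'.
    apply: le_trans (error_le_onesided a0 p_ge1 q_ge1 pq_conj Lf Bg Bu
      (b_exact rho b rho_gt0 (lexx _) bs) gu tt') _.
    rewrite fbE -phiE KE uE' -/C3.
    have := Lpnorm_ge0 p (cellpoly a b0 \- cellpoly a b1).
    case: (Lpnorm p _) => [s| |]// s0.
      by rewrite -!(EFinM, EFinD) lee_fin; nra.
    by rewrite [X in (_ <= _ + X)%E]gt0_muley ?lte_fin// addey// leey.
  rewrite ge0_muleDr//; last by rewrite mule_ge0 ?adde_ge0 ?lee_fin// ltW.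
  rewrite EFinD -addeA; apply: leeD.
    by apply: le_trans r1E _; apply: lee_wpmul2r.
  apply: (@le_trans _ _ ((2 * C3 ^+ 2)%:E * (k%:E * (Z + r2%:E)))%E); last first.
    by apply: lee_wpmul2r; rewrite ?lee_fin// mule_ge0 ?adde_ge0 ?lee_fin// ltW.
  rewrite muleA -EFinM ge0_muleDr ?lee_fin// addeC; apply: leeD2l.
  rewrite -EFinM lee_fin; have := sqr_ge0 C3; nra.
have Lf := in_Xp_in_Lp p_ge1 Xf; have [ph mh hoo] := Lh.
have eh : e = fourier h.
  apply/funext => l; rewrite /e /dfourier psih; last exact: smooth_cexp.
  by congr cintegral; apply/funext => x; rewrite mulrC.
set m := Lpnorm q (fun x => (mean_on_nodes a h x)%:C).
have mL : (m <= Lqj_norm M j q h)%E by exact: Lpnorm_mean_le_Lqj.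
have m0 : (0 <= m)%E by exact: Lpnorm_ge0.
have L0 := le_trans m0 mL.
have mh_le : (m <= Lpnorm q h)%E by exact: Lpnorm_mean_on_nodes_le.
have : m \is a fin_num by rewrite ge0_fin_numE// (le_lt_trans mh_le).
case mE : m => [r| |]// _; rewrite mE in m0 mL; rewrite lee_fin in m0.
have C30 : 0 <= C3 by rewrite (le_trans ler01).
apply: (@le_trans _ _ (0 + (1 + C3 * k * r)%:E * best_approx (delta *: dilation M j) p f)%E).
  apply: le_affine_ereal_inf => //.
    by rewrite ltr_pwDl// !mulr_ge0// ltW.
  move=> _ [T trigT <-]; rewrite add0e.
  have [b [bs Tb]] : exists b, (forall l, ~ freqs (delta *: @diagR R d a) l -> b l = 0) /\
      T = cellpoly a b.
    by apply: trigpoly_cellpoly; rewrite -?AE//; exact: le_trans delta_le_rho rho_le1.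
  rewrite Tb phiE quasi_interpE//.
  have := error_le_convolution a0 p_ge1 q_ge1 pq_conj Lh Lf (c := c') (b := b).
  rewrite -/m mE -phiE KE -/C3 -!(EFinM, EFinD); apply => l lD bl.
  by rewrite -eh; exact: (b_exact delta b delta_gt0 delta_le_rho bs l lD bl).
rewrite add0e muleA; apply: lee_wpmul2r => //.
rewrite ge0_muleDr//; last by rewrite mule_ge0// lee_fin ltW.
rewrite mule1 EFinD; apply: leeD; first by rewrite lee_fin; nra.
apply: (@le_trans _ _ (C%:E * (k%:E * r%:E))%E).
  by rewrite -!EFinM lee_fin -mulrA ler_wpM2r ?mulr_ge0 ?(ltW k0)//; nra.
apply: lee_wpmul2l; first by rewrite lee_fin ltW.
by apply: lee_wpmul2l; first by rewrite lee_fin ltW.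
Qed.
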